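(* Let $\tau_1,\tau_2,\tilde\tau_1,\tilde\tau_2\in L_2(0,1)$ be complex-valued, put $p=\tau_1'$, $q=\tau_2''$ (distributional derivatives, so $p\in W_2^{-1}(0,1)$, $q\in W_2^{-2}(0,1)$) and similarly $\tilde p=\tilde\tau_1'$, $\tilde q=\tilde\tau_2''$. Let $$F(x)=\begin{pmatrix}0&1&0&0\\-\tau_2&\tau_1&1&0\\\tau_1\tau_2&-\tau_1^2+2\tau_2&-\tau_1&1\\\tau_2^2&-\tau_1\tau_2&-\tau_2&0\end{pmatrix},$$ the associated matrix of $l_4(y)=y^{(4)}-(py')'+qy$, and let $\tilde F$ be defined analogously with $\tilde\tau_1,\tilde\tau_2$. Assume that $\mathcal L=(F,U,V)$ and $\tilde{\mathcal L}=(\tilde F,U,V)$ both satisfy the separation assumption. For $(i,j)\in\{(1,2),(1,3),(2,3)\}$ let $\mathfrak S_{ij}$ be the spectrum of the boundary value problem $y^{[4]}=\lambda y$, $U_i(y)=U_j(y)=0$, $V_3(y)=V_4(y)=0$, and $\tilde{\mathfrak S}_{ij}$ the analogous spectrum for $\tilde{\mathcal L}$. If $\mathfrak S_{12}=\tilde{\mathfrak S}_{12}$, $\mathfrak S_{13}=\tilde{\mathfrak S}_{13}$ and $\mathfrak S_{23}=\tilde{\mathfrak S}_{23}$, then $p=\tilde p$ in $W_2^{-1}(0,1)$ and $q=\tilde q$ in $W_2^{-2}(0,1)$.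
   Context: General setting (order $n$). Let $F(x)=[f_{k,j}(x)]_{k,j=1}^n$ be a complex-valued matrix function on $[0,1]$ with $f_{k,j}\equiv0$ for $j>k+1$, $f_{k,k+1}\equiv1$, $f_{k,k}\in L_2(0,1)$, $f_{k,j}\in L_1(0,1)$ for $k>j$, and $\operatorname{trace}F\equiv0$. Quasi-derivatives: $y^{[0]}=y$, $y^{[k]}=(y^{[k-1]})'-\sum_{j=1}^k f_{k,j}y^{[j-1]}$, $k=1,\dots,n$. Let $\mathcal D_F=\{y: y^{[k]}\in AC[0,1],\ k=0,\dots,n-1\}$. A solution of $y^{[n]}=\lambda y$ ($\lambda\in\mathbb C$) is a function $y\in\mathcal D_F$ with $y^{[n]}=\lambda y$ a.e. on $(0,1)$. Linear forms: $U_s(y)=y^{[n-s]}(0)$, $V_s(y)=y^{[n-s]}(1)$, $s=1,\dots,n$. Let $C_k(x,\lambda)$, $k=1,\dots,n$, be the solutions with $U_s(C_k)=\delta_{s,k}$. Put $\Delta_{k,k}(\lambda)=\det[V_s(C_r)]_{s,r=k+1}^n$ (with $\Delta_{n,n}\equiv1$), and for $j>k$ let $\Delta_{j,k}(\lambda)$ be obtained from $\Delta_{k,k}(\lambda)$ by replacing $C_j$ by $C_k$; these are entire functions of $\lambda$. Separation assumption: for each $1\le m\le n-1$, $\Delta_{m,m}$ and $\Delta_{m+1,m+1}$ have no common zeros. The problem $\mathcal L=(F,U,V)$ is this data; objects for $\tilde{\mathcal L}$ (built from $\tilde F$ in the same way) carry a tilde. The spectrum of a boundary value problem $y^{[n]}=\lambda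 y$, $W_1(y)=\dots=W_n(y)=0$, where each $W_i$ is one of the forms $U_s,V_s$, is the multiset of zeros, counted with multiplicities, of the entire function $\det[W_i(C_r(\cdot,\lambda))]_{i,r=1}^n$. Here $n=4$. *)

(* Defs.v *)
From HB Require Import structures.
From mathcomp Require Import all_boot all_order all_algebra.
From mathcomp Require Import all_classical all_reals all_analysis.
From mathcomp Require Import complex.
From Stdlib Require Import ClassicalEpsilon.
Set Implicit Arguments. Unset Strict Implicit. Unset Printing Implicit Defensive.
Import Order.TTheory GRing.Theory Num.Theory ComplexField Normc.
Local Open Scope ring_scope.
Local Open Scope complex_scope.

Section Defs.
Variable R : realType.
Local Notation C := R[i].
Local Notation mu := (@lebesgue_measure R).

Definition cRe (f : R -> C) : R -> R := fun t => complex.Re (f t).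
Definition cIm (f : R -> C) : R -> R := fun t => complex.Im (f t).

Definition cintegrable (D : set R) (f : R -> C) : Prop :=
  mu.-integrable D (EFin \o cRe f) /\ mu.-integrable D (EFin \o cIm f).

Definition cint (D : set R) (f : R -> C) : C :=
  (Rintegral mu D (cRe f)) +i* (Rintegral mu D (cIm f)).

Definition L2 (f : R -> C) : Prop :=
  measurable_fun `[(0:R), 1]%classic (cRe f) /\
  measurable_fun `[(0:R), 1]%classic (cIm f) /\
  mu.-integrable `[(0:R), 1]%classic
    (fun t => ((cRe f t) ^+ 2 + (cIm f t) ^+ 2)%:E).

Definition Fmat (tau1 tau2 : R -> C) (x : R) : 'M[C]_4 :=
  \matrix_(k < 4, j < 4)
    let t1 := tau1 x in let t2 := tau2 x in
    match nat_of_ord k, nat_of_ord j with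
    | 0, 1 => 1
    | 1, 0 => - t2 | 1, 1 => t1 | 1, 2 => 1
    | 2, 0 => t1 * t2 | 2, 1 => - t1 ^+ 2 + 2%:R * t2 | 2, 2 => - t1 | 2, 3 => 1
    | 3, 0 => t2 ^+ 2 | 3, 1 => - (t1 * t2) | 3, 2 => - t2
    | _, _ => 0
    end.

(* System matrix of y^[4] = lambda y for the vector Y = (y^[0], ..., y^[3]):
   (y^[k-1])' = y^[k] + sum_{j<=k} f_{k,j} y^[j-1] (k<4) and
   (y^[3])' = lambda y + sum_j f_{4,j} y^[j-1]. *)
Definition Amat (F : R -> 'M[C]_4) (lam : C) (x : R) : 'M[C]_4 :=
  F x + lam *: delta_mx (inord 3) (inord 0).

(* Y : R -> 'cV_4 is the vector of quasi-derivatives (y^[0],...,y^[3]) of a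
   solution y of y^[4] = lambda y: each y^[k] (k=0..3) is absolutely continuous
   on [0,1], i.e. an indefinite integral of an L_1 function, and the
   quasi-derivative relations hold a.e. *)
Definition is_qsol (F : R -> 'M[C]_4) (lam : C) (Y : R -> 'cV[C]_4) : Prop :=
  forall k : 'I_4,
    cintegrable `[(0:R), 1]%classic (fun t => (Amat F lam t *m Y t) k 0) /\
    forall x : R, 0 <= x <= 1 ->
      Y x k 0 = Y 0 k 0 + cint `[(0:R), x]%classic (fun t => (Amat F lam t *m Y t) k 0).

(* Linear forms (index s : 'I_4 stands for s+1):
   U_{s+1}(y) = y^[4-(s+1)](0),  V_{s+1}(y) = y^[4-(s+1)](1). *)
Definition Uf (s : 'I_4) (Y : R -> 'cV[C]_4) : C := Y 0 (rev_ord s) 0.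
Definition Vf (s : 'I_4) (Y : R -> 'cV[C]_4) : C := Y 1 (rev_ord s) 0.

Definition is_fund (F : R -> 'M[C]_4) (lam : C) (Cs : 'I_4 -> R -> 'cV[C]_4) : Prop :=
  forall k : 'I_4, is_qsol F lam (Cs k) /\
    forall s : 'I_4, Uf s (Cs k) = (s == k)%:R.

Definition fund (F : R -> 'M[C]_4) (lam : C) : 'I_4 -> R -> 'cV[C]_4 :=
  epsilon (inhabits (fun _ _ => 0)) (is_fund F lam).

(* Delta_{m,m}(lambda) = det [V_s(C_r)]_{s,r=m+1}^4  (Delta_{4,4} = 1) *)
Definition Delta (F : R -> 'M[C]_4) (m : nat) (lam : C) : C :=
  \det (\matrix_(s < 4 - m, r < 4 - m)
          Vf (inord (m + s)) (fund F lam (inord (m + r)))).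

Definition separation (F : R -> 'M[C]_4) : Prop :=
  forall m : nat, (1 <= m <= 3)%N ->
    forall lam : C, ~ (Delta F m lam = 0 /\ Delta F m.+1 lam = 0).

(* Characteristic function of  y^[4] = lambda y, U_i(y) = U_j(y) = V_3(y) = V_4(y) = 0
   (i, j : 'I_4 stand for i+1, j+1) *)
Definition Wform (i j : 'I_4) (a : 'I_4) (Y : R -> 'cV[C]_4) : C :=
  match nat_of_ord a with
  | 0 => Uf i Y | 1 => Uf j Y | 2 => Vf (inord 2) Y | _ => Vf (inord 3) Y
  end.

Definition charfun (F : R -> 'M[C]_4) (i j : 'I_4) (lam : C) : C :=
  \det (\matrix_(a < 4, r < 4) Wform i j a (fund F lam r)).

Definition zero_mult (f : C -> C) (z0 : C) (m : nat) : Prop :=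
  exists g : C -> C,
    (forall e : R, 0 < e -> exists d : R, 0 < d /\
       forall z, normc (z - z0) < d -> normc (g z - g z0) < e) /\
    g z0 <> 0 /\ forall z, f z = (z - z0) ^+ m * g z.

(* the spectra (multisets of zeros counted with multiplicity) coincide *)
Definition same_spectrum (f g : C -> C) : Prop :=
  forall (z0 : C) (m : nat), zero_mult f z0 m <-> zero_mult g z0 m.

(* test functions: smooth, compactly supported in (0,1); real-valued ones suffice
   by linearity of the pairing *)
Definition test_fun (phi : R -> R) : Prop :=
  (forall (k : nat) (x : R), derivable (iter k (@derive1 R R) phi) x 1) /\
  exists a b : R, 0 < a /\ a <= b /\ b < 1 /\
    forall x, x < a \/ b < x -> phi x = 0.

(* equality of the k-th distributional derivatives of f and g on (0,1):
   <f^(k), phi> = (-1)^k int f phi^(k) *)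
Definition distr_deriv_eq (k : nat) (f g : R -> C) : Prop :=
  forall phi : R -> R, test_fun phi ->
    cint `[(0:R), 1]%classic (fun t => f t * (iter k (@derive1 R R) phi t)%:C) =
    cint `[(0:R), 1]%classic (fun t => g t * (iter k (@derive1 R R) phi t)%:C).

End Defs.

(* Main.v *)
(**
Consider the solutions with y(1) = y^[1](1) = 0.  Their initial data at 0 form a plane whose Pluecker
coordinates are the 2x2 minors M_ij of the first two rows of the fundamental matrix at 1, and the
three characteristic functions are M_01, -M_02 and M_03.  These are entire of order 1/4, so equal
spectra make them proportional; on the ray lambda = -4 q^4, where the characteristic exponents are
q(+-1 +- i), the ratios M_02 / M_01 and M_03 / M_01 have universal asymptotics, so the constant c is
the same for the three of them.  The system is symplectic, whence M_12 = M_03, and by the Pluecker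
relation and the separation assumption (M_01 and M_02 have no common zero) M_01 divides
M_13 - c M~_13.  The quotient has order 1/4 and tends to 0 along the ray, so it vanishes by
Phragmen-Lindeloef: both problems have the same plane.  Hence the matrix P = Y Y~^-1, Y and Y~ being
the fundamental matrices, maps solutions decaying from 0 to such solutions, and growing ones to
growing ones, which gives P_kl = O(q^(k-l)) on the ray.  By Phragmen-Lindeloef again P is lower
triangular and independent of lambda, and then P' = F P - P F~, P(0) = 1 leaves no choice but
tau_1 = tau~_1 and tau_2 = tau~_2 almost everywhere.

Entire functions are taken to be locally uniform limits of polynomials, and absolutely continuous
functions to be indefinite integrals.
*)

(* All function theory rests on one source, the maximum principle for polynomials, proved by
   averaging over four points; limits of polynomials inherit it. Logarithms enter only through [ln]
   of a modulus, which for a zero-free function is a limit of real parts of polynomials, and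
   multiplicities are handled by dividing common zeros out of two functions, disc by disc.

   Since the entries of [F] are merely integrable, solutions are not expanded in powers of 1/q. A
   cone argument takes the place of asymptotics: [0, 1] is cut into blocks, independent of q, on
   which the integral of the norm of [F] is small, and each block costs a bounded factor. This
   yields bounds up to constants and ratios tending to 0, which is all that Phragmen-Lindeloef asks
   for. On the chosen ray two exponents grow and two decay at one common rate, so planes of
   solutions, rather than single solutions, are compared. The spectra fix tau_1 and tau_2
   themselves, and not only their derivatives, because the quasi-derivatives in the boundary
   conditions depend on them. *)
Require Import Defs.
From HB Require Import structures.
From mathcomp Require Import all_boot all_order all_algebra.
From mathcomp Require Import all_classical all_reals all_analysis.
From mathcomp Require Import complex measurable_realfun.
From mathcomp Require Import ring lra zify.
From Stdlib Require Import ClassicalEpsilon.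
Import Order.TTheory GRing.Theory Num.Theory ComplexField Normc.
Import numFieldNormedType.Exports.
Local Open Scope ring_scope.
Set Implicit Arguments. Unset Strict Implicit. Unset Printing Implicit Defensive.

(** * Polynomials and their uniform limits on discs *)

Section ComplexNorm.
Variable R : realType.
Local Notation C := R[i].
Implicit Types (z w : C) (x y : R).
Local Open Scope complex_scope.

Lemma nc_ge0 z : 0 <= normc z.
Proof. by case: z => x y; exact: sqrtr_ge0. Qed.

Lemma nc0 : normc (0 : C) = 0. Proof. exact: normc0. Qed.
Lemma nc1 : normc (1 : C) = 1. Proof. exact: normc1. Qed.

Lemma nc_eq0 z : (normc z == 0) = (z == 0).
Proof.
apply/eqP/eqP; [exact: eq0_normc | by move=> ->; exact: nc0].
Qed.

Lemma nc_gt0 z : (0 < normc z) = (z != 0).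
Proof. by rewrite lt_def nc_ge0 andbT nc_eq0. Qed.

Lemma nc_sqr z : normc z ^+ 2 = complex.Re z ^+ 2 + complex.Im z ^+ 2.
Proof. by case: z => x y /=; rewrite sqr_sqrtr // addr_ge0 ?sqr_ge0. Qed.

Lemma ncX z n : normc (z ^+ n) = normc z ^+ n.
Proof. by elim: n => [|n IH]; rewrite ?expr0 ?nc1 // !exprS normcM IH. Qed.

Lemma nc_real x : normc x%:C = `|x|.
Proof. by rewrite /= expr0n /= addr0 sqrtr_sqr. Qed.

Lemma nc_nat n : normc (n%:R : C) = n%:R.
Proof. by rewrite -[n%:R](rmorph_nat (real_complex R)) nc_real normr_nat. Qed.

Lemma ncB z w : normc (z - w) = normc (w - z).
Proof. by rewrite -normcN opprB. Qed.

Lemma nc_dist z w : normc z <= normc w + normc (z - w).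
Proof. by rewrite -{1}[z](subrKC w) le_normcD. Qed.

Lemma nc_sum (I : Type) (s : seq I) (P : pred I) (F : I -> C) :
  normc (\sum_(i <- s | P i) F i) <= \sum_(i <- s | P i) normc (F i).
Proof.
elim/big_ind2: _ => [|a b c d ab cd|//]; first by rewrite nc0.
exact: le_trans (le_normcD _ _) (lerD ab cd).
Qed.

Lemma nc_ge_Re z : `|complex.Re z| <= normc z.
Proof.
rewrite -(ler_pXn2r (n := 2)) ?nnegrE ?nc_ge0 //.
by rewrite nc_sqr real_normK ?num_real // lerDl sqr_ge0.
Qed.

Lemma nc_ge_Im z : `|complex.Im z| <= normc z.
Proof.
rewrite -(ler_pXn2r (n := 2)) ?nnegrE ?nc_ge0 //.
by rewrite nc_sqr real_normK ?num_real // lerDr sqr_ge0.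
Qed.

Lemma nc_le z : normc z <= `|complex.Re z| + `|complex.Im z|.
Proof.
rewrite -(ler_pXn2r (n := 2)) ?nnegrE ?nc_ge0 ?addr_ge0 //.
rewrite nc_sqr sqrrD !real_normK ?num_real // lerD2r lerDl.
by rewrite mulrn_wge0 // mulr_ge0.
Qed.

Lemma le_small x y : (forall e, 0 < e -> x <= y + e) -> x <= y.
Proof. by move=> h; apply/ler_addgt0Pr. Qed.

Lemma nc_small0 z : (forall e, 0 < e -> normc z <= e) -> z = 0.
Proof.
move=> h; apply/eqP; rewrite -nc_eq0 eq_le nc_ge0 andbT.
by apply: le_small => e e0; rewrite add0r h.
Qed.

Lemma bigI : ('i : C) ^+ 2 = -1. Proof. exact: sqr_i. Qed.
Lemma nc_i : normc ('i : C) = 1.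
Proof. by rewrite /= expr0n expr1n add0r sqrtr1. Qed.

End ComplexNorm.

(** * The maximum principle for polynomials *)

Section PolyMax.
Variable R : realType.
Local Notation C := R[i].
Local Open Scope complex_scope.

Lemma poly_bound (p : {poly C}) (r : R) :
  exists2 M, 0 <= M & forall z, normc z <= r -> normc p.[z] <= M.
Proof.
elim/poly_ind: p => [|p c [M M0 IH]].
  by exists 0 => // z _; rewrite horner0 nc0.
exists (M * `|r| + normc c) => [|z zr]; first by rewrite addr_ge0 ?mulr_ge0 ?nc_ge0.
rewrite hornerMXaddC (le_trans (le_normcD _ _)) // lerD2r normcM ler_pM ?nc_ge0 ?IH //.
exact: le_trans zr (ler_norm _).
Qed.

(** The first, second and third powers of the fourth roots of unity sum to 0, so only the terms of
    degree at least 4 of the expansion at z survive. This replaces the mean value property over a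
    circle. *)
Lemma poly_avg4 (p : {poly C}) (z : C) : exists2 M, 0 <= M &
  forall r : R, 0 <= r <= 1 ->
  normc (p.[z + r%:C] + p.[z - r%:C] + p.[z + 'i * r%:C] + p.[z - 'i * r%:C]
    - 4%:R * p.[z]) <= M * r ^+ 4.
Proof.
pose q := p \Po ('X + z%:P).
have qE h : p.[z + h] = q.[h] by rewrite horner_comp !hornerE addrC.
have [M M0 hM] := poly_bound (drop_poly 4 q) 1.
have q4 h : q.[h] = q`_0 + q`_1 * h + q`_2 * h ^+ 2 + q`_3 * h ^+ 3
                    + (drop_poly 4 q).[h] * h ^+ 4.
  rewrite -{1}(poly_take_drop 4 q) hornerD hornerM hornerXn; congr (_ + _).
  rewrite (horner_coef_wide _ (size_take_poly 4 q)) !big_ord_recl big_ord0 /=.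
  by rewrite !coef_take_poly /= /bump /= expr0 mulr1 addr0 expr1 !addrA.
exists (4%:R * M) => [|r /andP[r0 r1]]; first by rewrite mulr_ge0.
have hq (h : C) : normc h = r -> normc ((drop_poly 4 q).[h] * h ^+ 4) <= M * r ^+ 4.
  move=> hr; rewrite normcM ncX hr ler_wpM2r ?exprn_ge0 // hM // hr //.
have pz : p.[z] = q`_0 by rewrite -[z]addr0 qE horner_coef0.
have i2 := bigI R.
have i3 : ('i : C) ^+ 3 = - 'i by rewrite exprS i2 mulrN1.
set d := drop_poly 4 q in q4 hq *.
have -> : p.[z + r%:C] + p.[z - r%:C] + p.[z + 'i * r%:C] + p.[z - 'i * r%:C]
    - 4%:R * p.[z] = d.[r%:C] * r%:C ^+ 4 + d.[- r%:C] * (- r%:C) ^+ 4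
    + d.['i * r%:C] * ('i * r%:C) ^+ 4 + d.[- ('i * r%:C)] * (- ('i * r%:C)) ^+ 4.
  rewrite !qE !q4 pz; set a := q`_0; set b := q`_1; set c := q`_2; set e := q`_3.
  set A := d.[_]; set B := d.[_]; set D := d.[_]; set E := d.[_].
  have -> : (- ('i * r%:C)) ^+ 2 = - r%:C ^+ 2 :> C by rewrite sqrrN exprMn i2; ring.
  have -> : ('i * r%:C) ^+ 2 = - r%:C ^+ 2 :> C by rewrite exprMn i2; ring.
  have -> : (- ('i * r%:C)) ^+ 3 = 'i * r%:C ^+ 3 :> C by rewrite exprNn exprMn i3; ring.
  have -> : ('i * r%:C) ^+ 3 = - 'i * r%:C ^+ 3 :> C by rewrite exprMn i3; ring.
  ring.
have nr : normc (r%:C : C) = r by rewrite nc_real ger0_norm.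
have nir : normc ('i * r%:C : C) = r by rewrite normcM nr nc_i mul1r.
have H1 := hq _ nr.
have H2 := hq (- r%:C); rewrite normcN nr in H2; have {}H2 := H2 erefl.
have H3 := hq _ nir.
have H4 := hq (- ('i * r%:C)); rewrite normcN nir in H4; have {}H4 := H4 erefl.
have -> : 4%:R * M * r ^+ 4 = M * r ^+ 4 + M * r ^+ 4 + M * r ^+ 4 + M * r ^+ 4 by ring.
apply: le_trans (le_normcD _ _) _; rewrite lerD //.
apply: le_trans (le_normcD _ _) _; rewrite lerD //.
by apply: le_trans (le_normcD _ _) _; rewrite lerD.
Qed.

Local Open Scope classical_set_scope.

Definition plane (xy : R * R) : C := xy.1 +i* xy.2.

Lemma poly_continuous (p : {poly C}) :
  continuous (fun xy : R * R => complex.Re p.[plane xy]) /\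
  continuous (fun xy : R * R => complex.Im p.[plane xy]).
Proof.
elim/poly_ind: p => [|p c [cr ci]].
  by split=> xy; rewrite /continuous_at horner0 /=;
    under eq_fun do rewrite horner0 /=; exact: cvg_cst.
have e (xy : R * R) : p.[plane xy] * plane xy + c =
  (complex.Re p.[plane xy] * xy.1 - complex.Im p.[plane xy] * xy.2 + complex.Re c) +i*
  (complex.Re p.[plane xy] * xy.2 + complex.Im p.[plane xy] * xy.1 + complex.Im c).
  by rewrite /plane; case: (p.[_]) => a b; case: c.
split=> xy; rewrite /continuous_at hornerMXaddC e /=;
  under eq_fun do rewrite hornerMXaddC e /=;
  apply: cvgD; try exact: cvg_cst.
- by apply: cvgB; apply: cvgM; [exact: cr|exact: cvg_fst|exact: ci|exact: cvg_snd].
- by apply: cvgD; apply: cvgM; [exact: cr|exact: cvg_snd|exact: ci|exact: cvg_fst].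
Qed.

Lemma Re_mul_conj_le (a b : C) :
  complex.Re (a^* * b) <= (normc a ^+ 2 + normc b ^+ 2) / 2.
Proof.
rewrite !nc_sqr; case: a => a1 a2; case: b => b1 b2 /=.
have := sqr_ge0 (a1 - b1); have := sqr_ge0 (a2 - b2); nra.
Qed.

(** Adding d |z|^2 to |p|^2 makes it strictly subharmonic, so a maximum at a point of K outside [bd]
    contradicts the four-point average. Then d tends to 0. *)
Lemma poly_max (K : set (R * R)) (bd : set (R * R)) (p : {poly C}) (M : R) :
  compact K ->
  (forall xy, K xy -> bd xy \/ exists2 r, 0 < r &
     forall h k, h ^+ 2 + k ^+ 2 <= r ^+ 2 -> K (xy.1 + h, xy.2 + k)) ->
  (forall xy, K xy -> bd xy -> normc p.[plane xy] <= M) ->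
  forall xy, K xy -> normc p.[plane xy] <= M.
Proof.
move=> cK Kin pM xy0 K0.
have [r0 [r0ge Kb]] : exists r0, 0 <= r0 /\ forall xy, K xy -> normc (plane xy) ^+ 2 <= r0.
  have cn : {within K, continuous (fun xy : R * R => xy.1 ^+ 2 + xy.2 ^+ 2)}.
    have -> : (fun xy : R * R => xy.1 ^+ 2 + xy.2 ^+ 2) =
      fun xy => xy.1 * xy.1 + xy.2 * xy.2 by apply/funext => xy; rewrite !expr2.
    apply: continuous_subspaceT => xy.
    by apply: cvgD; apply: cvgM; [exact: cvg_fst|exact: cvg_fst|exact: cvg_snd|exact: cvg_snd].
  have [c _ cmax] := compact_EVT_max (ex_intro _ _ K0) cK cn.
  exists (c.1 ^+ 2 + c.2 ^+ 2); rewrite addr_ge0 ?sqr_ge0; split=> // xy Kxy.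
  by rewrite nc_sqr /=; exact/cmax/mem_set.
pose psi d (xy : R * R) := normc p.[plane xy] ^+ 2 + d * (xy.1 ^+ 2 + xy.2 ^+ 2).
have psi_cont d : {within K, continuous (psi d)}.
  have [cr ci] := poly_continuous p.
  have -> : psi d = fun xy => complex.Re p.[plane xy] * complex.Re p.[plane xy] +
      complex.Im p.[plane xy] * complex.Im p.[plane xy] + d * (xy.1 * xy.1 + xy.2 * xy.2).
    by apply/funext => xy; rewrite /psi nc_sqr !expr2.
  apply: continuous_subspaceT => xy.
  apply: cvgD; first by apply: cvgD; apply: cvgM; [exact: cr|exact: cr|exact: ci|exact: ci].
  by apply: cvgM; [exact: cvg_cst|apply: cvgD; apply: cvgM;
    [exact: cvg_fst|exact: cvg_fst|exact: cvg_snd|exact: cvg_snd]].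
have main d : 0 < d -> 0 <= M /\ normc p.[plane xy0] ^+ 2 <= M ^+ 2 + d * r0.
  move=> d0; have [c Kc cmax] := compact_EVT_max (ex_intro _ _ K0) cK (psi_cont d).
  have {}cmax xy : K xy -> psi d xy <= psi d c by move=> Kxy; exact/cmax/mem_set.
  have {}Kc : K c by exact: set_mem.
  have c2 : c.1 ^+ 2 + c.2 ^+ 2 <= r0 by have := Kb _ Kc; rewrite nc_sqr.
  have [bc|[r r_gt0 rK]] := Kin _ Kc.
    have pc := pM _ Kc bc; have M0 : 0 <= M by exact: le_trans (nc_ge0 _) pc.
    split=> //; have := cmax _ K0; rewrite /psi.
    have : normc p.[plane c] ^+ 2 <= M ^+ 2 by rewrite lerXn2r ?nnegrE ?nc_ge0.
    have : d * (c.1 ^+ 2 + c.2 ^+ 2) <= d * r0 by rewrite ler_pM2l.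
    have : 0 <= d * (xy0.1 ^+ 2 + xy0.2 ^+ 2) by rewrite mulr_ge0 ?addr_ge0 ?sqr_ge0 ?ltW.
    by lra.
  have [B B0 hB] := poly_avg4 p (plane c).
  set a0 := p.[plane c] in hB.
  have aB : 0 <= normc a0 * B by rewrite mulr_ge0 ?nc_ge0.
  pose rho := Num.min (Num.min r 1) (d / (normc a0 * B + 1)).
  have rho0 : 0 < rho by rewrite !lt_min r_gt0 ltr01 divr_gt0 //; lra.
  have rho_r : rho <= r by rewrite !ge_min lexx.
  have rho1 : rho <= 1 by rewrite !ge_min lexx orbT.
  have rhod : normc a0 * B * rho <= d.
    have : rho <= d / (normc a0 * B + 1) by rewrite !ge_min lexx !orbT.
    rewrite ler_pdivlMr; last lra.
    by nra.
  have rr : rho ^+ 2 <= r ^+ 2 by rewrite lerXn2r ?nnegrE // ltW.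
  (* Maximality of c bounds |p|^2 on the small circle. The term linear in (h, k) cancels between
     opposite points. *)
  have est h k : h ^+ 2 + k ^+ 2 = rho ^+ 2 ->
    complex.Re (a0^* * p.[plane (c.1 + h, c.2 + k)]) <=
      normc a0 ^+ 2 - d * (c.1 * h + c.2 * k) - d * rho ^+ 2 / 2.
    move=> hk; apply: le_trans (Re_mul_conj_le _ _) _.
    have := cmax (c.1 + h, c.2 + k); rewrite /psi /= -/a0 => /(_ (rK _ _ _)).
    rewrite hk => /(_ rr) H.
    have -> : rho ^+ 2 = h ^+ 2 + k ^+ 2 by [].
    by nra.
  have e1 := est rho 0; rewrite expr0n addr0 in e1; have {}e1 := e1 erefl.
  have e2 := est (- rho) 0; rewrite expr0n addr0 sqrrN in e2; have {}e2 := e2 erefl.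
  have e3 := est 0 rho; rewrite expr0n add0r in e3; have {}e3 := e3 erefl.
  have e4 := est 0 (- rho); rewrite expr0n add0r sqrrN in e4; have {}e4 := e4 erefl.
  have := hB rho; rewrite rho1 (ltW rho0) => /(_ isT) H.
  have p1 : plane (c.1 + rho, c.2 + 0) = plane c + rho%:C by rewrite /plane; simpc.
  have p2 : plane (c.1 + - rho, c.2 + 0) = plane c - rho%:C by rewrite /plane; simpc.
  have p3 : plane (c.1 + 0, c.2 + rho) = plane c + 'i * rho%:C by rewrite /plane; simpc.
  have p4 : plane (c.1 + 0, c.2 - rho) = plane c - 'i * rho%:C by rewrite /plane; simpc.
  rewrite p1 in e1; rewrite p2 in e2; rewrite p3 in e3; rewrite p4 in e4.
  set S := _ - _ in H.
  have : complex.Re (a0^* * S) >= - (normc a0 * (B * rho ^+ 4)).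
    rewrite lerNl; apply: le_trans (_ : normc (a0^* * S) <= _).
      by apply: le_trans (nc_ge_Re _); rewrite -normrN ler_norm.
    rewrite normcM; apply: ler_pM; rewrite ?nc_ge0 //.
    by case: (a0) => x y; rewrite /= sqrrN.
  rewrite /S mulrBr !mulrDr.
  have -> : a0^* * (4%:R * a0) = (4 * normc a0 ^+ 2)%:C.
    by rewrite nc_sqr; case: (a0) => x y; rewrite -[4%:R](rmorph_nat (real_complex R));
     apply/eqP; rewrite eq_complex /=; apply/andP; split; apply/eqP; ring.
  rewrite !raddfD raddfN /=.
  have : normc a0 * B * rho * rho ^+ 2 <= d * rho ^+ 2 by rewrite ler_wpM2r ?sqr_ge0.
  have : normc a0 * (B * rho ^+ 4) <= normc a0 * B * rho * rho ^+ 2.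
    have -> : normc a0 * (B * rho ^+ 4) = normc a0 * B * rho * rho ^+ 2 * rho by ring.
    apply: ler_piMr => //.
    by apply: mulr_ge0; [apply: mulr_ge0; [exact: aB|exact: ltW]|exact: sqr_ge0].
  have : 0 < d * rho ^+ 2 by rewrite mulr_gt0 ?exprn_gt0.
  by lra.
have [M0 _] := main 1 ltr01.
rewrite -(ler_pXn2r (n := 2)) ?nnegrE ?nc_ge0 //.
apply/ler_addgt0Pr => e e0.
have r1 : 0 < r0 + 1 by lra.
have [_ H] := main (e / (r0 + 1)) (divr_gt0 e0 r1); apply: le_trans H _.
rewrite lerD2l mulrAC ler_pdivrMr // ler_pM2l //; lra.
Qed.
End PolyMax.

(** * Uniform limits of polynomials on a disc *)

Section Approximable.
Variable R : realType.
Local Notation C := R[i].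
Local Open Scope complex_scope.
Local Open Scope classical_set_scope.

(** The intervals of radius [c n] around [u n] meet pairwise, so the supremum of their left ends
    lies in all of them; this gives the limit together with its rate. *)
Lemma real_complete (u c : nat -> R) :
  (forall n m, (n <= m)%N -> `|u m - u n| <= c n) ->
  exists l, forall n, `|u n - l| <= c n.
Proof.
move=> h; pose E := [set x | exists n, x = u n - c n].
have ub n : ubound E (u n + c n).
  move=> _ [m ->]; have := h n (maxn n m) (leq_maxl _ _).
  have := h m (maxn n m) (leq_maxr _ _).
  by rewrite !ler_distl; lra.
have E0 : E !=set0 by exists (u 0%N - c 0%N); exists 0%N.
exists (sup E) => n; rewrite ler_distl.
have /(_ (u n + c n) (ub n)) h1 := @ge_sup _ _ _ E0.
have h2 : u n - c n <= sup E.
  by apply: ub_le_sup; [exists (u 0%N + c 0%N); exact: ub|exists n].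
by apply/andP; split; lra.
Qed.

Lemma complex_complete (u : nat -> C) (c : nat -> R) :
  (forall n m, (n <= m)%N -> normc (u m - u n) <= c n) ->
  exists l, forall n, normc (u n - l) <= 2 * c n.
Proof.
move=> h.
have [n m nm|a ha] := @real_complete (fun n => complex.Re (u n)) c.
  by apply: le_trans (h _ _ nm); rewrite -raddfB; exact: nc_ge_Re.
have [n m nm|b hb] := @real_complete (fun n => complex.Im (u n)) c.
  by apply: le_trans (h _ _ nm); rewrite -raddfB; exact: nc_ge_Im.
exists (a +i* b) => n; apply: le_trans (nc_le _) _.
have := ha n; have := hb n; case: (u n) => x y /=; lra.
Qed.

(** On the disc these are the continuous functions that are holomorphic inside. Taking approximation
    as the definition lets every estimate be proved for polynomials first and passed to the
    limit. *)
Definition appr (r : R) (f : C -> C) := forall e, 0 < e ->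
  exists p : {poly C}, forall z, normc z <= r -> normc (f z - p.[z]) <= e.

Lemma appr_poly r (p : {poly C}) : appr r (horner p).
Proof. by move=> e e0; exists p => z _; rewrite subrr nc0 ltW. Qed.

Lemma appr_cst r (c : C) : appr r (fun=> c).
Proof. by move=> e e0; exists c%:P => z _; rewrite hornerC subrr nc0 ltW. Qed.

Lemma appr_le r s f : r <= s -> appr s f -> appr r f.
Proof.
move=> rs h e e0; have [p hp] := h e e0; exists p => z zr; exact/hp/(le_trans zr).
Qed.

Lemma appr_ext r f g : (forall z, normc z <= r -> f z = g z) -> appr r f -> appr r g.
Proof. by move=> fg h e e0; have [p hp] := h e e0; exists p => z zr; rewrite -fg ?hp. Qed.

Lemma appr_bound r f : appr r f ->
  exists2 M, 0 < M & forall z, normc z <= r -> normc (f z) <= M.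
Proof.
move=> h; have [p hp] := h 1 ltr01; have [M M0 hM] := poly_bound p r.
exists (M + 1) => [|z zr]; first lra.
apply: le_trans (nc_dist _ p.[z]) _; have := hp z zr; have := hM z zr; lra.
Qed.

Lemma apprD r f g : appr r f -> appr r g -> appr r (fun z => f z + g z).
Proof.
move=> hf hg e e0; have e2 : 0 < e / 2 by lra.
have [p hp] := hf _ e2; have [q hq] := hg _ e2; exists (p + q) => z zr.
rewrite hornerD opprD addrACA; apply: le_trans (le_normcD _ _) _.
by have := hp z zr; have := hq z zr; lra.
Qed.

Lemma apprM r f g : appr r f -> appr r g -> appr r (fun z => f z * g z).
Proof.
move=> hf hg e e0.
have [M M0 hM] := appr_bound hf; have [N N0 hN] := appr_bound hg.
have [q hq] : exists q : {poly C}, forall z, normc z <= r ->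
    normc (g z - q.[z]) <= e / (2 * (M + e)).
  by apply: hg; rewrite divr_gt0 // mulr_gt0 // addr_gt0.
have [p hp] : exists p : {poly C}, forall z, normc z <= r ->
    normc (f z - p.[z]) <= Num.min e (e / (2 * N)).
  by apply: hf; rewrite lt_min e0 divr_gt0 // mulr_gt0.
exists (p * q) => z zr; rewrite hornerM.
have -> : f z * g z - p.[z] * q.[z] = (f z - p.[z]) * g z + p.[z] * (g z - q.[z]) by ring.
have := hp z zr; rewrite le_min => /andP[p1 p2]; have q1 := hq z zr.
have pM : normc p.[z] <= M + e.
  by apply: le_trans (nc_dist _ (f z)) _; rewrite ncB; have := hM z zr; lra.
apply: le_trans (le_normcD _ _) _; rewrite !normcM.
have -> : e = e / (2 * N) * N + (M + e) * (e / (2 * (M + e))).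
  have ? : N != 0 by rewrite gt_eqF.
  have ? : M + e != 0 by rewrite gt_eqF //; lra.
  by field; apply/andP.
by apply: lerD; apply: ler_pM; rewrite ?nc_ge0 ?hN.
Qed.

Lemma apprZ r (c : C) f : appr r f -> appr r (fun z => c * f z).
Proof. by move=> h; apply: apprM (appr_cst _ _) h. Qed.

Lemma apprB r f g : appr r f -> appr r g -> appr r (fun z => f z - g z).
Proof.
move=> hf hg; apply: (@appr_ext _ (fun z => f z + (-1) * g z)) => [z _|].
  by rewrite mulN1r.
by apply: apprD hf _; apply: apprZ.
Qed.

Lemma poly_lipschitz (p : {poly C}) (r : R) : exists2 L, 0 < L &
  forall z w, normc z <= r -> normc w <= r -> normc (p.[z] - p.[w]) <= L * normc (z - w).
Proof.
elim/poly_ind: p => [|p c [L L0 IH]].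
  by exists 1 => // z w _ _; rewrite !horner0 subr0 nc0 mul1r nc_ge0.
have [M M0 hM] := poly_bound p r.
exists (`|r| * L + M + 1) => [|z w zr wr]; first by have := mulr_ge0 (normr_ge0 r) (ltW L0); lra.
rewrite !hornerMXaddC.
have -> : p.[z] * z + c - (p.[w] * w + c) = z * (p.[z] - p.[w]) + p.[w] * (z - w) by ring.
apply: le_trans (le_normcD _ _) _; rewrite !normcM.
have d0 := nc_ge0 (z - w).
have : normc z * normc (p.[z] - p.[w]) <= `|r| * (L * normc (z - w)).
  by apply: ler_pM; rewrite ?nc_ge0 ?IH //; apply: le_trans zr (ler_norm _).
have : normc p.[w] * normc (z - w) <= M * normc (z - w) by rewrite ler_wpM2r ?hM.
by nra.
Qed.

Lemma appr_cont r f z0 : appr r f -> normc z0 <= r -> forall e, 0 < e -> exists2 d, 0 < d &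
  forall z, normc z <= r -> normc (z - z0) <= d -> normc (f z - f z0) <= e.
Proof.
move=> h z0r e e0; have e3 : 0 < e / 3%:R by lra.
have [p hp] := h _ e3; have [L L0 hL] := poly_lipschitz p r.
exists (e / 3%:R / L) => [|z zr zd]; first exact: divr_gt0.
have -> : f z - f z0 = (f z - p.[z]) + (p.[z] - p.[z0]) - (f z0 - p.[z0]) by ring.
apply: le_trans (le_normcD _ _) _; rewrite normcN.
apply: le_trans (_ : e / 3%:R + e / 3%:R + e / 3%:R <= _); last lra.
rewrite lerD ?hp //; apply: le_trans (le_normcD _ _) _; rewrite lerD ?hp //.
apply: le_trans (hL _ _ zr z0r) _.
by rewrite mulrC -ler_pdivlMr.
Qed.

Lemma sqr_fun_cont : continuous (fun xy : R * R => xy.1 ^+ 2 + xy.2 ^+ 2).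
Proof.
have -> : (fun xy : R * R => xy.1 ^+ 2 + xy.2 ^+ 2) =
  fun xy => xy.1 * xy.1 + xy.2 * xy.2 by apply/funext => xy; rewrite !expr2.
move=> xy; by apply: cvgD; apply: cvgM;
  [exact: cvg_fst|exact: cvg_fst|exact: cvg_snd|exact: cvg_snd].
Qed.

Lemma box_compact (r : R) (K : set (R * R)) : closed K ->
  (forall xy, K xy -> normc (plane xy) <= r) -> compact K.
Proof.
move=> cK Kr.
apply: (subclosed_compact cK (compact_setX (@segment_compact _ (-r) r) (@segment_compact _ (-r) r))).
move=> xy /Kr h; split; rewrite /= in_itv /= -ler_norml; apply: le_trans h.
  exact: (nc_ge_Re (plane xy)).
exact: (nc_ge_Im (plane xy)).
Qed.

Lemma disc_compact (r : R) : compact [set xy : R * R | normc (plane xy) <= r].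
Proof.
apply: (box_compact (r := r)) => //.
have -> : [set xy : R * R | normc (plane xy) <= r] =
  (fun xy : R * R => normc (plane xy)) @^-1` [set x | x <= r] by [].
have cl := @closed_le R r; move: cl; apply: (continuous_closedP _).1 => xy.
apply: (@continuous_comp _ _ _ (fun xy : R * R => xy.1 ^+ 2 + xy.2 ^+ 2) Num.sqrt).
  exact: sqr_fun_cont.
exact: sqrt_continuous.
Qed.

Lemma plane_Re_Im (z : C) : plane (complex.Re z, complex.Im z) = z.
Proof. by case: z. Qed.

Lemma poly_disc_max (p : {poly C}) (r M : R) :
  (forall z, normc z = r -> normc p.[z] <= M) ->
  forall z, normc z <= r -> normc p.[z] <= M.
Proof.
move=> h z zr; rewrite -[z]plane_Re_Im.
apply: (poly_max (bd := [set xy | normc (plane xy) = r]) (@disc_compact r)); last first.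
- by change (normc (plane (complex.Re z, complex.Im z)) <= r); rewrite plane_Re_Im.
- by move=> xy _; exact: h.
move=> xy xyr; have : normc (plane xy) <= r := xyr.
rewrite le_eqVlt => /orP[/eqP e|lt]; [by left|right].
exists (r - normc (plane xy)) => [|a b ab]; first by rewrite subr_gt0.
change (normc (plane xy + (a +i* b)) <= r).
apply: le_trans (le_normcD _ _) _; rewrite -lerBrDl.
by rewrite -(ler_pXn2r (n := 2)) ?nnegrE ?nc_ge0 ?subr_ge0 ?nc_sqr ?(ltW lt).
Qed.

Lemma appr_disc_max f (r M : R) : appr r f ->
  (forall z, normc z = r -> normc (f z) <= M) ->
  forall z, normc z <= r -> normc (f z) <= M.
Proof.
move=> hf h z zr; apply/ler_addgt0Pr => e e0; have e2 : 0 < e / 2 by lra.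
have [p hp] := hf _ e2.
apply: le_trans (nc_dist _ p.[z]) _.
suff : normc p.[z] <= M + e / 2 by have := hp z zr; lra.
apply: (poly_disc_max (r := r)) => // w wr.
apply: le_trans (nc_dist _ (f w)) _; rewrite ncB.
have := h w wr; have := hp w; rewrite wr => /(_ (lexx _)); lra.
Qed.

(* The quotients of the approximating polynomials converge uniformly by the
   maximum principle. *)
Lemma appr_div r f z0 : appr r f -> normc z0 < r -> f z0 = 0 ->
  exists2 g, appr r g & forall z, f z = (z - z0) * g z.
Proof.
move=> hf z0r fz0; set d := r - normc z0; have d0 : 0 < d by rewrite subr_gt0.
have /choice [p hp] : forall n : nat, exists p : {poly C}, forall z, normc z <= r ->
    normc (f z - p.[z]) <= n.+1%:R^-1.
  by move=> n; apply: hf; rewrite invr_gt0 ltr0Sn.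
have /choice [q hq] : forall n : nat, exists q : {poly C},
    p n - (p n).[z0]%:P = q * ('X - z0%:P).
  by move=> n; apply/factor_theorem; rewrite rootE !hornerE subrr.
have qE n z : (p n).[z] - (p n).[z0] = (z - z0) * (q n).[z].
  have := congr1 (fun p => p.[z]) (hq n); rewrite !hornerE /= => ->.
  exact: mulrC.
have qn n z : normc z <= r -> normc (f z - (z - z0) * (q n).[z]) <= 2 * n.+1%:R^-1.
  move=> zr; rewrite -qE opprB addrCA addrC; apply: le_trans (le_normcD _ _) _.
  have := hp n z0 (ltW z0r); rewrite fz0 sub0r normcN; have := hp n z zr.
  move: (n.+1%:R^-1) => c; lra.
have qc n m : (n <= m)%N -> forall z, normc z <= r ->
    normc ((q m).[z] - (q n).[z]) <= 4%:R / d * n.+1%:R^-1.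
  move=> nm z zr; rewrite -hornerN -hornerD; apply: (poly_disc_max (r := r)) zr => {}z zr.
  have zd : d <= normc (z - z0) by rewrite lerBlDl -zr; exact: nc_dist.
  have mn : m.+1%:R^-1 <= n.+1%:R^-1 :> R by rewrite lef_pV2 ?posrE ?ltr0Sn // ler_nat ltnS.
  rewrite hornerD hornerN mulrAC ler_pdivlMr // mulrC.
  apply: le_trans (ler_wpM2r (nc_ge0 _) zd) _; rewrite -normcM.
  have -> : (z - z0) * ((q m).[z] - (q n).[z]) =
    (f z - (z - z0) * (q n).[z]) - (f z - (z - z0) * (q m).[z]) by ring.
  apply: le_trans (le_normcD _ _) _; rewrite normcN.
  have := qn n z; have := qn m z; rewrite zr lexx => /(_ isT) + /(_ isT).
  move: mn; move: (n.+1%:R^-1) (m.+1%:R^-1) => a b; lra.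
have [v hv] := complex_complete (fun n m nm => qc n m nm z0 (ltW z0r)).
(* The limit [v] of the quotients at z0 plays the part of the derivative of f there. *)
pose g z := if z == z0 then v else f z / (z - z0).
exists g => [|z]; last first.
  rewrite /g; case: eqP => [->|/eqP zz]; first by rewrite subrr mul0r.
  by rewrite mulrC divfK // subr_eq0.
have gq n z : normc z <= r -> normc (g z - (q n).[z]) <= 8%:R / d * n.+1%:R^-1.
  move=> zr; have K0 : 0 <= 4%:R / d * n.+1%:R^-1 by rewrite mulr_ge0 ?divr_ge0 ?invr_ge0 // ltW.
  rewrite /g; case: eqP => [->|/eqP zz].
    rewrite ncB; apply: le_trans (hv n) _; move: K0; move: (n.+1%:R^-1) (d^-1) => x y.
    nra.
  have dz : 0 < normc (z - z0) by rewrite nc_gt0 subr_eq0.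
  apply/ler_addgt0Pr => e e0.
  pose m := maxn n (Num.truncn (2 / (e * normc (z - z0)))).
  apply: le_trans (nc_dist _ ((q m).[z] - (q n).[z])) _.
  have := qc n m (leq_maxl _ _) z zr.
  suff : normc (f z / (z - z0) - (q n).[z] - ((q m).[z] - (q n).[z])) <= e.
    have -> : 8%:R / d * n.+1%:R^-1 = 2 * (4%:R / d * n.+1%:R^-1).
      by rewrite !mulrA -natrM.
    move: K0; move: (4%:R / d * n.+1%:R^-1) => x; lra.
  have -> : f z / (z - z0) - (q n).[z] - ((q m).[z] - (q n).[z]) =
    (f z - (z - z0) * (q m).[z]) / (z - z0).
    by field; rewrite subr_eq0.
  rewrite normcM normcV ler_pdivrMr //; apply: le_trans (qn m z zr) _.
  rewrite ler_pdivrMr ?ltr0Sn // -ler_pdivrMl ?mulr_gt0 // mulrC.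
  have := truncnS_gt (2 / (e * normc (z - z0))) => /ltW /le_trans; apply.
  by rewrite ler_nat ltnS leq_maxr.
move=> e e0; pose n := Num.truncn (8%:R / d / e).
exists (q n) => z zr; apply: le_trans (gq n z zr) _.
rewrite ler_pdivrMr ?ltr0Sn // -ler_pdivrMl // mulrC.
exact/ltW/truncnS_gt.
Qed.


(** Partial sums of the geometric series in z / w, whose ratio is at most [r / normc w]. For
    negative r the disc is empty. *)
Lemma appr_inv_lin r (w : C) : r < normc w -> appr r (fun z => (z - w)^-1).
Proof.
move=> rw; have [r0|r0] := ltP r 0.
  by apply: (appr_ext _ (appr_cst r 0)) => z zr; exfalso; have := nc_ge0 z; move: zr; lra.
have w0 : 0 < normc w by lra.
have wn : w != 0 by rewrite -nc_gt0.
have [t0 t1] : 0 <= r / normc w /\ r / normc w < 1.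
  by rewrite divr_ge0 ?(ltW w0) // ltr_pdivrMr // mul1r.
set t := r / normc w in t0 t1.
have d0 : 0 < normc w - r by lra.
move=> e e0.
have [n hn] : exists n, t ^+ n <= e * (normc w - r).
  have /cvgrPdist_le /(_ _ (mulr_gt0 e0 d0)) [n _ hn] : t ^+ n @[n --> \oo] --> 0.
    by apply: cvg_expr; rewrite ger0_norm.
  by exists n; have := hn n (leqnn n); rewrite /= sub0r normrN ger0_norm ?exprn_ge0.
exists (\sum_(i < n) (- w^-1 ^+ i.+1) *: 'X^i) => z zr.
have zw : z - w != 0.
  by rewrite subr_eq0; apply/eqP => zw; rewrite zw in zr; lra.
rewrite horner_sum; under eq_bigr do rewrite hornerZ hornerXn.
have -> : (z - w)^-1 - \sum_(i < n) - w^-1 ^+ i.+1 * z ^+ i = (z / w) ^+ n / (z - w).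
  apply: (mulIf zw); rewrite mulrBl mulVf // divfK //.
  have -> : \sum_(i < n) - w^-1 ^+ i.+1 * z ^+ i = - w^-1 * \sum_(i < n) (z / w) ^+ i.
    rewrite big_distrr /=; apply: eq_bigr => i _.
    by rewrite exprMn exprS; ring.
  have := subrX1 (z / w) n.
  have -> : z / w - 1 = (z - w) / w by field.
  by move=> h; rewrite -[RHS](subrK 1) h; ring.
rewrite normcM ncX normcM !normcV.
have zw0 : 0 < normc (z - w) by rewrite nc_gt0.
rewrite ler_pdivrMr //.
apply: le_trans (_ : t ^+ n <= _).
  have w1 : 0 <= (normc w)^-1 by rewrite invr_ge0 ltW.
  apply: lerXn2r; rewrite ?nnegrE //; first by rewrite mulr_ge0 ?nc_ge0.
  by rewrite /t ler_wpM2r.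
apply: le_trans hn _; rewrite ler_pM2l //.
by have := nc_dist w z; rewrite ncB; lra.
Qed.

Lemma poly_factor (p : {poly C}) : exists s : seq C, p = lead_coef p *: \prod_(w <- s) ('X - w%:P).
Proof. by have [s hs] := closed_field_poly_normal p; exists s. Qed.

(** All roots lie outside the disc, so the inverse is a product of inverses of linear factors. *)
Lemma appr_inv_poly r (p : {poly C}) : 0 <= r ->
  (forall z, normc z <= r -> p.[z] != 0) -> appr r (fun z => p.[z]^-1).
Proof.
move=> r0 hp; have [s es] := poly_factor p.
have p0 : lead_coef p != 0.
  apply: contraTneq (hp 0 _); last by rewrite nc0.
  by move=> e; rewrite es e scale0r horner0 eqxx.
have sr : forall w, w \in s -> r < normc w.
  move=> w ws; rewrite ltNge; apply/negP => /hp /eqP; apply.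
  rewrite es hornerZ horner_prod (big_rem w) //=.
  by rewrite hornerD hornerN hornerX hornerC subrr mul0r mulr0.
apply: (@appr_ext _ (fun z => (lead_coef p)^-1 * \prod_(w <- s) (z - w)^-1)).
  move=> z _; rewrite [in RHS]es hornerZ horner_prod invfM; congr (_ * _).
  by rewrite -prodfV; apply: eq_bigr => w _; rewrite !hornerE.
apply: apprZ; elim: s sr {es} => [|w s IH] sr.
  by apply: (appr_ext _ (appr_cst r 1)) => z _; rewrite big_nil.
apply: (appr_ext (f := fun z => (z - w)^-1 * \prod_(w <- s) (z - w)^-1)).
  by move=> z _; rewrite big_cons.
apply: apprM; first by apply: appr_inv_lin; rewrite sr ?mem_head.
by apply: IH => v vs; rewrite sr // inE vs orbT.
Qed.

Lemma appr_lower r f : 0 <= r -> appr r f -> (forall z, normc z <= r -> f z != 0) ->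
  exists2 d, 0 < d & forall z, normc z <= r -> d <= normc (f z).
Proof.
move=> r0 hf f0; pose K := [set xy : R * R | normc (plane xy) <= r].
have cf : {within K, continuous (fun xy : R * R => normc (f (plane xy)))}.
  apply/subspace_continuousP => xy Kxy; apply/cvgrPdist_le => e e0.
  have [d d0 hd] := appr_cont hf Kxy e0.
  have d2 : 0 < d / 2 by lra.
  rewrite /= near_withinE; apply/nbhs_ballP; exists (d / 2) => //= uv [b1 b2] Kuv.
  have h : normc (plane uv - plane xy) <= d.
    apply: le_trans (nc_le _) _.
    move: b1 b2; rewrite /ball /= !(distrC (xy.1)) !(distrC (xy.2)) /=; lra.
  have H := hd _ Kuv h.
  change (`|normc (f (plane xy)) - normc (f (plane uv))| <= e); rewrite ler_distl.
  have := nc_dist (f (plane uv)) (f (plane xy)); have := nc_dist (f (plane xy)) (f (plane uv)).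
  rewrite (ncB (f (plane xy))); lra.
have K0 : K !=set0 by exists (0, 0); rewrite /K /plane /= expr0n /= addr0 sqrtr0.
have [c Kc cmin] := compact_EVT_min K0 (@disc_compact r) cf.
exists (normc (f (plane c))).
  by rewrite nc_gt0 f0 //; exact: set_mem Kc.
move=> z zr; rewrite -{1}[z]plane_Re_Im; apply: cmin; apply/mem_set.
by change (normc (plane (complex.Re z, complex.Im z)) <= r); rewrite plane_Re_Im.
Qed.

(** The modulus of f has a positive minimum on the disc, so a polynomial close enough to f is
    zero-free there; its inverse is approximable and close to that of f. *)
Lemma appr_inv r f : 0 <= r -> appr r f -> (forall z, normc z <= r -> f z != 0) ->
  appr r (fun z => (f z)^-1).
Proof.
move=> r0 hf f0; have [d d0 hd] := appr_lower r0 hf f0.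
move=> e e0; have e2 : 0 < e / 2 by lra.
have [p hp] : exists p : {poly C}, forall z, normc z <= r ->
    normc (f z - p.[z]) <= Num.min (d / 2) (e * d ^+ 2 / 4%:R).
  by apply: hf; rewrite lt_min !divr_gt0 ?mulr_gt0 ?exprn_gt0.
have pd z : normc z <= r -> d / 2 <= normc p.[z].
  move=> zr; have := hp z zr; rewrite le_min => /andP[h _].
  have := hd z zr; have := nc_dist (f z) p.[z]; lra.
have [q hq] : exists q : {poly C}, forall z, normc z <= r -> normc (p.[z]^-1 - q.[z]) <= e / 2.
  by apply: appr_inv_poly => // z zr; rewrite -nc_gt0; have := pd z zr; lra.
exists q => z zr; rewrite -(subrKA p.[z]^-1); apply: le_trans (le_normcD _ _) _.
suff : normc ((f z)^-1 - p.[z]^-1) <= e / 2 by have := hq z zr; lra.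
have pz := pd z zr; have fz := hd z zr.
have p0 : p.[z] != 0 by rewrite -nc_gt0; lra.
have -> : (f z)^-1 - p.[z]^-1 = (p.[z] - f z) / (f z * p.[z]) by field; rewrite f0 ?p0.
have fp : d * (d / 2) <= normc (f z) * normc p.[z] by apply: ler_pM => //; lra.
rewrite normcM normcV normcM ler_pdivrMr; last by apply: lt_le_trans fp; nra.
rewrite ncB; have := hp z zr; rewrite le_min => /andP[_ /le_trans]; apply.
apply: le_trans (ler_wpM2l (ltW e2) fp); rewrite expr2; lra.
Qed.

(* Schwarz lemma applied to p / (2A - p). *)
Lemma poly_BC (p : {poly C}) (r A : R) : 0 < r -> 0 < A -> p.[0] = 0 ->
  (forall z, normc z <= r -> complex.Re p.[z] <= A) ->
  forall z, normc z < r -> normc p.[z] <= 2 * A * normc z / (r - normc z).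
Proof.
move=> r0 A0 p0 hp z zr.
have [q eq] : exists q : {poly C}, p = q * 'X.
  have /factor_theorem [q ->] : root p 0 by rewrite rootE p0.
  by exists q; rewrite subr0.
pose v : {poly C} := (2 * A)%:C%:P - p.
have vE w : v.[w] = (2 * A)%:C - p.[w] by rewrite /v hornerD hornerN hornerC.
have v0 w : normc w <= r -> v.[w] != 0.
  move=> wr; rewrite vE; apply/eqP => /(congr1 (@complex.Re R)).
  by rewrite raddfB /=; have := hp w wr; lra.
(* The half-plane Re <= A consists of the points at least as close to 0 as to 2A, which is why p /
   (2A - p) has modulus at most 1. *)
have vp w : normc w <= r -> normc p.[w] <= normc v.[w].
  move=> wr; rewrite -(ler_pXn2r (n := 2)) ?nnegrE ?nc_ge0 // !nc_sqr vE !raddfB /=.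
  by have := hp w wr; nra.
have h : normc (q.[z] * v.[z]^-1) <= r^-1.
  apply: (appr_disc_max (r := r) (f := fun z => q.[z] * v.[z]^-1)); last exact: ltW.
    by apply: apprM; [exact: appr_poly|exact/appr_inv_poly/v0/ltW].
  move=> w wr; rewrite normcM normcV ler_pdivrMr ?nc_gt0 ?v0 ?wr //.
  rewrite ler_pdivlMl // -{1}wr -normcM mulrC.
  by have := vp w; rewrite wr lexx {1}eq hornerM hornerX => ->.
have {}h : normc q.[z] <= r^-1 * normc v.[z].
  by move: h; rewrite normcM normcV ler_pdivrMr // nc_gt0 v0 // ltW.
have {}h : r * normc p.[z] <= normc z * normc v.[z].
  rewrite eq hornerM hornerX normcM mulrA [leLHS]mulrC; apply: ler_wpM2l; first exact: nc_ge0.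
  by rewrite -ler_pdivlMl.
have {}h : r * normc p.[z] <= normc z * (2 * A + normc p.[z]).
  apply: le_trans h _; apply: ler_wpM2l; first exact: nc_ge0.
  rewrite vE; apply: le_trans (le_normcD _ _) _; rewrite normcN nc_real ger0_norm //; lra.
rewrite ler_pdivlMr; last lra.
nra.
Qed.

End Approximable.

(** * Moduli of zero-free functions and Harnack's inequality *)

Section LogModulus.
Variable R : realType.
Local Notation C := R[i].
Local Open Scope complex_scope.
Local Open Scope classical_set_scope.

Lemma Re_div (u w : C) : w != 0 ->
  complex.Re (u / w) = complex.Re (u * w^*) / normc w ^+ 2.
Proof.
move=> w0; have w2 : normc w ^+ 2 != 0 by rewrite expf_eq0 /= nc_eq0.
rewrite nc_sqr in w2 *.
by case: u w {w0} w2 => a b [c d] /= w2; field.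
Qed.

(** Along t -> 1 - t u, the derivative of ln of the modulus plus the real part of the truncated
    logarithmic series collapses to - Re (u (t u)^N / (1 - t u)); the mean value theorem concludes.
    [D] is the squared modulus and [Q] the real part of the series, both as real polynomials in
    t. *)
Lemma ln_dist (u : C) (th : R) (N : nat) : normc u <= th -> th < 1 ->
  `|ln (normc (1 - u)) + complex.Re (\sum_(i < N) u ^+ i.+1 / i.+1%:R)| <= th ^+ N.+1 / (1 - th).
Proof.
move=> uth th1; have th0 : 0 <= th by exact: le_trans (nc_ge0 u) uth.
set a := complex.Re u; set b := complex.Im u.
pose D : {poly R} := (1 - a *: 'X) ^+ 2 + (b *: 'X) ^+ 2.
pose Q : {poly R} := \sum_(i < N) (complex.Re (u ^+ i.+1) / i.+1%:R) *: 'X^(i.+1).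
have DE t : D.[t] = normc (1 - t%:C * u) ^+ 2.
  by rewrite nc_sqr /D !hornerE /a /b; case: (u) => x y /=; ring.
have tu (t : R) : 0 <= t <= 1 -> normc (t%:C * u) <= th.
  move=> /andP[t0 t1]; rewrite normcM nc_real ger0_norm //.
  by apply: le_trans (ler_piMl _ _) uth; rewrite ?nc_ge0.
have lo (t : R) : 0 <= t <= 1 -> 1 - th <= normc (1 - t%:C * u).
  by move=> /tu h; have := nc_dist 1 (t%:C * u); rewrite nc1; lra.
have D0 (t : R) : 0 <= t <= 1 -> 0 < D.[t].
  by move=> /lo h; rewrite DE exprn_gt0 //; lra.
pose phi t := 2^-1 * ln D.[t] + Q.[t].
pose dphi t := 2^-1 * (D.[t]^-1 * D^`().[t]) + Q^`().[t].
have dd (t : R) : 0 <= t <= 1 -> is_derive t 1 phi (dphi t).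
  move=> /D0 Dt; apply: is_deriveD; apply: is_deriveZ.
  apply: is_derive1_comp; exact: is_derive1_ln.
have [t tin] : exists2 c, c \in `[0, 1]%R & phi 1 - phi 0 = dphi c * (1 - 0).
  apply: MVT_segment => // [x|].
    by rewrite in_itv /= => /andP[x0 x1]; apply: dd; rewrite !ltW.
  apply: derivable_within_continuous => x; rewrite in_itv /= => /dd h.
  exact: ex_derive.
move: tin; rewrite in_itv /= => t01; rewrite subr0 mulr1.
have -> : phi 1 - phi 0 = ln (normc (1 - u)) + complex.Re (\sum_(i < N) u ^+ i.+1 / i.+1%:R).
  rewrite /phi !DE mul1r mul0r subr0 nc1 expr1n ln1 mulr0 add0r.
  have h1 : 0 < normc (1 - u) by have := lo 1; rewrite ler01 lexx mul1r => /(_ isT); lra.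
  rewrite lnXn // -[_ *+ 2]mulr_natr.
  have -> : Q.[0] = 0.
    by rewrite /Q horner_sum big1 // => i _; rewrite hornerZ hornerXn expr0n mulr0.
  have -> : Q.[1] = complex.Re (\sum_(i < N) u ^+ i.+1 / i.+1%:R).
    rewrite /Q horner_sum (raddf_sum (@complex.Re R)); apply: eq_bigr => i _.
    rewrite hornerZ hornerXn expr1n mulr1 -[i.+1%:R in RHS](rmorph_nat (real_complex R)).
    by rewrite -fmorphV; case: (u ^+ _) => x y /=; ring.
  by lra.
move=> ->; set w := 1 - t%:C * u.
have w0 : w != 0 by rewrite -nc_gt0; apply: lt_le_trans (lo t t01); lra.
have -> : dphi t = - complex.Re (u * (t%:C * u) ^+ N / w).
  rewrite /dphi.
  have -> : 2^-1 * (D.[t]^-1 * D^`().[t]) = - complex.Re (u / w).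
    have Dn := lt0r_neq0 (D0 t t01); rewrite DE in Dn *.
    have -> : D^`().[t] = 2 * (- a * (1 - a * t) + b * (b * t)).
      have d1 : deriv (1 : {poly R}) = 0 by rewrite -polyC1 derivC.
      rewrite /D !expr2 derivD !derivM derivB d1 !derivZ derivX !hornerE /=.
      by ring.
    rewrite Re_div // /w; move: Dn; rewrite nc_sqr /a /b; case: (u) => x y /=.
    by set d := (_ ^+ 2 + _ ^+ 2) => Dn; field.
  have -> : Q^`().[t] = complex.Re (u * \sum_(i < N) (t%:C * u) ^+ i).
    rewrite /Q linear_sum horner_sum mulr_sumr (raddf_sum (@complex.Re R)).
    apply: eq_bigr => i _ /=; rewrite derivZ derivXn hornerZ hornerMn hornerXn /= exprMn.
    rewrite mulrCA -exprS -rmorphXn; case: (u ^+ _) => x y /=.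
    rewrite -[t ^+ i *+ _]mulr_natr; have : i.+1%:R != 0 :> R by rewrite pnatr_eq0.
    by move: (i.+1%:R) (t ^+ i) => n0 ti n00; field.
  have := subrX1 (t%:C * u) N; set S := \sum_(i < N) _ => hS.
  have {}hS : S = (1 - (t%:C * u) ^+ N) / w.
    apply: (mulIf w0); rewrite divfK // -[LHS]opprK -mulrN -[1 - (_ ^+ _)]opprB hS /w; congr (- _).
    by ring.
  rewrite hS -raddfN -raddfD -raddfN; congr complex.Re; field; exact: w0.
rewrite normrN; apply: le_trans (nc_ge_Re _) _.
rewrite normcM normcV normcM ncX ler_pdivrMr ?nc_gt0 //.
have h1 : normc u * normc (t%:C * u) ^+ N <= th ^+ N.+1.
  rewrite exprS; apply: ler_pM; rewrite ?exprn_ge0 ?nc_ge0 //.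
  by apply: lerXn2r; rewrite ?nnegrE ?nc_ge0 ?tu.
apply: le_trans h1 _; rewrite mulrAC ler_pdivlMr; last lra.
by apply: ler_wpM2l; [rewrite exprn_ge0|exact: lo].
Qed.

(** Stands in for a holomorphic branch of log (f / f 0) on the disc: only the real part is recorded,
    so no branch has to be chosen. *)
Definition logappr (r : R) (f : C -> C) := forall e, 0 < e ->
  exists P : {poly C}, P.[0] = 0 /\ forall z, normc z <= r ->
    `|ln (normc (f z)) - ln (normc (f 0)) - complex.Re P.[z]| <= e.

Lemma logappr_lin r (w : C) : 0 <= r -> r < normc w -> logappr r (fun z => z - w).
Proof.
move=> r0 rw e e0; have w0 : 0 < normc w by lra.
have wn : w != 0 by rewrite -nc_gt0.
have [t0 t1] : 0 <= r / normc w /\ r / normc w < 1.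
  by rewrite divr_ge0 ?(ltW w0) // ltr_pdivrMr // mul1r.
set t := r / normc w in t0 t1.
have d0 : 0 < 1 - t by lra.
have [n hn] : exists n, t ^+ n.+1 <= e * (1 - t).
  have /cvgrPdist_le /(_ _ (mulr_gt0 e0 d0)) [n _ hn] : t ^+ n @[n --> \oo] --> 0.
    by apply: cvg_expr; rewrite ger0_norm.
  by exists n; have := hn n.+1 (leqnSn n); rewrite /= sub0r normrN ger0_norm ?exprn_ge0.
exists (- \sum_(i < n) (w^-1 ^+ i.+1 / i.+1%:R) *: 'X^(i.+1)); split.
  rewrite hornerN horner_sum big1 ?oppr0 // => i _.
  by rewrite hornerZ hornerXn expr0n mulr0.
move=> z zr.
have zt : normc (z / w) <= t by rewrite normcM normcV /t ler_pM2r ?invr_gt0.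
have zw0 : 0 < normc (1 - z / w).
  by have := nc_dist 1 (z / w); rewrite nc1; lra.
have := ln_dist n zt t1.
have -> : z - w = - w * (1 - z / w) by field.
rewrite sub0r !normcM normcN lnM ?posrE //.
set S := complex.Re (\sum_(i < n) _).
have -> : complex.Re (- \sum_(i < n) (w^-1 ^+ i.+1 / i.+1%:R) *: 'X^(i.+1)).[z] = - S.
  rewrite hornerN raddfN horner_sum /S; congr (- complex.Re _); apply: eq_bigr => i _.
  by rewrite hornerZ hornerXn mulrAC -exprMn [w^-1 * z]mulrC.
rewrite (_ : _ - - S = ln (normc (1 - z / w)) + S); last by ring.
move=> /le_trans; apply.
by rewrite ler_pdivrMr.
Qed.

Lemma logappr_cst r (c : C) : logappr r (fun=> c).
Proof.
by move=> e e0; exists 0; rewrite horner0; split=> // z _; rewrite horner0 subrr subr0 normr0 ltW.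
Qed.

Lemma logapprM r f g : 0 <= r -> (forall z, normc z <= r -> f z != 0 /\ g z != 0) ->
  logappr r f -> logappr r g -> logappr r (fun z => f z * g z).
Proof.
move=> r0 h hf hg e e0; have e2 : 0 < e / 2 by lra.
have [P [P0 hP]] := hf _ e2; have [Q [Q0 hQ]] := hg _ e2.
exists (P + Q); rewrite hornerD P0 Q0 addr0; split=> // z zr.
have [fz gz] := h z zr; have [f0 g0] : f 0 != 0 /\ g 0 != 0 by apply: h; rewrite nc0.
rewrite !normcM !lnM ?posrE ?nc_gt0 // hornerD raddfD /=.
have := hP z zr; have := hQ z zr; rewrite !ler_norml; lra.
Qed.

Lemma logappr_poly r (p : {poly C}) : 0 <= r ->
  (forall z, normc z <= r -> p.[z] != 0) -> logappr r (horner p).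
Proof.
move=> r0 hp; have [s es] := poly_factor p.
have p0 : lead_coef p != 0.
  apply: contraTneq (hp 0 _); last by rewrite nc0.
  by move=> e; rewrite es e scale0r horner0 eqxx.
have sr : forall w, w \in s -> r < normc w.
  move=> w ws; rewrite ltNge; apply/negP => /hp /eqP; apply.
  rewrite es hornerZ horner_prod (big_rem w) //=.
  by rewrite hornerD hornerN hornerX hornerC subrr mul0r mulr0.
have pE : horner p = fun z => lead_coef p * \prod_(w <- s) (z - w).
  apply/funext => z; rewrite {1}es hornerZ horner_prod; congr (_ * _).
  by apply: eq_bigr => w _; rewrite hornerD hornerN hornerX hornerC.
have prod0 (s' : seq C) : (forall w, w \in s' -> r < normc w) -> forall z, normc z <= r ->
    \prod_(w <- s') (z - w) != 0.
  move=> hs z zr; rewrite prodf_seq_neq0; apply/allP => w ws /=.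
  by rewrite subr_eq0; apply/eqP => zw; have := hs w ws; rewrite -zw; lra.
rewrite pE; apply: logapprM => //; [|exact: logappr_cst|].
  by move=> z zr; split=> //; exact: prod0.
elim: s sr {es pE} => [|w s IH] sr.
  have -> : (fun z : C => \prod_(w <- [::]) (z - w)) = fun=> 1.
    by apply/funext => z; rewrite big_nil.
  exact: logappr_cst.
have -> : (fun z => \prod_(w0 <- w :: s) (z - w0)) = fun z => (z - w) * \prod_(w0 <- s) (z - w0).
  by apply/funext => z; rewrite big_cons.
have ss v : v \in s -> r < normc v by move=> vs; rewrite sr // inE vs orbT.
have rw : r < normc w by rewrite sr ?mem_head.
apply: logapprM => //; [|exact: logappr_lin|exact: IH].
move=> z zr; split; last exact: prod0.
by rewrite subr_eq0; apply/eqP => zw; rewrite -zw in rw; lra.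
Qed.

Lemma ln_close (a b d : R) : 0 < d -> d <= a -> d <= b -> `|ln a - ln b| <= `|a - b| / d.
Proof.
move=> d0 da db; have a0 : 0 < a by lra.
have b0 : 0 < b by lra.
have H (x y : R) : 0 < x -> 0 < y -> d <= y -> ln x - ln y <= `|x - y| / d.
  move=> x0 y0 dy; rewrite -ln_div ?posrE //.
  have -> : x / y = 1 + (x - y) / y by field; rewrite gt_eqF.
  have h : (x - y) / y <= `|x - y| / d.
    apply: le_trans (_ : `|x - y| / y <= _); first by rewrite ler_pM2r ?invr_gt0 ?ler_norm.
    by rewrite ler_wpM2l // lef_pV2 ?posrE.
  apply: le_trans h; apply: le_ln1Dx.
  rewrite ltr_pdivlMr //; lra.
rewrite ler_norml; have := H a b a0 b0 db; have := H b a b0 a0 da; rewrite (distrC b a); lra.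
Qed.

Lemma logappr_appr r f : 0 <= r -> appr r f -> (forall z, normc z <= r -> f z != 0) ->
  logappr r f.
Proof.
move=> r0 hf f0; have [d d0 hd] := appr_lower r0 hf f0.
move=> e e0; have [p hp] : exists p : {poly C}, forall z, normc z <= r ->
    normc (f z - p.[z]) <= Num.min (d / 2) (e * d / 8%:R).
  by apply: hf; rewrite lt_min !divr_gt0 ?mulr_gt0.
have pd z : normc z <= r -> d / 2 <= normc p.[z].
  move=> zr; have := hp z zr; rewrite le_min => /andP[h _].
  have := hd z zr; have := nc_dist (f z) p.[z]; lra.
have e2 : 0 < e / 2 by lra.
have [P [P0 hP]] : exists P : {poly C}, P.[0] = 0 /\ forall z, normc z <= r ->
    `|ln (normc p.[z]) - ln (normc p.[0]) - complex.Re P.[z]| <= e / 2.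
  by apply: logappr_poly => // z zr; rewrite -nc_gt0; have := pd z zr; lra.
have cl z : normc z <= r -> `|ln (normc (f z)) - ln (normc p.[z])| <= e / 4%:R.
  move=> zr; apply: le_trans (@ln_close _ _ (d / 2) _ _ _) _; [lra| |exact: pd|].
    by have := hd z zr; lra.
  rewrite ler_pdivrMr; last lra.
  have := hp z zr; rewrite le_min => /andP[_ h].
  apply: le_trans (_ : normc (f z - p.[z]) <= _); last by lra.
  rewrite ler_norml; have := nc_dist (f z) p.[z]; have := nc_dist p.[z] (f z).
  rewrite (ncB p.[z]); lra.
exists P; split=> // z zr.
have := cl z zr; have := cl 0; rewrite nc0 => /(_ r0).
have := hP z zr; rewrite !ler_norml; lra.
Qed.

(** Borel-Caratheodory for the polynomial approximating log (f / f 0), whose real part is at most ln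
    M - ln |f 0| up to the error. The point is that an upper bound for a zero-free function yields a
    lower one. *)
Lemma harnack (r : R) f (M : R) : 0 < r -> appr r f -> (forall z, normc z <= r -> f z != 0) ->
  (forall z, normc z <= r -> normc (f z) <= M) -> forall z, normc z < r ->
  `|ln (normc (f z)) - ln (normc (f 0))| <=
    2 * (ln M - ln (normc (f 0))) * normc z / (r - normc z).
Proof.
move=> r0 hf f0 fM z zr; apply/ler_addgt0Pr => e e0.
have z0 := nc_ge0 z; have d0 : 0 < r - normc z by lra.
have zz : normc (0 : C) <= r by rewrite nc0 ltW.
have f00 : 0 < normc (f 0) by rewrite nc_gt0 f0.
have M0 : 0 < M by exact: lt_le_trans f00 (fM 0 zz).
pose c := 2 * normc z / (r - normc z).
have c0 : 0 <= c by rewrite divr_ge0 ?mulr_ge0 ?(ltW d0).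
pose e1 := e / (c + 1).
have e10 : 0 < e1 by rewrite divr_gt0 //; lra.
have [P [P0 hP]] := logappr_appr (ltW r0) hf f0 e10.
set A := ln M - ln (normc (f 0)).
have A0 : 0 <= A by rewrite subr_ge0 ler_ln ?posrE ?fM.
have PA w : normc w <= r -> complex.Re P.[w] <= A + e1.
  move=> wr; have := hP w wr; rewrite ler_norml => /andP[h _].
  have : ln (normc (f w)) <= ln M by rewrite ler_ln ?posrE ?fM ?nc_gt0 ?f0.
  by rewrite /A; lra.
have Ae : 0 < A + e1 by lra.
have := poly_BC r0 Ae P0 PA zr; have := hP z (ltW zr).
have -> : 2 * (A + e1) * normc z / (r - normc z) = 2 * A * normc z / (r - normc z) + c * e1.
  by rewrite /c; field; rewrite gt_eqF.
have -> : e = c * e1 + e1 by rewrite /e1; field; rewrite gt_eqF //; lra.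
have := nc_ge_Re P.[z]; rewrite !ler_norml; lra.
Qed.

End LogModulus.

(** * Entire functions of order 1/4 *)

Section Entire.
Variable R : realType.
Local Notation C := R[i].
Local Open Scope complex_scope.
Local Open Scope classical_set_scope.

Definition entire (f : C -> C) := forall r : R, appr r f.

(* Growth of order 1/4, in terms of the fourth root k of the radius. *)
Definition growth (f : C -> C) := exists2 A : R, 0 < A & forall (k : R) z, 1 <= k ->
  normc z <= k ^+ 4 -> normc (f z) <= A * expR (A * k).

Lemma entireM f g : entire f -> entire g -> entire (fun z => f z * g z).
Proof. by move=> hf hg r; apply: apprM. Qed.

Lemma entireD f g : entire f -> entire g -> entire (fun z => f z + g z).
Proof. by move=> hf hg r; apply: apprD. Qed.

Lemma entireB f g : entire f -> entire g -> entire (fun z => f z - g z).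
Proof. by move=> hf hg r; apply: apprB. Qed.

Lemma entire_cst c : entire (fun=> c).
Proof. by move=> r; apply: appr_cst. Qed.

Lemma entire_shift f c : entire f -> entire (fun z => f (z + c)).
Proof.
move=> hf r e e0; have [p hp] := hf (r + normc c) e e0.
exists (p \Po ('X + c%:P)) => z zr; rewrite horner_comp hornerD hornerX hornerC.
by apply: hp; apply: le_trans (le_normcD _ _) _; rewrite lerD2r.
Qed.

Lemma growthD f g : growth f -> growth g -> growth (fun z => f z + g z).
Proof.
move=> [A A0 hA] [B B0 hB]; exists (A + B) => [|k z k1 zk]; first lra.
apply: le_trans (le_normcD _ _) _; rewrite mulrDl; apply: lerD.
  apply: le_trans (hA _ _ k1 zk) _; rewrite ler_pM2l // ler_expR ler_wpM2r //; lra.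
apply: le_trans (hB _ _ k1 zk) _; rewrite ler_pM2l // ler_expR ler_wpM2r //; lra.
Qed.

Lemma growthM f g : growth f -> growth g -> growth (fun z => f z * g z).
Proof.
move=> [A A0 hA] [B B0 hB]; exists (A * B + A + B) => [|k z k1 zk]; first by nra.
have AB : 0 < A * B by apply: mulr_gt0.
rewrite normcM; apply: le_trans (_ : (A * expR (A * k)) * (B * expR (B * k)) <= _).
  by apply: ler_pM; rewrite ?nc_ge0 ?hA ?hB.
rewrite mulrACA -expRD -mulrDl; apply: ler_pM; rewrite ?expR_ge0 ?ltW //; first lra.
by rewrite ltr_expR; nra.
Qed.

Lemma growth_cst c : growth (fun=> c).
Proof.
exists (normc c + 1) => [|k z k1 _]; first by have := nc_ge0 c; lra.
have := nc_ge0 c => c0; apply: le_trans (_ : (normc c + 1) * 1 <= _); first lra.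
rewrite ler_wpM2l //; first lra.
by apply: le_trans (expR_ge1Dx _); rewrite lerDl mulr_ge0 //; lra.
Qed.

Lemma growthB f g : growth f -> growth g -> growth (fun z => f z - g z).
Proof.
move=> [A A0 hA] [B B0 hB]; have h : growth (fun z => - g z).
  by exists B => // k z k1 zk; rewrite normcN hB.
by apply: growthD h; exists A.
Qed.

Lemma pow4_ge (k : R) : 1 <= k -> k <= k ^+ 4.
Proof. by move=> k1; rewrite -[leLHS]expr1; apply: ler_weXn2l. Qed.

Lemma pow4_add (a b : R) : 0 <= a -> 0 <= b -> a ^+ 4 + b ^+ 4 <= (a + b) ^+ 4.
Proof.
move=> a0 b0; have -> : (a + b) ^+ 4 = a ^+ 4 + b ^+ 4 +
  (4%:R * a ^+ 3 * b + 6%:R * a ^+ 2 * b ^+ 2 + 4%:R * a * b ^+ 3) by ring.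
by rewrite lerDl !addr_ge0 // !mulr_ge0 ?exprn_ge0.
Qed.

Lemma growth_shift f c : growth f -> growth (fun z => f (z + c)).
Proof.
move=> [A A0 hA]; set d := normc c + 1.
have d1 : 1 <= d by rewrite /d; have := nc_ge0 c; lra.
exists (A * expR (A * d) + A) => [|k z k1 zk].
  by have := mulr_gt0 A0 (expR_gt0 (A * d)); lra.
apply: le_trans (hA (k + d) _ _ _) _; [lra| |].
  apply: le_trans (le_normcD _ _) _; apply: le_trans (pow4_add _ _); [|lra|lra].
  by rewrite lerD //; apply: le_trans (pow4_ge d1); rewrite /d; lra.
have e0 := expR_gt0 (A * d); have := mulr_gt0 A0 e0 => Ae.
rewrite mulrDr expRD [expR (A * k) * _]mulrC mulrA.
apply: ler_pM; rewrite ?expR_ge0 ?ltW //; first lra.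
by rewrite ltr_expR ltr_pM2r //; lra.
Qed.

Lemma appr_eq_off r (d : C -> C) w : normc w < r -> appr r d ->
  (forall z, normc z <= r -> z != w -> d z = 0) -> d w = 0.
Proof.
move=> wr hd d0; apply: nc_small0 => e e0.
have [s s0 hs] := appr_cont hd (ltW wr) e0.
pose t := Num.min s (r - normc w).
have t0 : 0 < t by rewrite lt_min s0 subr_gt0.
have tn : normc (t%:C : C) = t by rewrite nc_real ger0_norm // ltW.
have zr : normc (w + t%:C) <= r.
  apply: le_trans (le_normcD _ _) _; rewrite tn -lerBrDl.
  by rewrite /t ge_min lexx orbT.
have := hs (w + t%:C) zr; rewrite [w + _]addrC addrK tn d0; last 2 first.
- by rewrite addrC.
- by rewrite -subr_eq0 addrK -nc_gt0 tn.
by rewrite sub0r normcN; apply; rewrite /t ge_min lexx.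
Qed.

Lemma entire_eq_off (d : C -> C) w : entire d -> (forall z, z != w -> d z = 0) -> d w = 0.
Proof.
move=> hd d0; apply: (appr_eq_off (r := normc w + 1) _ (hd _)); first lra.
by move=> z _; exact: d0.
Qed.

Lemma entire_cancel (d : C -> C) w : entire d -> (forall z, (z - w) * d z = 0) -> forall z, d z = 0.
Proof.
move=> hd h; have hw z : z != w -> d z = 0.
  by move=> zw; have /eqP := h z; rewrite mulf_eq0 subr_eq0 (negPf zw) /= => /eqP.
by move=> z; have [->|/hw//] := eqVneq z w; exact: entire_eq_off hd hw.
Qed.

(** The quotients constructed on different discs agree off w, hence also at w by continuity, so they
    can be glued. *)
Lemma entire_div f w : entire f -> f w = 0 ->
  exists2 g, entire g & forall z, f z = (z - w) * g z.
Proof.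
move=> hf fw; have w1 : normc w < normc w + 1 by lra.
have [g hg fg] := appr_div (hf _) w1 fw.
exists g => // r; have [r1|r1] := leP r (normc w + 1); first exact: appr_le r1 hg.
have [g' hg' fg'] := appr_div (hf r) (lt_trans w1 r1) fw.
have off z : z != w -> g z = g' z.
  by move=> zw; apply: (mulfI (_ : z - w != 0)); rewrite ?subr_eq0 // -fg -fg'.
suff gw : g w = g' w.
  by apply: (appr_ext _ hg') => z _; have [->|/off->//] := eqVneq z w.
apply/eqP; rewrite -subr_eq0; apply/eqP.
apply: (appr_eq_off (d := fun z => g z - g' z) w1).
  by apply: apprB hg _; apply: appr_le hg'; exact: ltW.
by move=> z _ zw; rewrite off // subrr.
Qed.

(** On the circle of radius (k + d)^4 the divisor has modulus at least 1, and the maximum principle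
    carries the bound inside. Passing from k to k + d only changes the constant. *)
Lemma growth_div f g w : growth f -> entire g -> (forall z, f z = (z - w) * g z) -> growth g.
Proof.
move=> hf hg fg; set d := normc w + 1.
have d1 : 1 <= d by rewrite /d; have := nc_ge0 w; lra.
have [A A0 hA] := hf.
have [B B0 hB] : growth (fun z => A%:C * (expR (A * d) - 0)%:C) by exact: growth_cst.
exists (A * expR (A * d) + A) => [|k z k1 zk].
  by have := mulr_gt0 A0 (expR_gt0 (A * d)); lra.
apply: le_trans (_ : A * expR (A * (k + d)) <= _); last first.
  have e0 := expR_gt0 (A * d); have := mulr_gt0 A0 e0 => Ae.
  rewrite mulrDr expRD [expR (A * k) * _]mulrC mulrA.
  apply: ler_pM; rewrite ?expR_ge0 ?ltW //; first lra.
  by rewrite ltr_expR ltr_pM2r //; lra.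
have h4 := pow4_add (ltac:(lra) : 0 <= k) (ltac:(lra) : 0 <= d).
apply: (appr_disc_max (r := (k + d) ^+ 4)); [exact: hg| |]; last first.
  by apply: le_trans zk _; apply: le_trans h4; rewrite lerDl exprn_ge0 //; lra.
move=> v vk; apply: le_trans (hA (k + d) v _ _); [|lra|by rewrite vk].
rewrite fg normcM -[leLHS]mul1r ler_wpM2r ?nc_ge0 //.
have := nc_dist v w; rewrite vk; have := pow4_ge d1; have := exprn_ge0 4 (ltac:(lra) : 0 <= k).
by rewrite /d in h4 *; lra.
Qed.

(** The difference quotient (f z - f 0) / z is at most 2M / r on the circle of radius r, hence
    inside it, and r is arbitrary. *)
Lemma liouville f (M : R) : entire f -> (forall z, normc (f z) <= M) -> forall z, f z = f 0.
Proof.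
move=> hf fM z.
have [g hg fg] : exists2 g, entire g & forall z, f z - f 0 = (z - 0) * g z.
  by apply: entire_div; [apply: entireB => //; exact: entire_cst|rewrite subrr].
have M0 : 0 <= M by apply: le_trans (nc_ge0 _) (fM 0).
suff gz : g z = 0 by apply/eqP; rewrite -subr_eq0 fg gz mulr0.
apply: nc_small0 => e e0.
pose r := normc z + (2 * M) / e + 1.
have z0 := nc_ge0 z; have q0 : 0 <= 2 * M / e by rewrite divr_ge0 ?(ltW e0) //; lra.
have r0 : 0 < r by rewrite /r; lra.
apply: (appr_disc_max (r := r)); [exact: hg| |by rewrite /r; lra].
move=> v vr; have : normc (f v - f 0) <= 2 * M.
  by apply: le_trans (le_normcD _ _) _; rewrite normcN; have := fM v; have := fM 0; lra.
rewrite fg subr0 normcM vr => h; rewrite -(ler_pM2l r0); apply: le_trans h _.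
rewrite -ler_pdivrMr // /r; lra.
Qed.

Lemma expR_ge (x : R) : x <= expR x.
Proof. by have := expR_ge1Dx x; lra. Qed.

(** On the disc of radius k^4, ln |f| is bounded above by a multiple of k, and Harnack's inequality
    at a fixed z gains a factor of order |z| / k^4. As k grows, |f z| <= |f 0| remains, and
    Liouville's theorem applies. *)
Lemma zero_free_const f : entire f -> growth f -> (forall z, f z != 0) -> forall z, f z = f 0.
Proof.
move=> hf [A A0 hA] f0; apply: (liouville (M := normc (f 0))) => // z.
have nf0 w : 0 < normc (f w) by rewrite nc_gt0.
rewrite -ler_ln ?posrE //; apply/ler_addgt0Pr => e e0.
set B := ln A - ln (normc (f 0)).
(* Large enough for |z| <= k^4 / 2 and for the resulting bound, of order |z| / k, to be at most
   e. *)
pose k := 1 + 2 * normc z + 4%:R * (`|B| + A) * normc z / e.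
have z0 := nc_ge0 z; have B0 := normr_ge0 B.
have q0 : 0 <= 4%:R * (`|B| + A) * normc z / e.
  by rewrite divr_ge0 ?(ltW e0) // !mulr_ge0 //; lra.
have k1 : 1 <= k by rewrite /k; lra.
have k4 := pow4_ge k1.
have r0 : 0 < k ^+ 4 by rewrite exprn_gt0 //; lra.
have zk : normc z < k ^+ 4 by apply: lt_le_trans k4; rewrite /k; lra.
have Ae : 0 < A * expR (A * k) by rewrite mulr_gt0 ?expR_gt0.
have fM w : normc w <= k ^+ 4 -> normc (f w) <= A * expR (A * k) by exact: hA.
have := harnack r0 (hf _) (fun w _ => f0 w) fM zk.
rewrite lnM ?posrE ?expR_gt0 // expRK ler_norml => /andP[_ h].
suff : 2 * (ln A + A * k - ln (normc (f 0))) * normc z / (k ^+ 4 - normc z) <= e by lra.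
rewrite ler_pdivrMr; last lra.
have k2 : 0 <= k ^+ 2 * (k ^+ 2 - 1).
  by rewrite mulr_ge0 ?sqr_ge0 // subr_ge0 expr_ge1 //; lra.
have kk : k ^+ 2 <= k ^+ 4.
  have -> : k ^+ 4 = k ^+ 2 * (k ^+ 2 - 1) + k ^+ 2 by ring.
  lra.
have hk : k * k <= 2 * (k ^+ 4 - normc z).
  have : normc z * 2 <= k by rewrite /k; lra.
  have : k <= k ^+ 2 by rewrite expr2; nra.
  by rewrite -expr2; lra.
have h1 : ln A + A * k - ln (normc (f 0)) <= (`|B| + A) * k.
  have := ler_norm B; rewrite {1}/B => ?; have : `|B| <= `|B| * k by nra.
  by rewrite mulrDl; lra.
have h2 : 4%:R * (`|B| + A) * normc z <= e * k.
  by rewrite [leRHS]mulrC -ler_pdivrMr // /k; lra.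
have : 2 * (ln A + A * k - ln (normc (f 0))) * normc z <= 2 * ((`|B| + A) * k) * normc z.
  by rewrite ler_wpM2r // ler_pM2l.
nra.
Qed.

End Entire.

(** * Entire quotients and their growth *)

Section Quotient.
Variable R : realType.
Local Notation C := R[i].
Local Open Scope complex_scope.
Local Open Scope classical_set_scope.

Definition root_prod (s : seq C) (z : C) : C := \prod_(w <- s) (z - w).

Lemma root_prod_cons w s z : root_prod (w :: s) z = (z - w) * root_prod s z.
Proof. by rewrite /root_prod big_cons. Qed.

Lemma entire_root_prod s : entire (root_prod s).
Proof.
elim: s => [|w s IH] r.
  by apply: (appr_ext _ (appr_cst r 1)) => z _; rewrite /root_prod big_nil.
apply: (appr_ext (f := fun z => (z - w) * root_prod s z)).
  by move=> z _; rewrite root_prod_cons.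
apply: apprM (IH r); apply: (appr_ext _ (appr_poly r ('X - w%:P))) => z _.
by rewrite hornerD hornerN hornerX hornerC.
Qed.

Lemma root_prod_lower s (r : R) z : 0 < r -> (forall w, w \in s -> normc w <= r) ->
  normc z = 3%:R * r -> (2 * r) ^+ size s <= normc (root_prod s z).
Proof.
move=> r0 hs zr; elim: s hs => [|w s IH] hs.
  by rewrite /root_prod big_nil nc1 expr0.
rewrite root_prod_cons normcM /= exprS; apply: ler_pM.
- by lra.
- by rewrite exprn_ge0 //; lra.
- have := nc_dist z w; have := hs w (mem_head _ _); rewrite zr; lra.
- by apply: IH => v vs; rewrite hs // inE vs orbT.
Qed.

Lemma root_prod_upper0 s (r : R) : 0 < r -> (forall w, w \in s -> normc w <= r) ->
  normc (root_prod s 0) <= r ^+ size s.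
Proof.
move=> r0; elim: s => [|w s IH] hs; first by rewrite /root_prod big_nil nc1 expr0.
rewrite root_prod_cons normcM /= exprS; apply: ler_pM; rewrite ?nc_ge0 //.
- by rewrite sub0r normcN hs ?mem_head.
- by apply: IH => v vs; rewrite hs // inE vs orbT.
Qed.

Lemma root_prod_cancel (d : C -> C) s : entire d -> (forall z, root_prod s z * d z = 0) ->
  forall z, d z = 0.
Proof.
move=> hd; elim: s => [|w s IH] h z.
  by have := h z; rewrite /root_prod big_nil mul1r.
apply: IH => v; apply: (entire_cancel (d := fun v => root_prod s v * d v) (w := w)).
  by apply: entireM => //; exact: entire_root_prod.
by move=> u; rewrite mulrA -root_prod_cons.
Qed.

(** The division f / g is carried out for any relation that makes f vanish at the zeros of g and
    survives the removal of a common linear factor; multiplicities are then taken care of by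
    iteration. The instances are [spectral_rel] and [cofactor_rel]. *)
Variable rel : (C -> C) -> (C -> C) -> Prop.
Hypothesis rel_entire : forall f g, rel f g -> entire f /\ entire g.
Hypothesis rel_zero : forall f g w, rel f g -> g w = 0 -> f w = 0.
Hypothesis rel_div : forall f g f1 g1 w, rel f g -> g w = 0 -> entire f1 -> entire g1 ->
  (forall z, f z = (z - w) * f1 z) -> (forall z, g z = (z - w) * g1 z) -> rel f1 g1.

Variables (f g : C -> C).
Hypothesis fg : rel f g.
Hypothesis g0 : g 0 != 0.

Definition reduced (r : R) (s : seq C) (f1 g1 : C -> C) :=
  [/\ rel f1 g1, forall w, w \in s -> normc w <= r,
      forall z, f z = root_prod s z * f1 z & forall z, g z = root_prod s z * g1 z].

(** On the circle of radius 3r every factor z - w has modulus at least 2r, and the maximum principle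
    does the rest. *)
Lemma reduced_upper r s f1 g1 M : 0 < r -> reduced r s f1 g1 ->
  (forall z, normc z <= 3%:R * r -> normc (f z) <= M) ->
  forall z, normc z <= 3%:R * r -> normc (f1 z) <= M / (2 * r) ^+ size s.
Proof.
move=> r0 [/rel_entire[ef eg] sr hf hg] fM; apply: appr_disc_max => //.
move=> z zr; rewrite ler_pdivlMr ?exprn_gt0 //; last lra.
apply: le_trans (fM z _); last by rewrite zr.
rewrite hf normcM [leRHS]mulrC; apply: ler_wpM2l; first exact: nc_ge0.
exact: root_prod_lower.
Qed.

Lemma reduced_upper' r s f1 g1 M : 0 < r -> reduced r s f1 g1 ->
  (forall z, normc z <= 3%:R * r -> normc (g z) <= M) ->
  forall z, normc z <= 3%:R * r -> normc (g1 z) <= M / (2 * r) ^+ size s.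
Proof.
move=> r0 [/rel_entire[ef eg] sr hf hg] fM; apply: appr_disc_max => //.
move=> z zr; rewrite ler_pdivlMr ?exprn_gt0 //; last lra.
apply: le_trans (fM z _); last by rewrite zr.
rewrite hg normcM [leRHS]mulrC; apply: ler_wpM2l; first exact: nc_ge0.
exact: root_prod_lower.
Qed.

Lemma reduced_lower0 r s f1 g1 : 0 < r -> reduced r s f1 g1 ->
  normc (g 0) <= r ^+ size s * normc (g1 0).
Proof.
move=> r0 [_ sr _ hg]; rewrite hg normcM; apply: ler_wpM2r; first exact: nc_ge0.
exact: root_prod_upper0.
Qed.

(** Zeros are removed one at a time. The process stops, because n removed zeros give |g 0| <= r^n
    |g1 0| <= M / 2^n, a weak form of Jensen's bound on the number of zeros. *)
Lemma reduced_exists r : 0 < r -> exists s f1 g1, reduced r s f1 g1 /\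
  forall z, normc z <= r -> g1 z != 0.
Proof.
move=> r0; have [ef eg] := rel_entire fg.
have [M M0 hM] := appr_bound (eg (3%:R * r)).
have ng : 0 < normc (g 0) by rewrite nc_gt0.
have [n hn] : exists n, M / normc (g 0) < 2 ^+ n.
  have := truncnS_gt (M / normc (g 0)); set n := Num.truncn _ => h; exists n.+1.
  by apply: lt_trans h _; rewrite -natrX ltr_nat ltn_expl.
have bound s f1 g1 : reduced r s f1 g1 -> (size s < n)%N.
  move=> h; rewrite ltnNge; apply/negP => ns.
  have h1 := reduced_lower0 r0 h.
  have h2 := reduced_upper' r0 h hM (z := 0).
  rewrite nc0 in h2; have {}h2 := h2 (ltac:(lra)).
  move: h2; rewrite exprMn; set k := size s in ns h1 *.
  have rk : 0 < r ^+ k by rewrite exprn_gt0.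
  have tk : (0 : R) < 2 ^+ k by rewrite exprn_gt0.
  have nk : (2 : R) ^+ n <= 2 ^+ k by rewrite ler_weXn2l // ler1n.
  rewrite ler_pdivlMr ?mulr_gt0 // => h2.
  move: hn; rewrite ltr_pdivrMr //.
  have : 2 ^+ n * normc (g 0) <= 2 ^+ k * (r ^+ k * normc (g1 0)).
    by apply: ler_pM => //; rewrite ltW // exprn_gt0.
  by lra.
suff H k : forall s f1 g1, reduced r s f1 g1 -> (n <= size s + k)%N ->
    exists s f1 g1, reduced r s f1 g1 /\ forall z, normc z <= r -> g1 z != 0.
  apply: (H n [::] f g _ (leqnn n)); split=> // z; rewrite /root_prod big_nil mul1r //.
elim: k => [|k IH] s f1 g1 h; first by rewrite addn0 leqNgt (bound _ _ _ h).
rewrite addnS -addSn => sk.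
have [[w [wr gw]]|no] := pselect (exists w, normc w <= r /\ g1 w = 0); last first.
  exists s, f1, g1; split=> // z zr; apply/eqP => gz; apply: no; by exists z.
have [h1 sr hf hg] := h; have [ef1 eg1] := rel_entire h1.
have fw := rel_zero h1 gw.
have [f2 ef2 hf2] := entire_div ef1 fw; have [g2 eg2 hg2] := entire_div eg1 gw.
apply: (IH (w :: s) f2 g2) sk; split.
- exact: rel_div h1 gw ef2 eg2 hf2 hg2.
- by move=> v; rewrite inE => /predU1P[->|/sr].
- by move=> z; rewrite root_prod_cons hf hf2 mulrCA mulrA.
- by move=> z; rewrite root_prod_cons hg hg2 mulrCA mulrA.
Qed.

Lemma reduced_cross r s f1 g1 r' s' f2 g2 : reduced r s f1 g1 -> reduced r' s' f2 g2 ->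
  forall z, f1 z * g2 z = f2 z * g1 z.
Proof.
move=> [/rel_entire[ef1 eg1] _ hf hg] [/rel_entire[ef2 eg2] _ hf' hg'] z.
apply/eqP; rewrite -subr_eq0; apply/eqP.
apply: (root_prod_cancel (d := fun z => f1 z * g2 z - f2 z * g1 z) (s := s ++ s')).
  by apply: entireB; apply: entireM.
move=> v; have -> : root_prod (s ++ s') v = root_prod s v * root_prod s' v.
  by rewrite /root_prod big_cat.
have -> : root_prod s v * root_prod s' v * (f1 v * g2 v - f2 v * g1 v) =
  (root_prod s v * f1 v) * (root_prod s' v * g2 v) -
  (root_prod s' v * f2 v) * (root_prod s v * g1 v) by ring.
by rewrite -hf -hg' -hf' -hg subrr.
Qed.

(** Glues the quotients f1 / g1 obtained on the discs of radius n + 1. For the growth, f1 is bounded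
    above by the maximum principle and g1 below by Harnack's inequality; the number of removed
    zeros, over which there is no good control, drops out of the estimate. *)
Lemma quotient_entire : growth f -> growth g ->
  exists h, [/\ entire h, growth h, forall z, f z = g z * h z &
    forall z, exists f1 g1, [/\ rel f1 g1, g1 z != 0 & h z = f1 z / g1 z]].
Proof.
move=> [A A0 hA] [B B0 hB].
have /choice [T hT] : forall n : nat, exists t : seq C * ((C -> C) * (C -> C)),
    reduced n.+1%:R t.1 t.2.1 t.2.2 /\ forall z, normc z <= n.+1%:R -> t.2.2 z != 0.
  move=> n; have [|s [f1 [g1 h]]] := @reduced_exists n.+1%:R; first by rewrite ltr0Sn.
  by exists (s, (f1, g1)).
pose h (z : C) := (T (Num.truncn (normc z))).2.1 z / (T (Num.truncn (normc z))).2.2 z.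
have trn (z : C) : normc z <= (Num.truncn (normc z)).+1%:R by rewrite ltW // truncnS_gt.
have hE r s f1 g1 z : reduced r s f1 g1 -> g1 z != 0 -> h z = f1 z / g1 z.
  move=> h1 gz; have [h2 g2] := hT (Num.truncn (normc z)).
  have gz2 := g2 z (trn z); have cr := reduced_cross h1 h2 z.
  rewrite /h; apply/eqP; rewrite eqr_div //; apply/eqP.
  exact: esym cr.
exists h; split.
- move=> r; pose n := Num.truncn r.
  have rn : r <= n.+1%:R by rewrite ltW // truncnS_gt.
  have [h1 g1] := hT n; have [/rel_entire[ef1 eg1] _ _ _] := h1.
  apply: (appr_le rn).
  apply: (@appr_ext _ _ (fun z => (T n).2.1 z * ((T n).2.2 z)^-1)).
    by move=> z zn; rewrite (hE _ _ _ _ _ h1) // g1.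
  apply: apprM; first exact: ef1.
  by apply: appr_inv; rewrite ?ler0n.
- have ng : 0 < normc (g 0) by rewrite nc_gt0.
  set G := normc (g 0) in ng *.
  pose A' := A * B ^+ 2 / G ^+ 3; pose E := 2 * A + 4%:R * B.
  have A'0 : 0 < A' by rewrite /A' divr_gt0 ?mulr_gt0 ?exprn_gt0.
  exists (A' + E) => [|k z k1 zk]; first by rewrite /E; lra.
  have k4 : 1 <= k ^+ 4 by rewrite expr_ge1 //; lra.
  pose r := 2 * k ^+ 4; have r0 : 0 < r by rewrite /r; lra.
  have r3 v : normc v <= 3%:R * r -> normc v <= (2 * k) ^+ 4.
    by move=> /le_trans; apply; rewrite /r exprMn; lra.
  have k2 : 1 <= 2 * k by lra.
  have fM v : normc v <= 3%:R * r -> normc (f v) <= A * expR (A * (2 * k)).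
    by move=> /r3; exact: hA.
  have gM v : normc v <= 3%:R * r -> normc (g v) <= B * expR (B * (2 * k)).
    by move=> /r3; exact: hB.
  have [s [f1 [g1 [h1 gn0]]]] := reduced_exists r0.
  have zr : normc z <= r by rewrite /r; lra.
  have [/rel_entire[ef1 eg1] _ _ _] := h1.
  rewrite (hE _ _ _ _ _ h1 (gn0 z zr)) normcM normcV.
  have f1M := reduced_upper r0 h1 fM (z := z) (ltac:(lra)).
  have g1M := reduced_upper' r0 h1 gM.
  have g10 := reduced_lower0 r0 h1; rewrite -/G in g10.
  set Mf := A * expR _ in f1M; set Mg := B * expR _ in g1M.
  set n := size s in f1M g1M g10.
  set a := r ^+ n in g10; set b := (2 * r) ^+ n in f1M g1M.
  have rn : 0 < a by rewrite exprn_gt0.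
  have tn : 0 < b by rewrite exprn_gt0 //; lra.
  have tr : a <= b by apply: lerXn2r; rewrite ?nnegrE; lra.
  have Mf0 : 0 < Mf by rewrite /Mf mulr_gt0 ?expR_gt0.
  have Mg0 : 0 < Mg by rewrite /Mg mulr_gt0 ?expR_gt0.
  set M1 := Mg / b in g1M.
  have M10 : 0 < M1 by rewrite divr_gt0.
  have gz : 0 < normc (g1 z) by rewrite nc_gt0 gn0.
  have zz : normc (0 : C) <= r by rewrite nc0 ltW.
  have gg : 0 < normc (g1 0) by rewrite nc_gt0 gn0.
  (* For |z| <= r / 2 Harnack's factor 2 |z| / (r - |z|) is at most 2, whence ln |g1 z| >= 3 ln |g1
     0| - 2 ln M1. *)
  have low : normc (g1 0) ^+ 3 <= normc (g1 z) * M1 ^+ 2.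
    have p1 : 0 < normc (g1 0) ^+ 3 by rewrite exprn_gt0.
    have p2 : 0 < M1 ^+ 2 by rewrite exprn_gt0.
    have p3 : 0 < normc (g1 z) * M1 ^+ 2 by rewrite mulr_gt0.
    suff : ln (normc (g1 0) ^+ 3) <= ln (normc (g1 z) * M1 ^+ 2) by rewrite ler_ln.
    rewrite (lnM gz p2) !lnXn //.
    have zr2 : normc z <= r / 2 by rewrite /r; lra.
    have zr3 : normc z < r by lra.
    have := harnack r0 (eg1 _) gn0 (fun v vr => g1M v (ltac:(lra) : normc v <= 3%:R * r)) zr3.
    set X := ln M1; set Y := ln (normc (g1 0)); set Z := ln (normc (g1 z)).
    have XY : 0 <= X - Y by rewrite subr_ge0 /X /Y ler_ln ?posrE // g1M // nc0; lra.
    have : 2 * (X - Y) * normc z / (r - normc z) <= 2 * (X - Y).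
      rewrite ler_pdivrMr; last lra.
      by apply: ler_wpM2l; [rewrite mulr_ge0|lra].
    rewrite ler_norml -[Y *+ 3]mulr_natl -[X *+ 2]mulr_natl; lra.
  (* The powers of [b] cancel: the bound of f1 carries one in the denominator, [M1 ^+ 2] two, and
     [a ^+ 3] is at most [b ^+ 3]. *)
  have step : normc (f1 z) / normc (g1 z) <= Mf * Mg ^+ 2 / G ^+ 3.
    rewrite ler_pdivrMr // mulrAC ler_pdivlMr ?exprn_gt0 //.
    apply: le_trans (_ : (Mf / b) * (a * normc (g1 0)) ^+ 3 <= _).
      apply: ler_pM; rewrite ?nc_ge0 ?exprn_ge0 ?(ltW ng) //.
      by apply: lerXn2r; rewrite ?nnegrE ?mulr_ge0 ?(ltW rn) ?(ltW ng) ?nc_ge0.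
    rewrite exprMn.
    apply: le_trans (_ : (Mf / b) * (b ^+ 3 * (normc (g1 z) * M1 ^+ 2)) <= _).
      apply: ler_wpM2l; first by rewrite divr_ge0 ?(ltW Mf0) ?(ltW tn).
      apply: ler_pM; [exact: exprn_ge0 (ltW rn)|exact: exprn_ge0 (ltW gg)| |exact: low].
      by apply: lerXn2r; rewrite ?nnegrE ?(ltW rn) ?(ltW tn).
    rewrite le_eqVlt; apply/orP; left; apply/eqP; rewrite /M1; field; exact: lt0r_neq0.
  apply: le_trans step _.
  have -> : Mf * Mg ^+ 2 / G ^+ 3 = A' * expR (E * k).
    rewrite /Mf /Mg /A' exprMn -expRM_natl.
    have -> : A * expR (A * (2 * k)) * (B ^+ 2 * expR (2 * (B * (2 * k)))) / G ^+ 3 =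
      A * B ^+ 2 / G ^+ 3 * (expR (A * (2 * k)) * expR (2 * (B * (2 * k)))) by ring.
    by rewrite -expRD; congr (_ * expR _); rewrite /E; ring.
  apply: ler_pM; rewrite ?expR_ge0 ?(ltW A'0) //; first by rewrite /E; lra.
  by rewrite ler_expR ler_wpM2r //; lra.
- move=> z; have [h1 g1] := hT (Num.truncn (normc z)).
  have gz := g1 z (trn z); rewrite (hE _ _ _ _ _ h1 gz).
  have [_ _ -> ->] := h1; rewrite -mulrA; congr (_ * _).
  by rewrite mulrCA divff // mulr1.
- move=> z; have [h1 g1] := hT (Num.truncn (normc z)).
  have gz := g1 z (trn z); have [rl _ _ _] := h1.
  by exists (T (Num.truncn (normc z))).2.1, (T (Num.truncn (normc z))).2.2.
Qed.

End Quotient.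

(** * The Phragmen-Lindelof principle *)

Section PhragmenLindelof.
Variable R : realType.
Local Notation C := R[i].
Local Open Scope complex_scope.
Local Open Scope classical_set_scope.

(* tan (pi / 8) *)
Definition tan8 : R := Num.sqrt 2 - 1.

Lemma tan8E : tan8 ^+ 2 = 1 - 2 * tan8.
Proof.
rewrite /tan8; have : Num.sqrt 2 ^+ 2 = 2 :> R by rewrite sqr_sqrtr.
move: (Num.sqrt 2) => s hs; rewrite sqrrB hs; ring.
Qed.

Lemma tan8_itv : 2 / 5%:R <= tan8 <= 1 / 2.
Proof.
have s0 : 0 <= Num.sqrt 2 :> R by exact: sqrtr_ge0.
have : Num.sqrt 2 ^+ 2 = 2 :> R by rewrite sqr_sqrtr.
by rewrite /tan8; move: (Num.sqrt 2) s0 => s s0 hs; apply/andP; split; nra.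
Qed.

(** The eighth power maps the boundary rays of the sector |arg w| <= pi / 8 to the negative axis, so
    a bound on that axis controls both of them. *)
Lemma sector_ray (x : R) : (x +i* (tan8 * x)) ^+ 8 = (- (64%:R * tan8 ^+ 4 * x ^+ 8))%:C.
Proof.
have h2 : (x +i* (tan8 * x)) ^+ 2 = (2 * tan8 * x ^+ 2) +i* (2 * tan8 * x ^+ 2).
  rewrite expr2; apply/eqP; rewrite eq_complex /=; apply/andP; split; apply/eqP; last ring.
  have -> : x * x - tan8 * x * (tan8 * x) = (1 - tan8 ^+ 2) * x ^+ 2 by ring.
  rewrite tan8E; ring.
rewrite -[8%N]/(2 * (2 * 2))%N 2!exprM h2 !expr2.
by apply/eqP; rewrite eq_complex /=; apply/andP; split; apply/eqP; ring.
Qed.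

Lemma sector_ray' (x : R) : (x -i* (tan8 * x)) ^+ 8 = (- (64%:R * tan8 ^+ 4 * x ^+ 8))%:C.
Proof.
have h2 : (x -i* (tan8 * x)) ^+ 2 = (2 * tan8 * x ^+ 2) -i* (2 * tan8 * x ^+ 2).
  rewrite expr2; apply/eqP; rewrite eq_complex /=; apply/andP; split; apply/eqP; last ring.
  have -> : x * x - - (tan8 * x) * - (tan8 * x) = (1 - tan8 ^+ 2) * x ^+ 2 by ring.
  rewrite tan8E; ring.
rewrite -[8%N]/(2 * (2 * 2))%N 2!exprM h2 !expr2.
by apply/eqP; rewrite eq_complex /=; apply/andP; split; apply/eqP; ring.
Qed.

Lemma sqrt_right (z : C) : exists2 w, w ^+ 2 = z & 0 <= complex.Re w.
Proof.
have [h|h] := leP 0 (complex.Re (sqrtc z)); first by exists (sqrtc z); rewrite ?sqr_sqrtc.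
exists (- sqrtc z); first by rewrite sqrrN sqr_sqrtc.
by rewrite raddfN /=; lra.
Qed.

Lemma sector_Im (x y : R) : 0 <= x -> 2 * x * `|y| <= x ^+ 2 - y ^+ 2 -> `|y| <= tan8 * x.
Proof.
move=> x0 h; have := tan8_itv; have := tan8E; set t := tan8 => tE /andP[t0 t1].
have y0 := normr_ge0 y; rewrite -(real_normK (num_real y)) in h.
move: (`|y|) y0 h => {}y y0 h; rewrite leNgt; apply/negP => yt.
have tx : 0 <= t * x by apply: mulr_ge0; lra.
have h1 : (t * x) ^+ 2 < y ^+ 2 by rewrite ltr_pXn2r ?nnegrE.
have h2 : 2 * x * (t * x) <= 2 * x * y by apply: ler_wpM2l; lra.
have h3 : (t * x) ^+ 2 + 2 * x * (t * x) = x ^+ 2.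
  by rewrite exprMn tE; ring.
lra.
Qed.

(** Three successive square roots in the right half-plane. As w, w^2 and w^4 all have nonnegative
    real part, the argument of w is at most pi / 8. *)
Lemma root8 (z : C) : exists2 w, w ^+ 8 = z &
  0 <= complex.Re w /\ `|complex.Im w| <= tan8 * complex.Re w.
Proof.
have [w1 <- h1] := sqrt_right z; have [w2 e2 h2] := sqrt_right w1.
have [w3 e3 h3] := sqrt_right w2.
exists w3; first by rewrite -e2 -e3 -!exprM.
split=> //; apply: sector_Im => //.
rewrite -e2 in h1; rewrite -e3 in h1 h2; move: h1 h2 h3 {e2 e3}; case: w3 => x y.
rewrite !expr2 /= => h1 h2 x0.
have s0 : 0 <= x * x - y * y by lra.
have e : 2 * x * `|y| = `|x * y + y * x|.
  have -> : x * y + y * x = 2 * x * y by ring.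
  by rewrite normrM (ger0_norm (ltac:(lra) : 0 <= 2 * x)).
rewrite e -[leRHS](ger0_norm s0) -ler_sqr ?nnegrE ?normr_ge0 //.
by rewrite !real_normK ?num_real // !expr2; lra.
Qed.

Definition triangle (X : R) : set (R * R) :=
  [set xy | [/\ xy.1 <= X, xy.2 <= tan8 * xy.1 & - xy.2 <= tan8 * xy.1]].

Lemma triangle_ge0 X xy : triangle X xy -> 0 <= xy.1.
Proof.
case=> _ h1 h2; have /andP[t0 _] := tan8_itv.
have : 0 <= tan8 * xy.1 by lra.
by rewrite pmulr_rge0 //; lra.
Qed.

Lemma triangle_norm X xy : triangle X xy -> normc (plane xy) <= 2 * xy.1.
Proof.
move=> h; have x0 := triangle_ge0 h; case: h => _ h1 h2; have /andP[_ t1] := tan8_itv.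
have tx : tan8 * xy.1 <= 1 / 2 * xy.1 by apply: ler_wpM2r.
apply: le_trans (nc_le _) _; rewrite /= (ger0_norm x0).
have : `|xy.2| <= tan8 * xy.1 by rewrite ler_norml; lra.
by lra.
Qed.

Lemma triangle_compact X : compact (triangle X).
Proof.
apply: (@box_compact _ (2 * X)); last first.
  move=> xy h; apply: le_trans (triangle_norm h) _; case: h => h _ _; lra.
have cl (f : R * R -> R) : continuous f -> closed [set xy | f xy <= 0].
  move=> cf; have cl0 := @closed_le R 0; move: cl0; exact: (continuous_closedP _).1.
have -> : triangle X = [set xy | xy.1 - X <= 0] `&` ([set xy | xy.2 - tan8 * xy.1 <= 0]
    `&` [set xy | - xy.2 - tan8 * xy.1 <= 0]).
  apply/seteqP; split=> xy /=; rewrite /triangle /=; rewrite !subr_le0; first by case.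
  by case=> ? [].
apply: closedI; [|apply: closedI]; apply: cl => xy.
- by apply: cvgB; [exact: cvg_fst|exact: cvg_cst].
- by apply: cvgB; [exact: cvg_snd|apply: cvgM; [exact: cvg_cst|exact: cvg_fst]].
- apply: cvgB; [apply: cvgN; exact: cvg_snd|].
  by apply: cvgM; [exact: cvg_cst|exact: cvg_fst].
Qed.

Lemma triangle_max (p : {poly C}) (X M : R) :
  (forall w : C, 0 <= complex.Re w -> complex.Re w <= X ->
     `|complex.Im w| = tan8 * complex.Re w -> normc p.[w] <= M) ->
  (forall w : C, complex.Re w = X -> `|complex.Im w| <= tan8 * X -> normc p.[w] <= M) ->
  forall w : C, complex.Re w <= X -> `|complex.Im w| <= tan8 * complex.Re w -> normc p.[w] <= M.
Proof.
move=> h1 h2 w wX wt; rewrite -[w]plane_Re_Im.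
pose bd : set (R * R) := [set xy | xy.1 = X \/ `|xy.2| = tan8 * xy.1].
apply: (poly_max (bd := bd) (@triangle_compact X)); last 1 first.
- by move: wt; rewrite ler_norml => /andP[? ?]; split => //=; lra.
- move=> xy Kxy; have [x0 x1 x2] := Kxy.
  have [/eqP e|n1] := boolP (xy.1 == X); first by left; left.
  have [/eqP e|n2] := boolP (`|xy.2| == tan8 * xy.1); first by left; right.
  right; have d1 : 0 < X - xy.1 by rewrite subr_gt0 lt_def eq_sym n1.
  have d2 : 0 < tan8 * xy.1 - `|xy.2|.
    by rewrite subr_gt0 lt_def eq_sym n2 ler_norml; lra.
  exists (Num.min (X - xy.1) ((tan8 * xy.1 - `|xy.2|) / 2)) => [|h k].
    by rewrite lt_min d1 divr_gt0.
  set r := Num.min _ _ => hk.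
  have r0 : 0 <= r by rewrite /r le_min ltW //= divr_ge0 // ltW.
  have hr : `|h| <= r.
    rewrite -ler_sqr ?nnegrE // real_normK ?num_real //; apply: le_trans hk.
    by rewrite lerDl sqr_ge0.
  have kr : `|k| <= r.
    rewrite -ler_sqr ?nnegrE // real_normK ?num_real //; apply: le_trans hk.
    by rewrite lerDr sqr_ge0.
  have r1 : r <= X - xy.1 by rewrite /r ge_min lexx.
  have r2 : r <= (tan8 * xy.1 - `|xy.2|) / 2 by rewrite /r ge_min lexx orbT.
  have /andP[t0 t1] := tan8_itv.
  have th : `|tan8 * h| <= r.
    by rewrite normrM (ger0_norm (ltac:(lra) : 0 <= tan8)); nra.
  have := ler_norm xy.2; have := ler_norm (- xy.2); rewrite normrN.
  move: hr kr th; rewrite !ler_norml => /andP[? ?] /andP[? ?] /andP[? ?] ? ?.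
  by split => /=; rewrite ?mulrDr; lra.
- move=> xy Kxy; have x0 := triangle_ge0 Kxy; have [xX y1 y2] := Kxy.
  have yt : `|xy.2| <= tan8 * xy.1 by rewrite ler_norml; lra.
  by case=> [e|e]; [apply: h2 => //; rewrite /= -?e|apply: h1].
Qed.

(* Multiplying by (1 - eps w^3 / N)^N, a polynomial stand-in for exp(- eps w^3). *)
Lemma damping (z : C) : normc z <= 1 / 5%:R -> 1 / 5%:R * normc z <= complex.Re z ->
  normc (1 - z) ^+ 2 <= expR (- (normc z / 5%:R)).
Proof.
move=> z1 z2; apply: le_trans (expR_ge1Dx _).
have -> : normc (1 - z) ^+ 2 = 1 - 2 * complex.Re z + normc z ^+ 2.
  by rewrite !nc_sqr; case: (z) => x y /=; ring.
have := nc_ge0 z; nra.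
Qed.

(** In the sector |arg w^3| <= 3 pi / 8, so the real part of w^3 is comparable with its modulus. The
    exponent 3 lies between 2, the order of w -> f (w^8), and 4, where the real part would vanish on
    the boundary rays. *)
Lemma sector_cube (w : C) : 0 <= complex.Re w -> `|complex.Im w| <= tan8 * complex.Re w ->
  1 / 5%:R * normc (w ^+ 3) <= complex.Re (w ^+ 3) /\ normc w ^+ 2 <= 2 * complex.Re w ^+ 2.
Proof.
have re3 : complex.Re (w ^+ 3) = complex.Re w * (complex.Re w ^+ 2 - 3%:R * complex.Im w ^+ 2).
  by case: (w) => a b /=; ring.
have n2' := nc_sqr w; rewrite ncX re3.
move: n2'; move: (complex.Re w) (complex.Im w) => x y n2' x0 yt.
have /andP[t0 t1] := tan8_itv; have tE := tan8E.
have y2 : y ^+ 2 <= tan8 ^+ 2 * x ^+ 2.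
  by rewrite -exprMn -[leLHS]real_normK ?num_real // lerXn2r ?nnegrE // mulr_ge0 //; lra.
have t2 : tan8 ^+ 2 <= 1 / 5%:R by lra.
have y5 : y ^+ 2 <= 1 / 5%:R * x ^+ 2 by apply: le_trans y2 _; rewrite ler_wpM2r ?sqr_ge0.
have n2 : normc w ^+ 2 <= 6%:R / 5%:R * x ^+ 2 by rewrite n2'; lra.
have n1 : normc w <= 6%:R / 5%:R * x.
  have w0 := nc_ge0 w; rewrite leNgt; apply/negP => h; nra.
split; last by have := sqr_ge0 x; lra.
apply: le_trans (_ : 1 / 5%:R * ((6%:R / 5%:R * x ^+ 2) * (6%:R / 5%:R * x)) <= _).
  rewrite ler_wpM2l // exprS mulrC; apply: ler_pM; rewrite ?exprn_ge0 ?nc_ge0 //.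
have : x * (2 / 5%:R * x ^+ 2) <= x * (x ^+ 2 - 3%:R * y ^+ 2).
  by apply: ler_wpM2l => //; have := sqr_ge0 x; lra.
have : 0 <= x * x ^+ 2 by rewrite mulr_ge0 ?sqr_ge0.
lra.
Qed.

Lemma bernoulli_le (N : nat) (x : R) : 0 <= x <= 1 -> 1 - N%:R * x <= (1 - x) ^+ N.
Proof.
move=> /andP[x0 x1]; elim: N => [|N IH]; first by rewrite mul0r subr0 expr0.
rewrite exprS; apply: le_trans (_ : (1 - x) * (1 - N%:R * x) <= _).
  rewrite -natr1; have : 0 <= N%:R * x ^+ 2 by rewrite mulr_ge0 ?sqr_ge0.
  nra.
by apply: ler_wpM2l => //; lra.
Qed.

(** With z = w^8 the plane cut along the negative axis becomes a sector of opening pi / 4, on which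
    f (w^8) grows at most like exp (A |w|^2). The damping factor makes the product small on a far
    edge, so the bound from the negative axis holds throughout; f is then bounded, hence
    constant. *)
Lemma phragmen_lindelof f (B x0 : R) : entire f -> growth f ->
  (forall x, x0 <= x -> normc (f (- x)%:C) <= B) -> forall z, f z = f 0.
Proof.
move=> hf [A A0 hA] hB.
have [M [M1 hM]] : exists M : R, 1 <= M /\ forall x, 0 <= x -> normc (f (- x)%:C) <= M.
  have [B' B'0 hB'] := appr_bound (hf `|x0|).
  exists (Num.max 1 (Num.max B B')); split; first by rewrite le_max lexx.
  move=> x x00; rewrite !le_max; have [h|h] := leP x0 x; first by rewrite hB ?orbT.
  rewrite (hB' (- x)%:C) ?orbT // nc_real normrN (ger0_norm x00).
  by apply: le_trans (ler_norm x0); exact: ltW.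
apply: (liouville (M := M)) => // z; have [w <- [w0 wt]] := root8 z.
set W := normc w ^+ 3; have W0 : 0 <= W by rewrite exprn_ge0 ?nc_ge0.
have F0 := nc_ge0 (f (w ^+ 8)).
(* Bernoulli's inequality bounds the damping factor at w from below by 1 - e W; letting e tend to 0
   removes it. *)
suff H e : 0 < e -> e * W <= 1 -> normc (f (w ^+ 8)) * (1 - e * W) <= M.
  apply/ler_addgt0Pr => d d0.
  pose e := Num.min (1 / (W + 1)) (d / (normc (f (w ^+ 8)) * W + 1)).
  have FW : 0 <= normc (f (w ^+ 8)) * W by rewrite mulr_ge0.
  have e0 : 0 < e by rewrite lt_min !divr_gt0 //; lra.
  have e1 : e <= 1 / (W + 1) by rewrite /e ge_min lexx.
  have e2 : e <= d / (normc (f (w ^+ 8)) * W + 1) by rewrite /e ge_min lexx orbT.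
  move: e1 e2; rewrite !ler_pdivlMr; [|lra|lra] => e1 e2.
  have := H e e0; rewrite (_ : e * W <= 1); last by nra.
  by move=> /(_ isT); nra.
move=> e0 eW.
(* Far enough out for e X^3 / 10 to absorb the growth exponent A + 2 A X^2 on the edge Re = X. *)
pose X := complex.Re w + 1 + 30%:R * A / e.
have Ae : 0 < 30%:R * A / e by rewrite divr_gt0 // mulr_gt0.
have X1 : 1 <= X by rewrite /X; lra.
have wX : complex.Re w <= X by rewrite /X; lra.
have X30 : 30%:R * A <= e * X.
  by rewrite [leRHS]mulrC -ler_pdivrMr // /X; lra.
(* Makes e |v|^3 / N at most 1/5 in the triangle, where |v|^3 <= 4 X^3; [damping] asks for this. *)
pose N := (Num.truncn (20%:R * e * X ^+ 3 + 1)).+1.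
have N0 : 0 < N%:R :> R by rewrite ltr0Sn.
have NX : 20%:R * e * X ^+ 3 <= N%:R.
  by have := truncnS_gt (20%:R * e * X ^+ 3 + 1); rewrite -/N; lra.
pose m : {poly C} := (1 - (e / N%:R)%:C *: 'X^3) ^+ N.
have mE v : m.[v] = (1 - (e / N%:R)%:C * v ^+ 3) ^+ N.
  by rewrite /m horner_exp hornerD hornerN hornerZ hornerXn -polyC1 hornerC.
have eN : 0 <= e / N%:R by rewrite divr_ge0 ?ltW.
have nz v : normc ((e / N%:R)%:C * v ^+ 3) = e / N%:R * normc v ^+ 3.
  by rewrite normcM nc_real ncX ger0_norm.
have cub v : 0 <= complex.Re v -> complex.Re v <= X -> `|complex.Im v| <= tan8 * complex.Re v ->
    normc v ^+ 3 <= 4%:R * X ^+ 3.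
  move=> v0 vX vt; have [_ h] := sector_cube v0 vt.
  have h2 : normc v ^+ 2 <= 2 * X ^+ 2.
    by apply: le_trans h _; rewrite ler_pM2l // lerXn2r ?nnegrE //; lra.
  have h1 : normc v <= 2 * X by have := nc_ge0 v => ?; rewrite leNgt; apply/negP => ?; nra.
  have -> : 4%:R * X ^+ 3 = (2 * X) * (2 * X ^+ 2) by ring.
  by rewrite exprS; apply: ler_pM; rewrite ?exprn_ge0 ?nc_ge0.
have mle v : 0 <= complex.Re v -> complex.Re v <= X -> `|complex.Im v| <= tan8 * complex.Re v ->
    normc m.[v] ^+ 2 <= expR (- (e * normc v ^+ 3 / 5%:R)).
  move=> v0 vX vt; rewrite mE ncX -exprM mulnC exprM.
  have -> : - (e * normc v ^+ 3 / 5%:R) = N%:R * (- (normc ((e / N%:R)%:C * v ^+ 3) / 5%:R)).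
    by rewrite nz; field; rewrite gt_eqF.
  rewrite expRM_natl; apply: lerXn2r; rewrite ?nnegrE ?exprn_ge0 ?nc_ge0 ?expR_ge0 //.
  apply: damping.
    rewrite nz mulrAC ler_pdivrMr //; have := cub v v0 vX vt.
    move: (normc v ^+ 3) NX => c; nra.
  have [h _] := sector_cube v0 vt.
  have -> : complex.Re ((e / N%:R)%:C * v ^+ 3) = e / N%:R * complex.Re (v ^+ 3).
    by case: (v ^+ 3) => a b /=; ring.
  by rewrite nz mulrCA ler_wpM2l // -ncX.
have m1 v : 0 <= complex.Re v -> complex.Re v <= X -> `|complex.Im v| <= tan8 * complex.Re v ->
    normc m.[v] <= 1.
  move=> v0 vX vt; rewrite -(ler_pXn2r (n := 2)) ?nnegrE ?nc_ge0 // expr1n.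
  apply: le_trans (mle v v0 vX vt) _; rewrite expR_le1 oppr_le0.
  by rewrite divr_ge0 // mulr_ge0 ?(ltW e0) // exprn_ge0 ?nc_ge0.
suff H : normc (f (w ^+ 8) * m.[w]) <= M.
  apply: le_trans _ H; rewrite normcM ler_wpM2l // mE ncX.
  apply: le_trans (_ : (1 - e / N%:R * W) ^+ N <= _).
    apply: le_trans (bernoulli_le _ _).
      rewrite le_eqVlt; apply/orP; left; apply/eqP; field; exact: lt0r_neq0.
    rewrite mulr_ge0 //= mulrAC ler_pdivrMr // mul1r.
    by apply: le_trans eW _; rewrite ler1n.
  have h : 1 - e / N%:R * W <= normc (1 - (e / N%:R)%:C * w ^+ 3).
    by have := nc_dist 1 ((e / N%:R)%:C * w ^+ 3); rewrite nc1 nz -/W; lra.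
  apply: lerXn2r => //; rewrite nnegrE ?nc_ge0 // subr_ge0 mulrAC ler_pdivrMr // mul1r.
  by apply: le_trans eW _; rewrite ler1n.
apply/ler_addgt0Pr => d d0; have d2 : 0 < d / 2 by lra.
have [p hp] := hf ((2 * X) ^+ 8) _ d2.
pose P : {poly C} := (p \Po 'X^8) * m.
have PE v : P.[v] = p.[v ^+ 8] * m.[v] by rewrite hornerM horner_comp hornerXn.
have in8 v : 0 <= complex.Re v -> complex.Re v <= X -> `|complex.Im v| <= tan8 * complex.Re v ->
    normc (f (v ^+ 8) - p.[v ^+ 8]) <= d / 2.
  move=> v0 vX vt; apply: hp; rewrite ncX; apply: lerXn2r; rewrite ?nnegrE ?nc_ge0 //; first lra.
  have [_ h] := sector_cube v0 vt; have := nc_ge0 v => ?.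
  rewrite leNgt; apply/negP => ?; nra.
have key v : 0 <= complex.Re v -> complex.Re v <= X -> `|complex.Im v| <= tan8 * complex.Re v ->
    normc (f (v ^+ 8)) * normc m.[v] <= M -> normc P.[v] <= M + d / 2.
  move=> v0 vX vt h; rewrite PE.
  have -> : p.[v ^+ 8] * m.[v] = f (v ^+ 8) * m.[v] - (f (v ^+ 8) - p.[v ^+ 8]) * m.[v] by ring.
  apply: le_trans (le_normcD _ _) _; rewrite normcN !normcM; apply: lerD => //.
  rewrite -[leRHS]mulr1; apply: ler_pM; rewrite ?nc_ge0 //; [exact: in8|exact: m1].
suff H : normc P.[w] <= M + d / 2.
  have -> : f (w ^+ 8) * m.[w] = (f (w ^+ 8) - p.[w ^+ 8]) * m.[w] + P.[w] by rewrite PE; ring.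
  apply: le_trans (le_normcD _ _) _; rewrite normcM.
  have : normc (f (w ^+ 8) - p.[w ^+ 8]) * normc m.[w] <= d / 2 * 1.
    by apply: ler_pM; rewrite ?nc_ge0 //; [exact: in8|exact: m1].
  by lra.
apply: (triangle_max (X := X)) => // v.
  move=> v0 vX vt; have vt' : `|complex.Im v| <= tan8 * complex.Re v by rewrite vt.
  apply: key => //; rewrite -[leRHS]mulr1; apply: ler_pM; rewrite ?nc_ge0 ?m1 //.
  have -> : v ^+ 8 = (- (64%:R * tan8 ^+ 4 * complex.Re v ^+ 8))%:C.
    move: vt v0 {vX vt'}; case: v => a b /= vt a0.
    have [b0|b0] := leP 0 b.
      by rewrite -sector_ray -vt ger0_norm.
    by rewrite -sector_ray' -vt ltr0_norm // opprK.
  by apply: hM; apply: mulr_ge0; [apply: mulr_ge0 => //|]; exact: exprn_even_ge0.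
move=> vX vt; have X0 : 0 <= X := le_trans ler01 X1.
have v0 : 0 <= complex.Re v by rewrite vX.
have vX' : complex.Re v <= X by rewrite vX.
have vt' : `|complex.Im v| <= tan8 * complex.Re v by rewrite vX.
apply: key => //; apply: le_trans M1.
have vl : X <= normc v by have := nc_ge_Re v; rewrite vX; have := ler_norm X; lra.
have [_ v2] := sector_cube v0 vt'; rewrite vX in v2.
have h1 : normc (f (v ^+ 8)) <= A * expR (A * normc v ^+ 2).
  apply: hA; first by rewrite expr_ge1 ?nc_ge0 // (le_trans X1 vl).
  by rewrite ncX -exprM.
have h2 : normc m.[v] <= expR (- (e * X ^+ 3 / 10%:R)).
  rewrite -(ler_pXn2r (n := 2)) ?nnegrE ?nc_ge0 ?expR_ge0 //.
  apply: le_trans (mle v v0 vX' vt') _; rewrite -expRM_natl ler_expR.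
  have : e * X ^+ 3 <= e * normc v ^+ 3.
    by rewrite ler_wpM2l ?(ltW e0) // lerXn2r ?nnegrE ?nc_ge0.
  lra.
apply: le_trans (_ : (expR A * expR (A * (2 * X ^+ 2))) * expR (- (e * X ^+ 3 / 10%:R)) <= _).
  apply: ler_pM; rewrite ?nc_ge0 //; apply: le_trans h1 _.
  apply: ler_pM; rewrite ?expR_ge0 ?(ltW A0) ?expR_ge // ler_expR ler_wpM2l //.
  exact: ltW.
rewrite -!expRD expR_le1.
have : A * 1 <= A * X ^+ 2 by rewrite ler_wpM2l ?(ltW A0) // expr_ge1.
have : 30%:R * A * X ^+ 2 <= e * X * X ^+ 2 by rewrite ler_wpM2r ?sqr_ge0.
have -> : e * X ^+ 3 = e * X * X ^+ 2 by ring.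
lra.
Qed.

End PhragmenLindelof.

(** * Functions with the same zeros *)

Section Spectra.
Variable R : realType.
Local Notation C := R[i].
Local Open Scope complex_scope.

Lemma entire_cont (f : C -> C) w : entire f -> forall e : R, 0 < e ->
  exists d : R, 0 < d /\ forall z, normc (z - w) < d -> normc (f z - f w) < e.
Proof.
move=> hf e e0; have e2 : 0 < e / 2 by lra.
have wr : normc w <= normc w + 1 by lra.
have [d d0 hd] := appr_cont (hf (normc w + 1)) wr e2.
exists (Num.min d 1); split=> [|z]; first by rewrite lt_min d0 ltr01.
rewrite lt_min => /andP[zd z1]; apply: le_lt_trans (hd z _ (ltW zd)) _; last lra.
by have := nc_dist z w; lra.
Qed.

Lemma zero_mult_entire (f g : C -> C) w m : entire g -> g w != 0 ->
  (forall z, f z = (z - w) ^+ m * g z) -> zero_mult f w m.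
Proof.
move=> eg gw fg; exists g; split; first by move=> e e0; exact: entire_cont.
by split=> //; exact/eqP.
Qed.

(** If every power of z - w divided f, the maximum principle on a circle where |z - w| >= 2 |v - w|
    would give |f v| <= M / 2^n for all n. *)
Lemma mult_exists (f : C -> C) w : entire f -> (exists z, f z != 0) ->
  exists m, exists2 g, entire g & g w != 0 /\ forall z, f z = (z - w) ^+ m * g z.
Proof.
move=> ef [v fv]; apply: contrapT => no.
have all m : exists2 g, entire g & forall z, f z = (z - w) ^+ m * g z.
  elim: m => [|m [g eg hg]].
    by exists f => // z; rewrite expr0 mul1r.
  have [gw|gw] := eqVneq (g w) 0.
    have [h eh hh] := entire_div eg gw; exists h => // z.
    by rewrite hg hh exprSr mulrA.
  by exfalso; apply: no; exists m, g.
have [vw|vw] := eqVneq v w.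
  apply: no; exists 0%N, f => //; split; first by rewrite -vw.
  by move=> z; rewrite expr0 mul1r.
set d := normc (v - w); have d0 : 0 < d by rewrite nc_gt0 subr_eq0.
set r := normc w + 2 * d + normc v.
have vn := nc_ge0 v; have wn := nc_ge0 w.
have [M M0 hM] := appr_bound (ef r).
have nf : 0 < normc (f v) by rewrite nc_gt0.
have [n hn] : exists n, M / normc (f v) < 2 ^+ n.
  have := truncnS_gt (M / normc (f v)); set n := Num.truncn _ => h; exists n.+1.
  by apply: lt_trans h _; rewrite -natrX ltr_nat ltn_expl.
have [g eg fg] := all n.
have dn : 0 < (2 * d) ^+ n by rewrite exprn_gt0 //; lra.
have gM : normc (g v) <= M / (2 * d) ^+ n.
  apply: (appr_disc_max (r := r)); [exact: eg| |by rewrite /r; lra].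
  move=> z zr; rewrite ler_pdivlMr // mulrC.
  apply: le_trans (hM z _); last by rewrite zr.
  rewrite fg normcM ncX; apply: ler_wpM2r; first exact: nc_ge0.
  apply: lerXn2r; rewrite ?nnegrE ?nc_ge0 //; first lra.
  by have := nc_dist z w; rewrite zr /r; lra.
move: hn; rewrite ltr_pdivrMr // ltNge => /negP; apply.
rewrite fg normcM ncX -/d; move: gM; rewrite ler_pdivlMr // exprMn; lra.
Qed.

(** [zero_mult] asks for a cofactor that is continuous at one point only, so cofactors and their
    continuity are rebuilt by hand when the factor z - w is moved in or out. *)
Lemma zero_mult_div (f g : C -> C) w v m : entire g -> (forall z, f z = (z - w) * g z) ->
  zero_mult g v m <-> zero_mult f v (if v == w then m.+1 else m).
Proof.
move=> eg fg; have [->|vw] := eqVneq v w; split.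
- by move=> [h [ch [hw eh]]]; exists h; split=> //; split=> // z; rewrite fg eh exprS mulrA.
- move=> [h [ch [hw eh]]]; exists h; split=> //; split=> //.
  have off z : z != w -> g z = (z - w) ^+ m * h z.
    move=> zw; apply: (mulfI (_ : z - w != 0)); first by rewrite subr_eq0.
    by rewrite -fg eh exprS mulrA.
  move=> z; have [->|/off//] := eqVneq z w.
  (* At z = w the two sides are compared with their values at a nearby point w + t, where they
     agree. *)
  apply/eqP; rewrite -subr_eq0; apply/eqP; apply: nc_small0 => e e0.
  have e2 : 0 < e / 2 by lra.
  have [d1 [d10 hd1]] := entire_cont w eg e2.
  have hc : forall e : R, 0 < e -> exists d : R, 0 < d /\ forall z, normc (z - w) < d ->
      normc ((z - w) ^+ m * h z - (w - w) ^+ m * h w) < e.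
    move=> {e2 hd1} e' e'0; rewrite subrr.
    case: m eh off => [|m] eh off.
      have [d [d0 hd]] := ch e' e'0; exists d; split=> // u ud.
      by rewrite !expr0 !mul1r hd.
    have hw1 : 0 < normc (h w) + 1 by have := nc_ge0 (h w); lra.
    have [d [d0 hd]] := ch 1 ltr01.
    exists (Num.min (Num.min d 1) (e' / (normc (h w) + 1))); split.
      by rewrite !lt_min d0 ltr01 divr_gt0.
    move=> u; rewrite !lt_min => /andP[/andP[ud u1] ue].
    rewrite expr0n mul0r subr0 normcM ncX exprS.
    rewrite ltr_pdivlMr // in ue; apply: le_lt_trans ue.
    apply: ler_pM; rewrite ?nc_ge0 ?mulr_ge0 ?exprn_ge0 ?nc_ge0 //.
      by rewrite -[leRHS]mulr1 ler_wpM2l ?nc_ge0 // exprn_ile1 ?nc_ge0 // ltW.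
    by have := nc_dist (h u) (h w); have := hd u ud; lra.
  have [d2 [d20 hd2]] := hc _ e2.
  pose t := Num.min d1 d2 / 2; have m0 : 0 < Num.min d1 d2 by rewrite lt_min d10.
  have t0 : 0 < t by rewrite /t; lra.
  have t1 : t < d1 by have : Num.min d1 d2 <= d1 by [rewrite ge_min lexx]; rewrite /t; lra.
  have t2 : t < d2 by have : Num.min d1 d2 <= d2 by [rewrite ge_min lexx orbT]; rewrite /t; lra.
  have tn : normc (w + t%:C - w) = t by rewrite addrC addKr nc_real ger0_norm // ltW.
  have := hd1 (w + t%:C); have := hd2 (w + t%:C); rewrite tn => /(_ t2) h2 /(_ t1).
  rewrite off; last by rewrite -subr_eq0 -nc_gt0 tn.
  set X := _ * h (w + _) in h2 *; move=> h1.
  have -> : g w - (w - w) ^+ m * h w = (X - (w - w) ^+ m * h w) - (X - g w) by ring.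
  by apply: le_trans (le_normcD _ _) _; rewrite normcN; lra.
- move=> [h [ch [hw eh]]]; exists (fun z => (z - w) * h z); split; last first.
    split; first by apply/eqP; rewrite mulf_neq0 ?subr_eq0 //; apply/eqP.
    by move=> z; rewrite fg eh mulrCA.
  move=> e e0.
  have n1 : 0 < normc (h v) + 1 by have := nc_ge0 (h v); lra.
  have n2 : 0 < normc (v - w) + 1 by have := nc_ge0 (v - w); lra.
  have [d1 [d10 hd1]] := ch _ (ltac:(by rewrite lt_min ltr01 divr_gt0 // mulr_gt0) :
    0 < Num.min 1 (e / (2 * (normc (v - w) + 1)))).
  exists (Num.min d1 (e / (2 * (normc (h v) + 1)))); split.
    by rewrite lt_min d10 divr_gt0 // mulr_gt0.
  move=> z; rewrite lt_min ltr_pdivlMr ?mulr_gt0 // => /andP[/hd1].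
  rewrite lt_min ltr_pdivlMr ?mulr_gt0 // => /andP[z1 z2] z3.
  have -> : (z - w) * h z - (v - w) * h v = (z - v) * h z + (v - w) * (h z - h v) by ring.
  apply: le_lt_trans (le_normcD _ _) _; rewrite !normcM.
  have : normc (z - v) * normc (h z) <= normc (z - v) * (normc (h v) + 1).
    by rewrite ler_wpM2l ?nc_ge0 //; have := nc_dist (h z) (h v); lra.
  have : normc (v - w) * normc (h z - h v) <= (normc (v - w) + 1) * normc (h z - h v).
    by rewrite ler_wpM2r ?nc_ge0 //; lra.
  lra.
- move=> [h [ch [hv eh]]].
  have vw0 : v - w != 0 by rewrite subr_eq0.
  have n2 : 0 < normc (v - w) by rewrite nc_gt0.
  pose h' z := if z == w then g w / (w - v) ^+ m else h z / (z - w).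
  exists h'; split; last first.
    split; first by rewrite /h' (negPf vw); apply/eqP; rewrite mulf_neq0 ?invr_neq0 //; apply/eqP.
    move=> z; rewrite /h'; have [->|zw] := eqVneq z w.
      by rewrite mulrC divfK // expf_neq0 // subr_eq0 eq_sym.
    have zw0 : z - w != 0 by rewrite subr_eq0.
    by apply: (mulfI zw0); rewrite -fg eh; field.
  move=> e e0; set q := normc (v - w) in n2.
  have n1 : 0 < normc (h v) + 1 by have := nc_ge0 (h v); lra.
  have [d1 [d10 hd1]] := ch _ (ltac:(by rewrite divr_gt0 ?mulr_gt0) : 0 < e * q / 4%:R).
  exists (Num.min d1 (Num.min (q / 2) (e * q ^+ 2 / (4%:R * (normc (h v) + 1))))); split.
    by rewrite !lt_min d10 !divr_gt0 ?mulr_gt0 ?exprn_gt0.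
  move=> z; rewrite !lt_min => /andP[/hd1 z1 /andP[z2 z3]].
  have zw : q / 2 < normc (z - w).
    have := nc_dist (v - w) (z - w); have -> : v - w - (z - w) = v - z by ring.
    by rewrite (ncB v z) -/q; lra.
  have zn : z - w != 0 by rewrite -nc_gt0; lra.
  rewrite /h' (negPf vw); move: (zn); rewrite subr_eq0 => /negPf ->.
  have -> : h z / (z - w) - h v / (v - w) =
    ((h z - h v) * (v - w) - h v * (z - v)) / ((z - w) * (v - w)) by field; rewrite vw0 zn.
  rewrite normcM normcV normcM ltr_pdivrMr ?mulr_gt0 //; last lra.
  apply: le_lt_trans (le_normcD _ _) _; rewrite normcN !normcM -/q.
  move: z3; rewrite ltr_pdivlMr ?mulr_gt0 // => z3.
  have : normc (h v) * normc (z - v) <= (normc (h v) + 1) * normc (z - v).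
    by rewrite ler_wpM2r ?nc_ge0 //; lra.
  have : e * (q / 2) * q <= e * normc (z - w) * q.
    by rewrite ler_wpM2r ?(ltW n2) // ler_wpM2l ?(ltW e0) // ltW.
  have : normc (h z - h v) * q <= e * q / 4%:R * q by rewrite ler_wpM2r ?(ltW n2) // ltW.
  have eq : 0 < e * q * q by rewrite !mulr_gt0.
  by move: z3; have -> : e * q ^+ 2 = e * q * q by [ring]; lra.
Qed.

Lemma zero_mult_shift (f : C -> C) c w m :
  zero_mult (fun z => f (z + c)) w m <-> zero_mult f (w + c) m.
Proof.
split=> [[h [ch [hw eh]]]|[h [ch [hw eh]]]].
  exists (fun z => h (z - c)); split; last first.
    split; first by rewrite addrK.
    by move=> z; rewrite -[z in LHS](subrK c) eh; congr (_ ^+ _ * _); ring.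
  move=> e e0; have [d [d0 hd]] := ch e e0; exists d; split=> // z zd.
  by rewrite addrK; apply: hd; have -> : z - c - w = z - (w + c) by ring.
exists (fun z => h (z + c)); split; last first.
  split => // z; rewrite eh; congr (_ ^+ _ * _); ring.
move=> e e0; have [d [d0 hd]] := ch e e0; exists d; split=> // z zd.
by apply: hd; have -> : z + c - (w + c) = z - w by ring.
Qed.

Definition spectral_rel (f g : C -> C) := [/\ entire f, entire g, same_spectrum f g,
  exists z, f z != 0 & exists z, g z != 0].

Lemma spectral_rel_sym f g : spectral_rel f g -> spectral_rel g f.
Proof. by case=> ef eg fg f0 g0; split=> // w m; apply: iff_sym. Qed.

Lemma spectral_rel_zero f g w : spectral_rel f g -> g w = 0 -> f w = 0.
Proof.
case=> ef eg fg f0 g0 gw; have [m [h eh [hw gh]]] := mult_exists w eg g0.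
case: m gh => [|m] gh.
  by move: hw; have := gh w; rewrite gw expr0 mul1r => <-; rewrite eqxx.
have /fg [k [_ [_ ->]]] := zero_mult_entire eh hw gh.
by rewrite subrr expr0n mul0r.
Qed.

Lemma spectral_rel_div f g f1 g1 w : spectral_rel f g -> g w = 0 -> entire f1 -> entire g1 ->
  (forall z, f z = (z - w) * f1 z) -> (forall z, g z = (z - w) * g1 z) -> spectral_rel f1 g1.
Proof.
case=> ef eg fg [z1 f0] [z2 g0] gw ef1 eg1 hf hg; split=> //.
- move=> v m; apply: (iff_trans (zero_mult_div v m ef1 hf)).
  apply: (iff_trans _ (iff_sym (zero_mult_div v m eg1 hg))); exact: fg.
- by exists z1; apply: contraNneq f0 => e; rewrite hf e mulr0.
- by exists z2; apply: contraNneq g0 => e; rewrite hg e mulr0.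
Qed.

(** The quotient f / g is entire of order 1/4 and, the relation being symmetric, zero-free, hence
    constant. The shift by v moves a point where g does not vanish to the origin. *)
Lemma same_spectrum_proportional (f g : C -> C) : entire f -> entire g ->
  growth f -> growth g -> (exists z, f z != 0) -> (exists z, g z != 0) ->
  same_spectrum f g -> exists2 c, c != 0 & forall z, f z = c * g z.
Proof.
move=> ef eg gf gg f0 [v gv] fg.
pose f' z := f (z + v); pose g' z := g (z + v).
have rel : spectral_rel f' g'.
  split; [exact: entire_shift|exact: entire_shift| | |].
  - move=> w m; apply: (iff_trans (zero_mult_shift f v w m)).
    exact: (iff_trans _ (iff_sym (zero_mult_shift g v w m))).
  - by have [z fz] := f0; exists (z - v); rewrite /f' subrK.
  - by exists 0; rewrite /g' add0r.
have g0 : g' 0 != 0 by rewrite /g' add0r.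
have [h [eh gh fh hh]] := quotient_entire
  (fun f g (h : spectral_rel f g) => let: And5 a b _ _ _ := h in conj a b)
  spectral_rel_zero spectral_rel_div rel g0 (growth_shift v gf) (growth_shift v gg).
have hz z : h z != 0.
  have [f1 [g1 [r1 g1z ->]]] := hh z; rewrite mulf_neq0 ?invr_neq0 //.
  by apply: contraNneq g1z => e; rewrite (spectral_rel_zero (spectral_rel_sym r1) e).
exists (h 0) => // z.
have := fh (z - v); rewrite (zero_free_const eh gh hz) /f' /g' subrK => ->.
exact: mulrC.
Qed.

(** The identity f a = k g with a and g free of common zeros says that g divides f, multiplicities
    included, in a form that survives division of f and g by z - w. *)
Definition cofactor_rel (f g : C -> C) := [/\ entire f, entire g &
  exists a k, [/\ entire a, entire k, forall z, f z * a z = k z * g z &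
    forall z, ~ (a z = 0 /\ g z = 0)]].

(* As a and g have no common zero, g divides f, and Phragmen-Lindelof applies to f / g. *)
Lemma cofactor_vanish (f g a k : C -> C) : entire f -> entire g -> entire a -> entire k ->
  growth f -> growth g -> (forall z, f z * a z = k z * g z) ->
  (forall z, ~ (a z = 0 /\ g z = 0)) ->
  (forall e : R, 0 < e -> exists x0 : R, forall x, x0 <= x ->
     g (- x)%:C != 0 /\ normc (f (- x)%:C) <= e * normc (g (- x)%:C)) ->
  forall z, f z = 0.
Proof.
move=> ef eg ea ek gf gg fa ag ray.
(* The origin is moved to a point of the ray where g does not vanish, as [quotient_entire]
   requires. *)
have [x0 hx0] := ray 1 ltr01; have [gv _] := hx0 x0 (lexx _).
set v := (- x0)%:C in gv.
pose f' z := f (z + v); pose g' z := g (z + v).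
have rel : cofactor_rel f' g'.
  split; [exact: entire_shift|exact: entire_shift|].
  exists (fun z => a (z + v)), (fun z => k (z + v)).
  by split; [exact: entire_shift|exact: entire_shift|move=> z; exact: fa|move=> z; exact: ag].
have g0 : g' 0 != 0 by rewrite /g' add0r.
have rel_zero f1 g1 w : cofactor_rel f1 g1 -> g1 w = 0 -> f1 w = 0.
  case=> _ _ [b [l [_ _ fb bg]]] gw; have /eqP := fb w; rewrite gw mulr0 mulf_eq0.
  by case/orP=> /eqP // bw; case: (bg w).
have rel_div f1 g1 f2 g2 w : cofactor_rel f1 g1 -> g1 w = 0 -> entire f2 -> entire g2 ->
    (forall z, f1 z = (z - w) * f2 z) -> (forall z, g1 z = (z - w) * g2 z) -> cofactor_rel f2 g2.
  case=> _ _ [b [l [eb el fb bg]]] gw ef2 eg2 hf hg; split=> //; exists b, l; split=> // z.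
    apply/eqP; rewrite -subr_eq0; apply/eqP.
    apply: (entire_cancel (d := fun z => f2 z * b z - l z * g2 z) (w := w)).
      by apply: entireB; apply: entireM.
    move=> u; rewrite mulrBr mulrA -hf fb hg mulrCA subrr //.
  by case=> bz gz; apply: (bg z); split; rewrite // hg gz mulr0.
have [h [eh gh fh _]] := quotient_entire
  (fun f g (h : cofactor_rel f g) => let: And3 a b _ := h in conj a b)
  rel_zero rel_div rel g0 (growth_shift v gf) (growth_shift v gg).
pose h' z := h (z - v).
have eh' : entire h' by exact: entire_shift.
have gh' : growth h' by exact: growth_shift.
have fh' z : f z = g z * h' z by have := fh (z - v); rewrite /f' /g' subrK.
have small e : 0 < e -> exists x1 : R, forall x, x1 <= x -> normc (h' (- x)%:C) <= e.
  move=> e0; have [x1 hx1] := ray e e0; exists x1 => x /hx1 [gx].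
  by rewrite fh' normcM mulrC ler_pM2r // nc_gt0.
have [x1 hx1] := small 1 ltr01.
have hc := phragmen_lindelof eh' gh' hx1.
suff h0 : h' 0 = 0 by move=> z; rewrite fh' hc h0 mulr0.
apply: nc_small0 => e e0; have [x2 hx2] := small e e0.
by rewrite -(hc (- x2)%:C); exact: hx2.
Qed.

End Spectra.

(** * Absolutely continuous functions *)

Section RealAC.
Variable R : realType.
Local Open Scope classical_set_scope.
Local Notation mu := (@lebesgue_measure R).
Local Notation I01 := (`[(0 : R), 1]%classic).
Implicit Types (u v w a b : R -> R) (x y z t e M : R).

Definition rint a x y : R := \int[mu]_(t in `]x, y]) a t.

Definition integr a := mu.-integrable I01 (EFin \o a).

(** The density u' is part of the data and u is constrained on [0, 1] only, so derivatives are
    handled as identities between densities. *)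
Definition RAC u u' := integr u' /\
  forall x, 0 <= x <= 1 -> u x = u 0 + \int[mu]_(t in `[0, x]) u' t.

Lemma integr_sub a x y : 0 <= x -> y <= 1 -> integr a -> mu.-integrable `]x, y] (EFin \o a).
Proof.
move=> x0 y1; apply: integrableS => //; move=> t /=; rewrite !in_itv /= => /andP[xt ty].
by rewrite (le_trans x0 (ltW xt)) (le_trans ty).
Qed.

Lemma integr_subc a y : y <= 1 -> integr a -> mu.-integrable `[0, y] (EFin \o a).
Proof.
move=> y1; apply: integrableS => //; move=> t /=; rewrite !in_itv /= => /andP[xt ty].
by rewrite xt (le_trans ty).
Qed.

Lemma RAC_diff u u' x y : RAC u u' -> 0 <= x -> x <= y -> y <= 1 ->
  u y - u x = rint u' x y.
Proof.
move=> [iu hu] x0 xy y1; rewrite (hu y) ?(hu x).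
- rewrite opprD addrACA subrr add0r.
  by rewrite (Rintegral_itvB (x := x)) //; exact: integr_subc.
- by rewrite x0 (le_trans xy).
- by rewrite (le_trans x0 xy).
Qed.

Lemma rint_le a b x y : 0 <= x -> y <= 1 -> integr a -> integr b ->
  (forall t, x < t -> t <= y -> a t <= b t) -> rint a x y <= rint b x y.
Proof.
move=> x0 y1 ia ib ab; apply: le_Rintegral => //; [exact: integr_sub|exact: integr_sub|].
by move=> t /=; rewrite in_itv /= => /andP[]; exact: ab.
Qed.

Lemma integrD a b : integr a -> integr b -> integr (fun t => a t + b t).
Proof.
move=> ia ib; rewrite /integr (_ : EFin \o _ = (EFin \o a) \+ (EFin \o b))%E //.
by apply: integrableD.
Qed.

Lemma integrZ k a : integr a -> integr (fun t => k * a t).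
Proof.
move=> ia; rewrite /integr (_ : EFin \o _ = (fun t => k%:E * (EFin \o a) t))%E //.
by apply: integrableZl.
Qed.

Lemma integrN a : integr a -> integr (fun t => - a t).
Proof.
by move=> ia; apply: eq_integrable (integrZ (-1) ia) => // t _ /=; rewrite mulN1r.
Qed.

Lemma integrB a b : integr a -> integr b -> integr (fun t => a t - b t).
Proof. by move=> ia ib; apply: integrD => //; exact: integrN. Qed.

Lemma integr_norm a : integr a -> integr (fun t => `|a t|).
Proof. exact: integrable_norm. Qed.

Lemma integr_cst k : integr (fun=> k).
Proof.
apply: continuous_compact_integrable; first exact: segment_compact.
by apply: continuous_subspaceT => x; exact: cvg_cst.
Qed.

Lemma integr_measurable a : integr a -> measurable_fun I01 a.
Proof. by move=> /measurable_int /measurable_EFinP. Qed.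

Lemma integr_le a b : measurable_fun I01 a -> integr b ->
  (forall t, 0 <= t <= 1 -> `|a t| <= b t) -> integr a.
Proof.
move=> ma ib ab; apply: le_integrable ib => //; first exact/measurable_EFinP.
move=> t /=; rewrite in_itv /= lee_fin => /ab h; apply: le_trans h _.
exact: ler_norm.
Qed.

Lemma integrM a (h : R -> R) M : integr a -> measurable_fun I01 h ->
  (forall t, 0 <= t <= 1 -> `|h t| <= M) -> integr (fun t => a t * h t).
Proof.
move=> ia mh hM; apply: (integr_le (b := fun t => M * `|a t|)).
- by apply: measurable_funM => //; exact: integr_measurable.
- by apply: integrZ; exact: integr_norm.
- by move=> t /hM h1; rewrite normrM mulrC ler_wpM2r.
Qed.

Lemma RAC_prim a : integr a -> RAC (fun x => \int[mu]_(t in `[0, x]) a t) a.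
Proof.
by move=> ia; split=> // x _; rewrite set_itv1 Rintegral_set1 add0r.
Qed.

Lemma RAC_D u u' v v' : RAC u u' -> RAC v v' -> RAC (fun t => u t + v t) (fun t => u' t + v' t).
Proof.
move=> [iu hu] [iv hv]; split; first exact: integrD.
move=> x x01; rewrite hu // hv // RintegralD //; first ring.
  by apply: integr_subc => //; case/andP: x01.
by apply: integr_subc => //; case/andP: x01.
Qed.

Lemma RAC_Z k u u' : RAC u u' -> RAC (fun t => k * u t) (fun t => k * u' t).
Proof.
move=> [iu hu]; split; first exact: integrZ.
move=> x x01; rewrite hu // RintegralZl //; first ring.
by apply: integr_subc => //; case/andP: x01.
Qed.

Lemma RAC_ext u u' v v' : RAC u u' -> (forall t, 0 <= t <= 1 -> u t = v t) ->
  (forall t, 0 <= t <= 1 -> u' t = v' t) -> RAC v v'.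
Proof.
move=> [iu hu] uv uv'; split.
  by apply: eq_integrable iu => // t; rewrite inE /= in_itv /= => /uv' ->.
move=> x x01; rewrite -uv // hu // -uv ?lexx ?ler01 //; congr (_ + _).
apply: eq_Rintegral => t; rewrite inE /= in_itv /= => /andP[t0 tx].
by rewrite uv' // t0 (le_trans tx) //; case/andP: x01.
Qed.

Lemma RAC_B u u' v v' : RAC u u' -> RAC v v' -> RAC (fun t => u t - v t) (fun t => u' t - v' t).
Proof.
move=> hu hv; apply: (RAC_ext (RAC_D hu (RAC_Z (-1) hv))) => t _; ring.
Qed.

Lemma RAC_cst k : RAC (fun=> k) (fun=> 0).
Proof.
split; first exact: integr_cst.
by move=> x _; rewrite Rintegral_cst // mul0r addr0.
Qed.

Lemma RAC_le u u' v v' x y : RAC u u' -> RAC v v' -> 0 <= x -> x <= y -> y <= 1 ->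
  (forall t, x < t -> t <= y -> u' t <= v' t) -> u y - u x <= v y - v x.
Proof.
move=> hu hv x0 xy y1 h; rewrite (RAC_diff hu) // (RAC_diff hv) //.
by apply: rint_le => //; [case: hu|case: hv].
Qed.

Lemma RAC_norm_le u u' v v' x y : RAC u u' -> RAC v v' -> 0 <= x -> x <= y -> y <= 1 ->
  (forall t, x < t -> t <= y -> `|u' t| <= v' t) -> `|u y - u x| <= v y - v x.
Proof.
move=> hu hv x0 xy y1 h; rewrite ler_norml; apply/andP; split.
  have := RAC_le (RAC_Z (-1) hu) hv x0 xy y1; rewrite !mulN1r => H.
  suff : - u y - - u x <= v y - v x by lra.
  by apply: H => t xt ty; rewrite mulN1r; have := h t xt ty; rewrite ler_norml; lra.
apply: (RAC_le hu hv x0 xy y1) => t xt ty.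
by have := h t xt ty; rewrite ler_norml; lra.
Qed.

Lemma RAC_cont u u' : RAC u u' -> {within I01, continuous u}.
Proof.
move=> [iu hu].
have c := parameterized_integral_continuous ler01 iu.
apply: (@subspace_eq_continuous _ _ _ (fun x => u 0 + parameterized_integral mu 0 x u')).
  by move=> x; rewrite inE /= in_itv /= => h; exact: esym (hu _ h).
by move=> x; apply: cvgD; [exact: cvg_cst|exact: c].
Qed.

Lemma RAC_measurable u u' : RAC u u' -> measurable_fun I01 u.
Proof. by move=> /RAC_cont; exact: subspace_continuous_measurable_fun. Qed.

Lemma RAC_bounded u u' : RAC u u' -> exists2 M, 0 <= M & forall x, 0 <= x <= 1 -> `|u x| <= M.
Proof.
move=> hu; have i := integr_norm hu.1; have hv := RAC_prim i.
set v := (X in RAC X _) in hv.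
have v0 : v 0 = 0 by rewrite /v set_itv1 Rintegral_set1.
have mono x y : 0 <= x -> x <= y -> y <= 1 -> v x <= v y.
  move=> x0 xy y1; rewrite -subr_ge0 -(subrr (0 : R)).
  by apply: (RAC_le (RAC_cst 0) hv).
exists (`|u 0| + v 1) => [|x /andP[x0 x1]].
  by have := mono 0 1 (lexx _) ler01 (lexx _); have := normr_ge0 (u 0); lra.
have := RAC_norm_le hu hv (lexx 0) x0 x1 (fun t _ _ => lexx _).
have := mono x 1 x0 x1 (lexx _); rewrite v0 subr0 => h1 h2.
have := ler_normD (u 0) (u x - u 0); rewrite addrC subrK; lra.
Qed.

Lemma RAC_unif u u' e : RAC u u' -> 0 < e -> exists N : nat,
  forall x y, 0 <= x <= 1 -> 0 <= y <= 1 -> `|x - y| <= N.+1%:R^-1 -> `|u x - u y| <= e.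
Proof.
move=> /RAC_cont /subspace_continuousP cu e0.
have cI : compact I01 by exact: segment_compact.
have /compact_near_coveringP nc := cI.
have := nc nat \oo (fun i x => I01 x -> forall y, 0 <= y <= 1 ->
  `|x - y| <= i.+1%:R^-1 -> `|u x - u y| <= e) _ _.
case.
  move=> x Ix; have e2 : 0 < e / 2 by lra.
  have /cvgrPdist_le /(_ _ e2) := cu x Ix.
  rewrite near_withinE => /nbhs_ballP[d /= d0 hd].
  have [N hN] : exists N : nat, N.+1%:R^-1 < d / 2.
    have := truncnS_gt (2 / d); set N := Num.truncn _ => h; exists N.
    by rewrite invf_plt ?posrE ?ltr0Sn ?invf_div //; lra.
  exists (ball x (d / 2), [set i | (N <= i)%N]); last first.
    move=> [y i] /= [xy Ni] Iy z z01 yz.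
    have iN : i.+1%:R^-1 <= N.+1%:R^-1 :> R by rewrite lef_pV2 ?posrE ?ltr0Sn // ler_nat.
    move: xy; rewrite /ball /= => xy.
    have /hd/(_ Iy) : ball x d y by rewrite /ball /=; lra.
    have /hd : ball x d z.
      have yz' := le_lt_trans yz (le_lt_trans iN hN).
      by rewrite /ball /=; apply: le_lt_trans (ler_distD y x z) _; lra.
    have Iz : I01 z by rewrite /= in_itv.
    move=> /(_ Iz); have := ler_distD (u x) (u y) (u z); rewrite (distrC (u y) (u x)) /=; lra.
  split; first by apply/nbhs_ballP; exists (d / 2) => //=; lra.
  by exists N.
move=> N _ hN; exists N => x y x01 y01; apply: (hN N (leqnn N)) => //.
all: by rewrite /= in_itv.
Qed.

(** Summing over N + 1 equal pieces of [0, x] gives |phi x - phi 0| <= e (m x - m 0) for every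
    positive e. *)
Lemma partition_const (phi m : R -> R) : (forall e, 0 < e -> exists N : nat,
    forall x y, 0 <= x -> x <= y -> y <= 1 -> y - x <= N.+1%:R^-1 ->
      `|phi y - phi x| <= e * (m y - m x)) ->
  forall x, 0 <= x <= 1 -> phi x = phi 0.
Proof.
move=> h x /andP[x0 x1].
have key e : 0 < e -> `|phi x - phi 0| <= e * (m x - m 0).
  move=> /h [N hN].
  have N0 : 0 < N.+1%:R :> R by rewrite ltr0Sn.
  have step i : (i <= N.+1)%N ->
      `|phi (x * (i%:R / N.+1%:R)) - phi 0| <= e * (m (x * (i%:R / N.+1%:R)) - m 0).
    elim: i => [|i IH] iN; first by rewrite mul0r mulr0 !subrr normr0 mulr0.
    have i1 : (i.+1%:R : R) / N.+1%:R <= 1 by rewrite ler_pdivrMr // mul1r ler_nat.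
    have i0 : (0 : R) <= i%:R / N.+1%:R by rewrite divr_ge0 // ltW.
    have ii : (i.+1%:R : R) / N.+1%:R = i%:R / N.+1%:R + N.+1%:R^-1.
      by rewrite -natr1 mulrDl mul1r.
    have n0 : (0 : R) <= N.+1%:R^-1 by rewrite invr_ge0 ltW.
    have := hN (x * (i%:R / N.+1%:R)) (x * (i.+1%:R / N.+1%:R)).
    have := IH (ltnW iN); rewrite ii in i1 *.
    set p := i%:R / N.+1%:R in i0 i1 *; set q := N.+1%:R^-1 in i1 n0 * => h1.
    have a1 : 0 <= x * p by rewrite mulr_ge0.
    have a2 : x * p <= x * (p + q) by rewrite ler_wpM2l //; lra.
    have a3 : x * (p + q) <= 1 by nra.
    have a4 : x * (p + q) - x * p <= q by nra.
    move=> /(_ a1 a2 a3 a4) h2.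
    have := ler_normD (phi (x * (p + q)) - phi (x * p)) (phi (x * p) - phi 0).
    rewrite subrKA; lra.
  by have := step N.+1 (leqnn _); rewrite divff ?mulr1 // gt_eqF.
apply/eqP; rewrite -subr_eq0 -normr_le0; apply/ler_addgt0Pr => d d0.
set c := m x - m 0 in key.
have c0 : 0 < `|c| + 1 by have := normr_ge0 c; lra.
apply: le_trans (key (d / (`|c| + 1)) (divr_gt0 d0 c0)) _.
rewrite add0r mulrAC ler_pdivrMr // ler_pM2l //; have := ler_norm c; lra.
Qed.

(** The defect of u v from the integral of u' v + u v' has increments that are small against those
    of the integral of |u'| + |v'|, by uniform continuity of u and v; so it is constant. *)
Lemma RAC_M u u' v v' : RAC u u' -> RAC v v' ->
  RAC (fun t => u t * v t) (fun t => u' t * v t + u t * v' t).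
Proof.
move=> hu hv; have [Mu Mu0 uM] := RAC_bounded hu; have [Mv Mv0 vM] := RAC_bounded hv.
have iuv : integr (fun t => u' t * v t) by apply: (integrM hu.1 (RAC_measurable hv) vM).
have iuv' : integr (fun t => u t * v' t).
  by apply: eq_integrable (integrM hv.1 (RAC_measurable hu) uM) => // t _ /=; rewrite mulrC.
have i := integrD iuv iuv'; split=> //.
have hw := RAC_prim i; set w := (X in RAC X _) in hw.
have w0 : w 0 = 0 by rewrite /w set_itv1 Rintegral_set1.
have hm := RAC_prim (integrD (integr_norm hu.1) (integr_norm hv.1)).
set m := (X in RAC X _) in hm.
suff H x : 0 <= x <= 1 -> u x * v x - w x = u 0 * v 0 - w 0.
  by move=> x /H; rewrite w0 -/(w x) => h; lra.
apply: (@partition_const (fun x => u x * v x - w x) m) => e e0.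
have [N hN] := RAC_unif hu e0; have [N' hN'] := RAC_unif hv e0.
exists (maxn N N') => {}x y x0 xy y1 xyN.
have le1 : (maxn N N').+1%:R^-1 <= N.+1%:R^-1 :> R.
  by rewrite lef_pV2 ?posrE ?ltr0Sn // ler_nat ltnS leq_maxl.
have le2 : (maxn N N').+1%:R^-1 <= N'.+1%:R^-1 :> R.
  by rewrite lef_pV2 ?posrE ?ltr0Sn // ler_nat ltnS leq_maxr.
(* With x and y frozen, the increment of u v equals that of v(y) u + u(x) v, which is linear in u
   and v. *)
have ha : RAC (fun s => v y * u s + u x * v s - w s)
    (fun s => v y * u' s + u x * v' s - (u' s * v s + u s * v' s)).
  by apply: RAC_B hw; apply: RAC_D; exact: RAC_Z.
have := RAC_norm_le ha (RAC_Z e hm) x0 xy y1.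
have -> : v y * u y + u x * v y - w y - (v y * u x + u x * v x - w x) =
  u y * v y - w y - (u x * v x - w x) by ring.
rewrite -mulrBr; apply => t xt ty.
have -> : v y * u' t + u x * v' t - (u' t * v t + u t * v' t) =
  (v y - v t) * u' t + (u x - u t) * v' t by ring.
apply: le_trans (ler_normD _ _) _; rewrite !normrM mulrDr.
have [ht hy hx] : [/\ 0 <= t <= 1, 0 <= y <= 1 & 0 <= x <= 1].
  by clear -x0 xy y1 xt ty; split; apply/andP; split; lra.
apply: lerD; apply: ler_wpM2r => //.
- apply: hN' => //.
  rewrite ger0_norm; [apply: le_trans le2; apply: le_trans xyN; lra|lra].
- apply: hN => //.
  rewrite distrC ger0_norm; [apply: le_trans le1; apply: le_trans xyN; lra|lra].
Qed.

Lemma RAC_C1 u u' : continuous u' -> (forall x : R, is_derive x 1 u (u' x)) -> RAC u u'.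
Proof.
move=> cu du.
have iu : integr u'.
  by apply: continuous_compact_integrable; [exact: segment_compact|exact: continuous_subspaceT].
split=> // x /andP[x0 x1].
have [->|xn] := eqVneq x 0; first by rewrite set_itv1 Rintegral_set1 addr0.
have xp : 0 < x by rewrite lt_def xn.
have cont : continuous u.
  move=> z; apply: differentiable_continuous; apply/derivable1_diffP.
  exact: ex_derive.
have FTC : (\int[mu]_(t in `[(0 : R)%R, x]) (u' t)%:E = (u x)%:E - (u 0)%:E)%E.
  apply: continuous_FTC2 => //; first exact: continuous_subspaceT.
  - split.
    + by move=> z _; exact: ex_derive.
    + by apply: cvg_at_right_filter; exact: cont.
    + by apply: cvg_at_left_filter; exact: cont.
  - by move=> z _; rewrite derive1E; exact: derive_val.
by rewrite /Rintegral FTC /=; ring.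
Qed.

(** Lebesgue's differentiation theorem for u' extended by 0 outside [0, 1]; the two end points form
    a null set. *)
Lemma RAC_ae0 u' : RAC (fun=> 0) u' -> {ae mu, forall x, I01 x -> u' x = 0}.
Proof.
move=> [iu hu].
pose f := u' \_ I01.
have ifT : mu.-integrable setT (EFin \o f).
  rewrite /f -restrict_EFin.
  by apply/(@integrable_mkcond _ _ _ mu I01 (EFin \o u') (measurable_itv _)).
have locf : locally_integrable [set: R] f.
  by apply: integrable_locally => //; exact: measurable_itv.
have FTC := @FTC1 R f (BLeft 0) _ locf.
have {}FTC := FTC (fun y => ltac:(by apply: integrableS ifT)).
have n1 c : {ae mu, forall x, x != c}.
  exists [set c]; split; [exact: measurable_set1|exact: lebesgue_measure_set1|].
  by move=> x /= /negP; rewrite negbK => /eqP.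
move: (n1 0) (n1 1); simpl in FTC; move: FTC.
apply: filterS3; first exact: (ae_filter_ringOfSetsType mu).
move=> x hF x0 x1; rewrite /= in_itv /= => /andP[xge xle].
have xp : 0 < x by rewrite lt_def x0.
have xl : x < 1 by rewrite lt_def eq_sym x1.
have [|_] := hF; first by rewrite lte_fin.
have -> : f x = u' x by rewrite /f patchE mem_set //= in_itv /= xge xle.
move=> <-; rewrite derive1E.
have nz : \forall z \near x, \int[mu]_(t in `[0, z]) f t = 0 :> R.
  have : \forall z \near x, z \in `]0, 1[%R by apply: near_in_itvoo; rewrite in_itv /= xp.
  apply: filterS => z; rewrite in_itv /= => /andP[z0 z1].
  have z01 : 0 <= z <= 1 by rewrite !ltW.
  have h0 := hu z z01; rewrite add0r in h0; rewrite [RHS]h0.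
  apply: eq_Rintegral => t; rewrite inE /= in_itv /= => /andP[t0 tz].
  by rewrite /f patchE mem_set //= in_itv /= t0 (le_trans tz) // ltW.
by rewrite (near_eq_derive (g := fun=> 0)) ?derive_cst.
Qed.

End RealAC.

Section RealAC2.
Variable R : realType.
Local Open Scope classical_set_scope.
Local Notation mu := (@lebesgue_measure R).
Local Notation I01 := (`[(0 : R), 1]%classic).
Implicit Types (u v w a b : R -> R) (x y z t e M : R).

Lemma RAC_id : RAC (@idfun R) (fun=> 1).
Proof.
have c : continuous (fun _ : R => 1 : R) by move=> x; exact: cvg_cst.
by apply: (RAC_C1 c) => x; exact: is_derive_id.
Qed.

Lemma RAC_X u u' n : RAC u u' -> RAC (fun t => u t ^+ n.+1) (fun t => n.+1%:R * u t ^+ n * u' t).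
Proof.
move=> hu; elim: n => [|n IH].
  by apply: (RAC_ext hu) => t _; rewrite ?expr1 // expr0 !mul1r.
apply: (RAC_ext (RAC_M hu IH)) => t _; first by rewrite [RHS]exprS.
by rewrite -[n.+2%:R]natr1 !exprS; ring.
Qed.

Lemma RAC_const_of0 u x y : RAC u (fun=> 0) -> 0 <= x <= 1 -> 0 <= y <= 1 -> u x = u y.
Proof.
move=> [_ hu] hx hy; rewrite hu // [in RHS]hu //.
by rewrite !Rintegral_cst ?mul0r //; exact: measurable_itv.
Qed.

(** A nonzero value of the continuous function u would persist on a short interval, over which its
    integral would not vanish. The interval is placed on the side of x that stays in [0, 1], so the
    end points are included. *)
Lemma RAC_cont0 u u' : RAC u u' -> RAC (fun=> 0) u -> forall x, 0 <= x <= 1 -> u x = 0.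
Proof.
move=> hu h0 x /andP[x0 x1]; apply/eqP; rewrite -normr_le0; apply/ler_addgt0Pr => e e0.
rewrite add0r; have [N hN] := RAC_unif hu e0.
pose d : R := Num.min N.+1%:R^-1 (1 / 2).
have N0 : 0 < N.+1%:R^-1 :> R by rewrite invr_gt0 ltr0Sn.
have d0 : 0 < d by rewrite lt_min N0 divr_gt0.
have dN : d <= N.+1%:R^-1 by rewrite ge_min lexx.
have d2 : d <= 1 / 2 by rewrite ge_min lexx orbT.
have key p q : 0 <= p -> p <= q -> q <= 1 -> q - p = d -> p <= x -> x <= q -> `|u x| <= e.
  move=> p0 pq q1 pqd px xq.
  have cl t : p < t -> t <= q -> `|u x - u t| <= e.
    move=> pt tq; apply: hN; [by rewrite x0|by apply/andP; split; lra|].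
    by apply: le_trans dN; rewrite ler_norml; lra.
  have lin k : RAC (fun t => k * t) (fun=> k).
    by apply: (RAC_ext (RAC_Z k RAC_id)) => t _ //; rewrite mulr1.
  have h1 := RAC_le (lin (u x - e)) h0 p0 pq q1.
  have h2 := RAC_le h0 (lin (u x + e)) p0 pq q1.
  have {}h1 : (u x - e) * d <= 0.
    rewrite -pqd mulrBr; apply: le_trans (h1 _) _; last by rewrite subrr.
    by move=> t pt tq; have := cl t pt tq; rewrite ler_norml; lra.
  have {}h2 : 0 <= (u x + e) * d.
    rewrite -pqd mulrBr; apply: le_trans (h2 _); first by rewrite subrr.
    by move=> t pt tq; have := cl t pt tq; rewrite ler_norml; lra.
  move: h1 h2; rewrite pmulr_lle0 // pmulr_lge0 // ler_norml; lra.
have [h|h] := leP x (1 / 2).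
  by apply: (key x (x + d)); lra.
by apply: (key (x - d) x); lra.
Qed.

End RealAC2.

(** * Complex-valued absolutely continuous functions *)

Section ComplexAC.
Variable R : realType.
Local Notation C := R[i].
Local Open Scope complex_scope.
Local Open Scope classical_set_scope.
Local Notation mu := (@lebesgue_measure R).
Local Notation I01 := (`[(0 : R), 1]%classic).
Implicit Types (f g : R -> C) (x y t : R).

Definition abscont f f' := cintegrable I01 f' /\
  forall x : R, 0 <= x <= 1 -> f x = f 0 + cint `[(0:R), x] f'.

Lemma abscontE f f' : abscont f f' <-> RAC (cRe f) (cRe f') /\ RAC (cIm f) (cIm f').
Proof.
split=> [[[i1 i2] h]|[[i1 h1] [i2 h2]]].
  split; split=> // x hx.
    by rewrite /cRe h // raddfD.
  by rewrite /cIm h // raddfD.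
split=> // x hx; apply/eqP; rewrite eq_complex !raddfD /=.
by rewrite -/(cRe f x) -/(cRe f 0) -/(cIm f x) -/(cIm f 0) -h1 // -h2 // !eqxx.
Qed.

Lemma AC_ext f f' g g' : abscont f f' -> (forall t, 0 <= t <= 1 -> f t = g t) ->
  (forall t, 0 <= t <= 1 -> f' t = g' t) -> abscont g g'.
Proof.
move=> /abscontE[h1 h2] fg fg'; apply/abscontE; split.
  by apply: (RAC_ext h1) => t ht; rewrite /cRe ?fg ?fg'.
by apply: (RAC_ext h2) => t ht; rewrite /cIm ?fg ?fg'.
Qed.

Lemma AC_cst (c : C) : abscont (fun=> c) (fun=> 0).
Proof. by apply/abscontE; split; exact: RAC_cst. Qed.

Lemma AC_D f f' g g' : abscont f f' -> abscont g g' -> abscont (fun t => f t + g t) (fun t => f' t + g' t).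
Proof.
move=> /abscontE[f1 f2] /abscontE[g1 g2]; apply/abscontE; split.
  by apply: (RAC_ext (RAC_D f1 g1)) => t _; rewrite /cRe raddfD.
by apply: (RAC_ext (RAC_D f2 g2)) => t _; rewrite /cIm raddfD.
Qed.

Lemma AC_M f f' g g' : abscont f f' -> abscont g g' ->
  abscont (fun t => f t * g t) (fun t => f' t * g t + f t * g' t).
Proof.
move=> /abscontE[f1 f2] /abscontE[g1 g2]; apply/abscontE; split.
  apply: (RAC_ext (RAC_B (RAC_M f1 g1) (RAC_M f2 g2))) => t _; rewrite /cRe /cIm.
    by case: (f t) => a b; case: (g t).
  by case: (f t) => a b; case: (g t) => c d; case: (f' t) => a' b'; case: (g' t) => c' d' /=; ring.
apply: (RAC_ext (RAC_D (RAC_M f1 g2) (RAC_M f2 g1))) => t _; rewrite /cRe /cIm.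
  by case: (f t) => a b; case: (g t).
by case: (f t) => a b; case: (g t) => c d; case: (f' t) => a' b'; case: (g' t) => c' d' /=; ring.
Qed.

Lemma AC_Z (c : C) f f' : abscont f f' -> abscont (fun t => c * f t) (fun t => c * f' t).
Proof. by move=> h; apply: (AC_ext (AC_M (AC_cst c) h)) => t _ //; rewrite mul0r add0r. Qed.

Lemma AC_B f f' g g' : abscont f f' -> abscont g g' -> abscont (fun t => f t - g t) (fun t => f' t - g' t).
Proof. by move=> hf hg; apply: (AC_ext (AC_D hf (AC_Z (-1) hg))) => t _; rewrite mulN1r. Qed.

Lemma AC_sum (I : Type) (s : seq I) (F F' : I -> R -> C) : (forall i, abscont (F i) (F' i)) ->
  abscont (fun t => \sum_(i <- s) F i t) (fun t => \sum_(i <- s) F' i t).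
Proof.
move=> h; elim: s => [|i s IH].
  by apply: (AC_ext (AC_cst 0)) => t _; rewrite big_nil.
by apply: (AC_ext (AC_D (h i) IH)) => t _; rewrite big_cons.
Qed.

Lemma AC_real (u u' : R -> R) : RAC u u' -> abscont (fun t => (u t)%:C) (fun t => (u' t)%:C).
Proof. by move=> h; apply/abscontE; split=> //; exact: RAC_cst. Qed.

(** The factor 2 comes from estimating real and imaginary parts separately; it reappears in the
    constants of the estimates for linear systems. *)
Lemma AC_le f f' (v v' : R -> R) x y : abscont f f' -> RAC v v' -> 0 <= x -> x <= y -> y <= 1 ->
  (forall t, x < t -> t <= y -> normc (f' t) <= v' t) -> normc (f y - f x) <= 2 * (v y - v x).
Proof.
move=> /abscontE[h1 h2] hv x0 xy y1 h; apply: le_trans (nc_le _) _; rewrite !raddfB /=.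
have := RAC_norm_le h1 hv x0 xy y1; have := RAC_norm_le h2 hv x0 xy y1.
rewrite /cRe /cIm => H2 H1.
have := H1 (fun t xt ty => le_trans (nc_ge_Re _) (h t xt ty)).
have := H2 (fun t xt ty => le_trans (nc_ge_Im _) (h t xt ty)); lra.
Qed.

Lemma AC_bounded f f' : abscont f f' -> exists2 M, 0 <= M & forall x, 0 <= x <= 1 -> normc (f x) <= M.
Proof.
move=> /abscontE[/RAC_bounded[M M0 hM] /RAC_bounded[N N0 hN]].
exists (M + N); first lra.
by move=> x hx; apply: le_trans (nc_le _) _; apply: lerD; [exact: hM|exact: hN].
Qed.

Lemma AC_measurable f f' : abscont f f' -> measurable_fun I01 (cRe f) /\ measurable_fun I01 (cIm f).
Proof. by move=> /abscontE[/RAC_measurable ? /RAC_measurable ?]. Qed.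

Lemma AC_prim (c : C) f' : cintegrable I01 f' -> abscont (fun x => c + cint `[(0:R), x] f') f'.
Proof.
move=> h; split=> // x _; congr (_ + _).
have -> : cint `[(0:R), 0] f' = 0.
  by rewrite /cint set_itv1 !Rintegral_set1.
by rewrite addr0.
Qed.

Lemma cintegrableD f g : cintegrable I01 f -> cintegrable I01 g ->
  cintegrable I01 (fun t => f t + g t).
Proof.
move=> [f1 f2] [g1 g2]; split.
  by apply: eq_integrable (integrD f1 g1) => // t _ /=; rewrite /cRe; case: (f t); case: (g t).
by apply: eq_integrable (integrD f2 g2) => // t _ /=; rewrite /cIm; case: (f t); case: (g t).
Qed.

Lemma cintegrable_cst (c : C) : cintegrable I01 (fun=> c).
Proof. by split; exact: integr_cst. Qed.

Lemma cintegrableM f h (M : R) : cintegrable I01 f ->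
  measurable_fun I01 (cRe h) /\ measurable_fun I01 (cIm h) ->
  (forall t, 0 <= t <= 1 -> normc (h t) <= M) -> cintegrable I01 (fun t => f t * h t).
Proof.
move=> [f1 f2] [m1 m2] hM.
have b1 t : 0 <= t <= 1 -> `|cRe h t| <= M by move=> /hM; exact: le_trans (nc_ge_Re _).
have b2 t : 0 <= t <= 1 -> `|cIm h t| <= M by move=> /hM; exact: le_trans (nc_ge_Im _).
split.
  apply: eq_integrable (integrB (integrM f1 m1 b1) (integrM f2 m2 b2)) => // t _ /=.
  by rewrite /cRe /cIm; case: (f t) => a b; case: (h t).
apply: eq_integrable (integrD (integrM f1 m2 b2) (integrM f2 m1 b1)) => // t _ /=.
by rewrite /cRe /cIm; case: (f t) => a b; case: (h t).
Qed.

Lemma cintegrableM_AC f h h' : cintegrable I01 f -> abscont h h' ->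
  cintegrable I01 (fun t => f t * h t).
Proof.
move=> hf hh; have [M M0 hM] := AC_bounded hh.
exact: cintegrableM hf (AC_measurable hh) hM.
Qed.

Lemma cintegrable_sum (I : Type) (s : seq I) (F : I -> R -> C) :
  (forall i, cintegrable I01 (F i)) -> cintegrable I01 (fun t => \sum_(i <- s) F i t).
Proof.
move=> h; elim: s => [|i s IH].
  by have -> : (fun t => \sum_(i <- [::]) F i t) = (fun=> 0);
    [apply/funext => t; rewrite big_nil|exact: cintegrable_cst].
have -> : (fun t => \sum_(j <- i :: s) F j t) = (fun t => F i t + \sum_(j <- s) F j t).
  by apply/funext => t; rewrite big_cons.
exact: cintegrableD.
Qed.

Lemma integr_nc f : cintegrable I01 f -> integr (fun t => normc (f t)).
Proof.
move=> [f1 f2]; apply: (integr_le (b := fun t => `|cRe f t| + `|cIm f t|)).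
- have -> : (fun t => normc (f t)) =
      (Num.sqrt : R -> R) \o (fun t => cRe f t * cRe f t + cIm f t * cIm f t).
    apply/funext => t; rewrite /= -!expr2 /cRe /cIm; by case: (f t).
  apply: measurableT_comp; first by apply: continuous_measurable_fun; exact: sqrt_continuous.
  by apply: measurable_funD; apply: measurable_funM; exact: integr_measurable.
- by apply: integrD; exact: integr_norm.
- by move=> t _; rewrite ger0_norm ?nc_ge0 // nc_le.
Qed.

Lemma AC_ae0 f' : abscont (fun=> 0) f' -> {ae mu, forall x, I01 x -> f' x = 0}.
Proof.
move=> /abscontE[/RAC_ae0 + /RAC_ae0]; apply: filterS2; first exact: (ae_filter_ringOfSetsType mu).
move=> x h1 h2 Ix; have := h1 Ix; have := h2 Ix; rewrite /cRe /cIm.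
by case: (f' x) => a b /= -> ->.
Qed.

Lemma AC_cont0 f f' : abscont f f' -> abscont (fun=> 0) f -> forall x, 0 <= x <= 1 -> f x = 0.
Proof.
move=> /abscontE[h1 h2] /abscontE[g1 g2] x hx.
have := RAC_cont0 h1 g1 hx; have := RAC_cont0 h2 g2 hx; rewrite /cRe /cIm.
by case: (f x) => a b /= -> ->.
Qed.

Definition cexp (m : C) (t : R) : C :=
  (expR (complex.Re m * t) * cos (complex.Im m * t)) +i*
  (expR (complex.Re m * t) * sin (complex.Im m * t)).

Lemma cexp0 m : cexp m 0 = 1.
Proof. by rewrite /cexp !mulr0 expR0 cos0 sin0 !mul1r. Qed.

Lemma nc_cexp m t : normc (cexp m t) = expR (complex.Re m * t).
Proof.
apply/eqP; rewrite -(eqrXn2 (n := 2)) ?nc_ge0 ?expR_ge0 // nc_sqr /cexp /= !exprMn -mulrDr.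
by rewrite cos2Dsin2 mulr1.
Qed.

Lemma AC_cexp m : abscont (cexp m) (fun t => m * cexp m t).
Proof.
case: m => a b; apply/abscontE.
have lin (c t : R) : is_derive t 1 (fun s => c * s) c.
  have h := @is_deriveZ _ _ _ id c t 1 1 (is_derive_id t (1 : R)).
  by apply: (is_derive_eq h); rewrite /GRing.scale /= mulr1.
have dE t : is_derive t 1 (fun s => expR (a * s)) (expR (a * t) * a).
  by apply: (is_derive1_comp (f := expR)); exact: lin.
have dC t : is_derive t 1 (fun s => cos (b * s)) (- sin (b * t) * b).
  by apply: (is_derive1_comp (f := cos)); exact: lin.
have dS t : is_derive t 1 (fun s => sin (b * s)) (cos (b * t) * b).
  by apply: (is_derive1_comp (f := sin)); exact: lin.
have cE : continuous (fun t => expR (a * t)).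
  by move=> t; apply: continuous_comp; [exact: mulrl_continuous|exact: continuous_expR].
have cC : continuous (fun t => cos (b * t)).
  by move=> t; apply: continuous_comp; [exact: mulrl_continuous|exact: continuous_cos].
have cS : continuous (fun t => sin (b * t)).
  by move=> t; apply: continuous_comp; [exact: mulrl_continuous|exact: continuous_sin].
split; rewrite /cRe /cIm /cexp /=; apply: RAC_C1.
- move=> t; apply: cvgB; apply: cvgM; [exact: cvg_cst| |exact: cvg_cst|];
    by apply: cvgM; [exact: cE|first [exact: cC|exact: cS]].
- move=> t; have h := is_deriveM (dE t) (dC t).
  by apply: (is_derive_eq h); rewrite /GRing.scale /=; ring.
- move=> t; apply: cvgD; apply: cvgM; [exact: cvg_cst| |exact: cvg_cst|];
    by apply: cvgM; [exact: cE|first [exact: cC|exact: cS]].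
- move=> t; have h := is_deriveM (dE t) (dS t).
  by apply: (is_derive_eq h); rewrite /GRing.scale /=; ring.
Qed.

End ComplexAC.

(** * Linear systems *)

Section Gronwall.
Variable R : realType.
Local Notation C := R[i].
Local Open Scope complex_scope.
Local Open Scope classical_set_scope.
Local Notation I01 := (`[(0 : R), 1]%classic).
Implicit Types (G g : R -> R) (x y t m S T : R).

Lemma RAC_mono G g x y : RAC G g -> (forall t, 0 <= t <= 1 -> 0 <= g t) ->
  0 <= x -> x <= y -> y <= 1 -> G x <= G y.
Proof.
move=> hG g0 x0 xy y1; rewrite -subr_ge0 -(subrr (0 : R)).
by apply: (RAC_le (RAC_cst 0) hG) => // t xt ty; apply: g0; apply/andP; split; lra.
Qed.

Lemma halving_bound (f B m : R) : (forall k : nat, f <= 2 * m + B / 2 ^+ k) -> f <= 2 * m.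
Proof.
move=> h; apply/ler_addgt0Pr => e e0.
pose k := Num.truncn (`|B| / e).
apply: le_trans (h k.+1) _; rewrite lerD2l ler_pdivrMr ?exprn_gt0 //.
have h1 := truncnS_gt (`|B| / e); rewrite -/k ltr_pdivrMr // in h1.
apply: le_trans (ler_norm B) _; apply: ltW; apply: lt_le_trans h1 _.
rewrite mulrC; apply: ler_wpM2l; first exact: ltW.
by rewrite -natrX ler_nat ltnW // ltn_expl.
Qed.

Section Family.
Variables (I : finType) (Z Z' : I -> R -> C) (G g : R -> R).
Hypothesis ZAC : forall i, abscont (Z i) (Z' i).
Hypothesis GAC : RAC G g.
Hypothesis g0 : forall t, 0 <= t <= 1 -> 0 <= g t.
Hypothesis Zg : forall t, 0 <= t <= 1 -> forall S, (forall i, normc (Z i t) <= S) ->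
  forall i, normc (Z' i t) <= S * g t.

Lemma family_bounded : exists2 S, 0 <= S & forall i t, 0 <= t <= 1 -> normc (Z i t) <= S.
Proof.
have /choice [M hM] : forall i, exists M : R, 0 <= M /\ forall t, 0 <= t <= 1 -> normc (Z i t) <= M.
  by move=> i; have [M M0 h] := AC_bounded (ZAC i); exists M.
exists (\sum_i M i); first by apply: sumr_ge0 => i _; case: (hM i).
move=> i t ht; rewrite (bigD1 i) //=; have [_ h] := hM i; have := h t ht.
have : 0 <= \sum_(j | j != i) M j by apply: sumr_ge0 => j _; case: (hM j).
lra.
Qed.

(** Starting from a crude bound S, each pass through the integral inequality turns a bound T into m
    + T / 2, since G varies by at most 1/4; the excess over 2m is halved every time. *)
Lemma block_bound x y m : 0 <= x -> x <= y -> y <= 1 -> G y - G x <= 1 / 4%:R ->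
  (forall i, normc (Z i x) <= m) -> forall t, x <= t -> t <= y -> forall i, normc (Z i t) <= 2 * m.
Proof.
move=> x0 xy y1 Gxy hm.
have [S S0 hS] := family_bounded.
have key k : forall t, x <= t -> t <= y -> forall i, normc (Z i t) <= 2 * m + S / 2 ^+ k.
  have [i0|no] := pselect (exists i : I, True); last first.
    by move=> t _ _ i; exfalso; apply: no; exists i.
  have m0 : 0 <= m by have [i _] := i0; exact: le_trans (nc_ge0 _) (hm i).
  elim: k => [|k IH] t xt ty i.
    rewrite expr0 divr1; apply: le_trans (hS i t _) _; first by apply/andP; split; lra.
    lra.
  set T := 2 * m + S / 2 ^+ k in IH.
  have T0 : 0 <= T by rewrite addr_ge0 ?mulr_ge0 ?divr_ge0 ?exprn_ge0.
  have := AC_le (ZAC i) (RAC_Z T GAC) x0 xt (le_trans ty y1).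
  have -> : 2 * m + S / 2 ^+ k.+1 = m + T / 2 by rewrite /T exprS invfM; field; rewrite expf_neq0.
  move=> h; have {}h : normc (Z i t - Z i x) <= 2 * (T * G t - T * G x).
    apply: h => s xs st; apply: Zg => [|j]; first by apply/andP; split; lra.
    by apply: IH; [exact: ltW|exact: le_trans st ty].
  have := nc_dist (Z i t) (Z i x); have := hm i.
  have Gt : G t - G x <= 1 / 4%:R.
    by have := RAC_mono GAC g0 (le_trans x0 xt) ty y1; lra.
  have : T * (G t - G x) <= T * (1 / 4%:R) by rewrite ler_wpM2l.
  move: h; rewrite -mulrBr; lra.
by move=> t xt ty i; apply: (@halving_bound _ S) => k; exact: key.
Qed.

(** Each of the N + 1 cells at most doubles the bound. The power of 2 plays the part of Gronwall's
    exponential. *)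
Lemma mesh_bound (N : nat) m : 
  (forall x y, 0 <= x -> x <= y -> y <= 1 -> y - x <= N.+1%:R^-1 -> G y - G x <= 1 / 4%:R) ->
  (forall i, normc (Z i 0) <= m) -> forall t, 0 <= t <= 1 -> forall i,
    normc (Z i t) <= 2 ^+ N.+1 * m.
Proof.
move=> mesh hm.
have N0 : 0 < N.+1%:R :> R by rewrite ltr0Sn.
have key k : (k <= N.+1)%N -> forall t, 0 <= t -> t <= k%:R / N.+1%:R -> forall i,
    normc (Z i t) <= 2 ^+ k * m.
  elim: k => [|k IH] kN t t0 tk i.
    by move: tk; rewrite mul0r => tk; rewrite expr0 mul1r (_ : t = 0) //; lra.
  have m0 : 0 <= m by exact: le_trans (nc_ge0 _) (hm i).
  have [h|h] := leP t (k%:R / N.+1%:R).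
    apply: le_trans (IH (ltnW kN) t t0 h i) _.
    by rewrite exprS -mulrA ler_peMl ?mulr_ge0 ?exprn_ge0 //; lra.
  have k0 : (0 : R) <= k%:R / N.+1%:R by rewrite divr_ge0 // ltW.
  have t1 : t <= 1.
    by apply: le_trans tk _; rewrite ler_pdivrMr // mul1r ler_nat.
  rewrite exprS -mulrA; apply: (block_bound k0 (ltW h) t1 _ _ (ltW h)) => //.
    apply: mesh => //; first exact: ltW.
    by move: tk; rewrite -natr1 mulrDl mul1r; set a := _^-1; lra.
  by apply: IH => //; exact: ltnW.
move=> t /andP[t0 t1]; apply: key => //; by rewrite divff // gt_eqF.
Qed.
End Family.

(** Induction on n: the primitive of G^n g / n! is the next power over the next factorial, and each
    integration contributes the factor 2 of [AC_le]. *)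
Lemma volterra_bound (I : finType) (D D' : nat -> I -> R -> C) G g S :
  RAC G g -> G 0 = 0 -> (forall t, 0 <= t <= 1 -> 0 <= g t) -> 0 <= S ->
  (forall n i, abscont (D n.+1 i) (D' n.+1 i)) -> (forall n i, D n.+1 i 0 = 0) ->
  (forall n t, 0 <= t <= 1 -> forall T, 0 <= T -> (forall j, normc (D n j t) <= T) ->
     forall i, normc (D' n.+1 i t) <= T * g t) ->
  (forall i t, 0 <= t <= 1 -> normc (D 0%N i t) <= S) ->
  forall n i t, 0 <= t <= 1 -> normc (D n i t) <= S * ((2 * G t) ^+ n / n`!%:R).
Proof.
move=> hG G0 g0 S0 hD D0 hD' h0.
have Gge t : 0 <= t <= 1 -> 0 <= G t.
  by move=> /andP[t0 t1]; rewrite -G0; exact: RAC_mono hG g0 _ _ _.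
elim=> [|n IH] i t ht; first by rewrite expr0 fact0 divr1 mulr1 h0.
have nf : n.+1`!%:R != 0 :> R by rewrite pnatr_eq0 -lt0n fact_gt0.
have nf' : n`!%:R != 0 :> R by rewrite pnatr_eq0 -lt0n fact_gt0.
have n1 : n.+1%:R != 0 :> R by rewrite pnatr_eq0.
have /andP[t0 t1] := ht.
have hv := RAC_Z (S * 2 ^+ n / n.+1`!%:R) (RAC_X n hG).
have := AC_le (hD n i) hv (lexx 0) t0 t1; rewrite D0 subr0 G0 expr0n mulr0 subr0.
move=> h; apply: le_trans (h _) _.
  move=> s s0 st; have hs : 0 <= s <= 1 by apply/andP; split; lra.
  apply: le_trans (hD' n s hs (S * ((2 * G s) ^+ n / n`!%:R)) _ _ i) _.
  - by rewrite mulr_ge0 // divr_ge0 // exprn_ge0 // mulr_ge0 // Gge.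
  - by move=> j; exact: IH.
  rewrite le_eqVlt; apply/orP; left; apply/eqP.
  rewrite factS natrM exprMn; move: nf' n1; move: (n`!%:R) (n.+1%:R) => a b a0 b0.
  by field; rewrite a0 b0.
by rewrite le_eqVlt; apply/orP; left; apply/eqP; rewrite exprMn [2 ^+ n.+1]exprS; field.
Qed.

(** Trades the factorial for a geometric rate, which is easier to sum: the n-th term of the series
    of exp (2a) is at most exp (2a). *)
Lemma pow_fact_le (a : R) n : 0 <= a -> a ^+ n / n`!%:R <= expR (2 * a) / 2 ^+ n.
Proof.
move=> a0; have -> : a ^+ n / n`!%:R = ((2 * a) ^+ n / n`!%:R) / 2 ^+ n.
  by rewrite exprMn; field; rewrite expf_neq0 //= pnatr_eq0 -lt0n fact_gt0.
rewrite ler_wpM2r ?invr_ge0 ?exprn_ge0 //.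
case: n => [|n]; first by rewrite expr0 fact0 divr1; apply: le_trans (expR_ge1Dx _); lra.
have a2 : 0 <= 2 * a by lra.
by apply: le_trans (expR_ge1Dxn n a2); rewrite lerDr.
Qed.

End Gronwall.

(** * Existence of solutions by Picard iteration *)

Section LinearSystem.
Variable R : realType.
Local Notation C := R[i].
Local Open Scope complex_scope.
Local Open Scope classical_set_scope.
Local Notation I01 := (`[(0 : R), 1]%classic).
Variable n : nat.
Implicit Types (B : R -> 'M[C]_n) (Y : R -> 'cV[C]_n) (x t S T : R).

Definition linsol B Y := forall k : 'I_n, abscont (fun t => Y t k 0) (fun t => (B t *m Y t) k 0).

Definition mx_sum (A : 'M[C]_n) : R := \sum_k \sum_j normc (A k j).

Lemma mx_sum_ge0 A : 0 <= mx_sum A.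
Proof. by apply: sumr_ge0 => k _; apply: sumr_ge0 => j _; exact: nc_ge0. Qed.

Lemma mulmx_bound (A : 'M[C]_n) (v : 'cV[C]_n) S : (forall j, normc (v j 0) <= S) ->
  forall k, normc ((A *m v) k 0) <= S * mx_sum A.
Proof.
move=> h k; have S0 : 0 <= S by exact: le_trans (nc_ge0 _) (h k).
rewrite mxE; apply: le_trans (nc_sum _ _ _) _.
apply: le_trans (_ : \sum_j S * normc (A k j) <= _).
  by apply: ler_sum => j _; rewrite normcM mulrC ler_wpM2r ?nc_ge0.
rewrite -mulr_sumr ler_wpM2l // /mx_sum [leRHS](bigD1 k) //= lerDl.
by apply: sumr_ge0 => i _; apply: sumr_ge0 => j _; exact: nc_ge0.
Qed.

Lemma integr_mx_sum B : (forall k j, cintegrable I01 (fun t => B t k j)) ->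
  integr (fun t => mx_sum (B t)).
Proof.
move=> h; rewrite /mx_sum.
have sumI (J : Type) (s : seq J) (F : J -> R -> R) : (forall j, integr (F j)) ->
    integr (fun t => \sum_(j <- s) F j t).
  move=> hF; elim: s => [|j s IH].
    by have -> : (fun t => \sum_(j <- [::]) F j t) = (fun=> 0);
      [apply/funext => t; rewrite big_nil|exact: integr_cst].
  have -> : (fun t => \sum_(i <- j :: s) F i t) = (fun t => F j t + \sum_(i <- s) F i t).
    by apply/funext => t; rewrite big_cons.
  exact: integrD.
by apply: (sumI) => k; apply: (sumI) => j; exact: integr_nc.
Qed.

Lemma cintegrable_mulmx B Y (Y' : 'I_n -> R -> C) : (forall k j, cintegrable I01 (fun t => B t k j)) ->
  (forall k, abscont (fun t => Y t k 0) (Y' k)) ->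
  forall k, cintegrable I01 (fun t => (B t *m Y t) k 0).
Proof.
move=> hB hY k; have -> : (fun t => (B t *m Y t) k 0) = (fun t => \sum_j B t k j * Y t j 0).
  by apply/funext => t; rewrite mxE.
by apply: cintegrable_sum => j; exact: cintegrableM_AC (hB k j) (hY j).
Qed.

Fixpoint picard B (y0 : 'cV[C]_n) (m : nat) : R -> 'cV[C]_n :=
  if m is m'.+1 then fun t => \col_k (y0 k 0 +
    cint `[(0:R), t] (fun s => (B s *m picard B y0 m' s) k 0)) else fun=> y0.

Lemma picard_AC B y0 : (forall k j, cintegrable I01 (fun t => B t k j)) ->
  forall m k, abscont (fun t => picard B y0 m.+1 t k 0) (fun t => (B t *m picard B y0 m t) k 0).
Proof.
move=> hB; have H m : (forall k, exists V, abscont (fun t => picard B y0 m t k 0) V) ->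
    forall k, abscont (fun t => picard B y0 m.+1 t k 0) (fun t => (B t *m picard B y0 m t) k 0).
  move=> /choice[V hV] k.
  apply: (AC_ext (AC_prim (y0 k 0) (cintegrable_mulmx hB hV k))) => // t _.
  by rewrite /= mxE.
elim=> [|m IH]; apply: H => k; last by eexists; exact: IH.
by eexists; exact: AC_cst.
Qed.

Lemma picard0 B y0 m : picard B y0 m 0 = y0.
Proof.
case: m => // m; apply/colP => k; rewrite /= mxE.
by rewrite (_ : cint _ _ = 0) ?addr0 // /cint set_itv1 !Rintegral_set1.
Qed.

Section Fix.
Variable B : R -> 'M[C]_n.
Hypothesis hB : forall k j, cintegrable I01 (fun t => B t k j).
Variables (G g : R -> R).
Hypothesis hG : RAC G g.
Hypothesis G0 : G 0 = 0.
Hypothesis Bg : forall t, 0 <= t <= 1 -> mx_sum (B t) <= g t.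

Let g0 t : 0 <= t <= 1 -> 0 <= g t.
Proof. by move=> /Bg; apply: le_trans; exact: mx_sum_ge0. Qed.

Lemma mulmx_bound_g (v : 'cV[C]_n) S t : 0 <= t <= 1 -> (forall j, normc (v j 0) <= S) ->
  forall k, normc ((B t *m v) k 0) <= S * g t.
Proof.
move=> ht h k; apply: le_trans (mulmx_bound _ h k) _.
by rewrite ler_wpM2l ?Bg //; exact: le_trans (nc_ge0 _) (h k).
Qed.

Lemma picard_approx Y y0 S : linsol B Y -> Y 0 = y0 -> 0 <= S ->
  (forall k t, 0 <= t <= 1 -> normc (Y t k 0 - y0 k 0) <= S) ->
  forall m k t, 0 <= t <= 1 ->
    normc (Y t k 0 - picard B y0 m t k 0) <= S * ((2 * G t) ^+ m / m`!%:R).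
Proof.
move=> hY Y0 S0 hS.
apply: (@volterra_bound R 'I_n (fun m k t => Y t k 0 - picard B y0 m t k 0)
  (fun m k t => (B t *m (Y t - picard B y0 m.-1 t)) k 0) G g S) => //.
- move=> m k; apply: (AC_ext (AC_B (hY k) (picard_AC y0 hB m k))) => // t _.
  by rewrite /= mulmxBr !mxE.
- by move=> m k; rewrite picard0 Y0 subrr.
- move=> m t ht T T0 h k /=; apply: mulmx_bound_g => // j.
  by have := h j; rewrite !mxE.
Qed.

(** The Picard iterates converge uniformly at a geometric rate. Their limit is measurable as a
    pointwise limit, which makes its product with B integrable, and then the integral equation
    passes to the limit. *)
Lemma linsol_exists y0 : exists Y, linsol B Y /\ Y 0 = y0.
Proof.
set P := picard B y0.
have hP := picard_AC y0 hB.
have [S S0 hS] : exists2 S : R, 0 <= S & forall k t, 0 <= t <= 1 ->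
    normc (P 1%N t k 0 - P 0%N t k 0) <= S.
  have [|S S0 hS] := @family_bounded R 'I_n (fun k t => P 1%N t k 0 - P 0%N t k 0)
    (fun k t => (B t *m P 0%N t) k 0 - 0).
    by move=> k; apply: AC_B (hP 0%N k) _; exact: AC_cst.
  by exists S.
have step m k t : 0 <= t <= 1 ->
    normc (P m.+1 t k 0 - P m t k 0) <= S * ((2 * G t) ^+ m / m`!%:R).
  move: m k t; apply: (@volterra_bound R 'I_n (fun m k t => P m.+1 t k 0 - P m t k 0)
    (fun m k t => (B t *m (P m t - P m.-1 t)) k 0) G g S) => //.
  - move=> m k; apply: (AC_ext (AC_B (hP m.+1 k) (hP m k))) => // t _.
    by rewrite /= mulmxBr !mxE.
  - by move=> m k; rewrite /P !picard0 subrr.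
  - move=> m t ht T T0 h k /=; apply: mulmx_bound_g => // j.
    by have := h j; rewrite !mxE.
pose E := S * expR (4%:R * G 1); have E0 : 0 <= E by rewrite mulr_ge0 ?expR_ge0.
have Gm t : 0 <= t <= 1 -> 0 <= G t <= G 1.
  move=> /andP[t0 t1]; have := RAC_mono hG g0 (lexx 0) t0 t1; rewrite G0 => -> /=.
  exact: RAC_mono hG g0 t0 t1 (lexx 1).
have step2 m k t : 0 <= t <= 1 -> normc (P m.+1 t k 0 - P m t k 0) <= E / 2 ^+ m.
  move=> ht; apply: le_trans (step m k t ht) _; rewrite /E -mulrA ler_wpM2l //.
  have /andP[Gt0 Gt1] := Gm t ht.
  have G2 : 0 <= 2 * G t by lra.
  apply: le_trans (pow_fact_le m G2) _; rewrite ler_wpM2r ?invr_ge0 ?exprn_ge0 //.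
  rewrite ler_expR; lra.
have cau k t : 0 <= t <= 1 -> forall m p, (m <= p)%N ->
    normc (P p t k 0 - P m t k 0) <= 2 * E / 2 ^+ m.
  move=> ht m p mp; rewrite -(subnK mp) addnC; move: (p - m)%N => {mp}p.
  have : normc (P (m + p)%N t k 0 - P m t k 0) <= 2 * E / 2 ^+ m - 2 * E / 2 ^+ (m + p).
    elim: p => [|p IH]; first by rewrite addn0 !subrr nc0.
    rewrite addnS -(subrKA (P (m + p)%N t k 0)); apply: le_trans (le_normcD _ _) _.
    have := step2 (m + p)%N k t ht.
    have -> : 2 * E / 2 ^+ (m + p).+1 = E / 2 ^+ (m + p) by rewrite exprS invfM; field; rewrite expf_neq0.
    rewrite (_ : 2 * E / 2 ^+ (m + p) = E / 2 ^+ (m + p) + E / 2 ^+ (m + p)) in IH; last first.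
      by rewrite -mulrDl; congr (_ / _); ring.
    by move: IH; move: (E / 2 ^+ (m + p)) (2 * E / 2 ^+ m) => a b; lra.
  have : 0 <= 2 * E / 2 ^+ (m + p) by rewrite divr_ge0 ?exprn_ge0 ?mulr_ge0.
  lra.
have /choice [L hL] : forall t, exists l : 'I_n -> C, 0 <= t <= 1 -> forall k m,
    normc (P m t k 0 - l k) <= 2 * (2 * E / 2 ^+ m).
  move=> t; have [ht|ht] := boolP (0 <= t <= 1); last by exists (fun=> 0).
  have /choice [l hl] : forall k, exists l : C, forall m, normc (P m t k 0 - l) <= 2 * (2 * E / 2 ^+ m).
    by move=> k; exact: complex_complete (cau k t ht).
  by exists l => _ k m.
pose Y t : 'cV[C]_n := \col_k L t k.
have small e : 0 < e -> exists m, 2 * (2 * E / 2 ^+ m) <= e.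
  move=> e0; exists (Num.truncn (4%:R * E / e)).+1.
  have := truncnS_gt (4%:R * E / e); set N := Num.truncn _; rewrite ltr_pdivrMr // => h.
  rewrite (_ : 2 * (2 * E / 2 ^+ N.+1) = 4%:R * E / 2 ^+ N.+1); last by ring.
  rewrite ler_pdivrMr ?exprn_gt0 //.
  apply: ltW; apply: lt_le_trans h _; rewrite mulrC ler_wpM2l ?(ltW e0) //.
  by rewrite -natrX ler_nat ltnW // ltn_expl.
have [M M0 YM] : exists2 M, 0 <= M & forall t, 0 <= t <= 1 -> forall k, normc (Y t k 0) <= M.
  have [M M0 hM] : exists2 M, 0 <= M & forall k : 'I_n, normc (y0 k 0) <= M.
    exists (\sum_k normc (y0 k 0)) => [|k]; first by apply: sumr_ge0 => k _; exact: nc_ge0.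
    by rewrite (bigD1 k) //= lerDl; apply: sumr_ge0 => j _; exact: nc_ge0.
  exists (M + 4%:R * E) => [|t ht k]; first lra.
  have := hL t ht k 0%N; rewrite expr0 divr1 mxE => h.
  by have := nc_dist (L t k) (y0 k 0); have := hM k; rewrite ncB; move: h; rewrite /P /=; lra.
have mY k : measurable_fun I01 (cRe (fun t => Y t k 0)) /\ measurable_fun I01 (cIm (fun t => Y t k 0)).
  have mP m : measurable_fun I01 (cRe (fun t => P m.+1 t k 0)) /\
              measurable_fun I01 (cIm (fun t => P m.+1 t k 0)) := AC_measurable (hP m k).
  have cv t : 0 <= t <= 1 -> forall e, 0 < e -> exists N, forall m, (N <= m)%N ->
      normc (Y t k 0 - P m.+1 t k 0) <= e.
    move=> ht e e0; have [N hN] := small e e0; exists N => m Nm.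
    rewrite ncB [Y t k 0]mxE; apply: le_trans (hL t ht k m.+1) _; apply: le_trans hN.
    rewrite ler_pM2l // ler_wpM2l ?mulr_ge0 // lef_pV2 ?posrE ?exprn_gt0 //.
    by rewrite ler_weXn2l ?ler1n // ltnW.
  split.
    apply: (measurable_fun_cvg (fun m => (mP m).1)) => t; rewrite /= in_itv /= => ht.
    apply/cvgrPdist_le => e e0; have [N hN] := cv t ht e e0.
    exists N => // m Nm; apply: le_trans (hN m Nm); rewrite /cRe -raddfB; exact: nc_ge_Re.
  apply: (measurable_fun_cvg (fun m => (mP m).2)) => t; rewrite /= in_itv /= => ht.
  apply/cvgrPdist_le => e e0; have [N hN] := cv t ht e e0.
  exists N => // m Nm; apply: le_trans (hN m Nm); rewrite /cIm -raddfB; exact: nc_ge_Im.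
have iBY k : cintegrable I01 (fun t => (B t *m Y t) k 0).
  have -> : (fun t => (B t *m Y t) k 0) = (fun t => \sum_j B t k j * Y t j 0).
    by apply/funext => t; rewrite mxE.
  apply: cintegrable_sum => j; apply: (cintegrableM (M := M)) => //.
  by move=> t ht; exact: YM.
have zz : (0 : R) <= 0 <= (1 : R) by rewrite lexx /= ler01.
have Y0 : Y 0 = y0.
  apply/colP => k; apply/eqP; rewrite -subr_eq0; apply/eqP; apply: nc_small0 => e e0.
  have [m hm] := small e e0; rewrite ncB mxE.
  by have := hL 0 zz k m; rewrite /P picard0 => h; exact: le_trans h hm.
exists Y; split=> // k; split=> // x hx; rewrite Y0.
have hI := AC_prim (y0 k 0) (iBY k).
apply/eqP; rewrite -subr_eq0; apply/eqP; apply: nc_small0 => e e0.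
have G1 : 0 <= G 1 by have /andP[] := Gm 1 (ltac:(by rewrite ler01 lexx)).
have e1 : 0 < e / (2 + 2 * G 1) by rewrite divr_gt0 //; lra.
have [m hm] := small _ e1; set c := 2 * (2 * E / 2 ^+ m) in hm.
have c0 : 0 <= c by rewrite mulr_ge0 // divr_ge0 ?exprn_ge0 ?mulr_ge0.
have /andP[x0 x1] := hx.
have := AC_le (AC_B (hP m k) hI) (RAC_Z c hG) (lexx 0) x0 x1.
pose J x := y0 k 0 + cint `[(0:R), x] (fun t => (B t *m Y t) k 0).
have J0 : J 0 = y0 k 0.
  by rewrite /J (_ : cint _ _ = 0) ?addr0 // /cint set_itv1 !Rintegral_set1.
rewrite -/(J x) -/(J 0) J0 picard0 subrr subr0 G0 mulr0 subr0 => h.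
have {}h : normc (P m.+1 x k 0 - J x) <= 2 * (c * G x).
  apply: h => t t0 tx; have ht : 0 <= t <= 1 by apply/andP; split; lra.
  have -> : (B t *m P m t) k 0 - (B t *m Y t) k 0 = (B t *m (P m t - Y t)) k 0.
    by rewrite mulmxBr !mxE.
  by apply: mulmx_bound_g => // j; rewrite !mxE; exact: hL.
have h2 := hL x hx k m.+1.
have h3 : 2 * (2 * E / 2 ^+ m.+1) <= c.
  by rewrite /c ler_pM2l // ler_wpM2l ?mulr_ge0 // lef_pV2 ?posrE ?exprn_gt0 // ler_weXn2l ?ler1n.
have /andP[Gx0 Gx1] := Gm x hx.
have -> : Y x k 0 - J x = (P m.+1 x k 0 - J x) - (P m.+1 x k 0 - L x k) by rewrite mxE; ring.
apply: le_trans (le_normcD _ _) _; rewrite normcN.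
have : c * (2 + 2 * G 1) <= e by rewrite -ler_pdivlMr //; lra.
have : c * G x <= c * G 1 by rewrite ler_wpM2l.
move: h h2 h3; lra.
Qed.

End Fix.

End LinearSystem.

Lemma cint00 (R : realType) (f : R -> R[i]) : cint `[(0:R), 0]%classic f = 0.
Proof. by rewrite /cint set_itv1 !Rintegral_set1. Qed.

(** * Dependence on the spectral parameter *)

Section SpectralParameter.
Variable R : realType.
Local Notation C := R[i].
Local Open Scope complex_scope.
Local Open Scope classical_set_scope.
Local Notation I01 := (`[(0 : R), 1]%classic).
Variables (n : nat) (F : R -> 'M[C]_n) (E : 'M[C]_n).
Hypothesis hF : forall k j, cintegrable I01 (fun t => F t k j).
Implicit Types (x t S : R) (lam : C).

Let B lam t := F t + lam *: E.

Lemma pencil_integrable lam k j : cintegrable I01 (fun t => B lam t k j).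
Proof.
have -> : (fun t => B lam t k j) = (fun t => F t k j + lam * E k j).
  by apply/funext => t; rewrite /B !mxE.
by apply: cintegrableD (hF k j) _; exact: cintegrable_cst.
Qed.

Lemma mx_sum_pencil lam t : mx_sum (B lam t) <= mx_sum (F t) + normc lam * mx_sum E.
Proof.
rewrite /mx_sum mulr_sumr -big_split /=; apply: ler_sum => k _.
rewrite mulr_sumr -big_split /=; apply: ler_sum => j _.
by rewrite /B !mxE -normcM le_normcD.
Qed.

(** Tailored to the Picard iterates: polynomials in lambda of degree bounded uniformly in t.
    Absolute continuity of the coefficients keeps the class closed under integration against
    integrable functions. *)
Definition poly_coef (f : C -> R -> C) := exists (m : nat) (p : R -> {poly C}),
  [/\ forall t, (size (p t) <= m)%N, forall i, exists c', abscont (fun t => (p t)`_i) c' &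
      forall lam t, 0 <= t <= 1 -> f lam t = (p t).[lam]].

Lemma poly_coef_ext f g : (forall lam t, 0 <= t <= 1 -> f lam t = g lam t) ->
  poly_coef f -> poly_coef g.
Proof. by move=> fg [m [p [s a h]]]; exists m, p; split=> // lam t ht; rewrite -fg ?h. Qed.

Lemma poly_coef_cst c : poly_coef (fun _ _ => c).
Proof.
exists 1%N, (fun=> c%:P); split=> [t|i|lam t _]; rewrite ?size_polyC_leq1 ?hornerC //.
by exists (fun=> 0); exact: AC_cst.
Qed.

Lemma poly_coefD f g : poly_coef f -> poly_coef g -> poly_coef (fun lam t => f lam t + g lam t).
Proof.
move=> [m [p [ps pa ph]]] [l [q [qs qa qh]]]; exists (maxn m l), (fun t => p t + q t); split.
- move=> t; apply: leq_trans (size_polyD _ _) _.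
  by rewrite geq_max !leq_max ps qs orbT.
- move=> i; have [c hc] := pa i; have [d hd] := qa i; eexists.
  by apply: (AC_ext (AC_D hc hd)) => t _; [rewrite coefD|].
- by move=> lam t ht; rewrite hornerD ph ?qh.
Qed.

Lemma poly_coef_sum (I : Type) (s : seq I) (f : I -> C -> R -> C) :
  (forall i, poly_coef (f i)) -> poly_coef (fun lam t => \sum_(i <- s) f i lam t).
Proof.
move=> h; elim: s => [|i s IH].
  by apply: (poly_coef_ext _ (poly_coef_cst 0)) => lam t _; rewrite big_nil.
by apply: (poly_coef_ext _ (poly_coefD (h i) IH)) => lam t _; rewrite big_cons.
Qed.

Lemma poly_coef_lam f : poly_coef f -> poly_coef (fun lam t => lam * f lam t).
Proof.
move=> [m [p [ps pa ph]]]; exists m.+1, (fun t => p t * 'X); split.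
- move=> t; apply: leq_trans (size_polyMleq _ _) _.
  by rewrite size_polyX addn2 /= ltnS.
- move=> [|i]; last first.
    have [c hc] := pa i; exists c; apply: (AC_ext hc) => t _ //.
    by rewrite coefMX.
  exists (fun=> 0); apply: (AC_ext (AC_cst 0)) => t _ //.
  by rewrite coefMX.
- by move=> lam t ht; rewrite hornerMX ph // mulrC.
Qed.

Lemma poly_coef_AC f lam : poly_coef f -> exists f', abscont (f lam) f'.
Proof.
move=> [m [p [ps /choice[c hc] ph]]]; eexists.
apply: (AC_ext (AC_sum (index_enum 'I_m) (fun i : 'I_m => AC_Z (lam ^+ i) (hc i)))) => t ht //.
rewrite ph // (horner_coef_wide _ (ps t)); apply: eq_bigr => i _; exact: mulrC.
Qed.

Lemma poly_coef_int (a : R -> C) f : cintegrable I01 a -> poly_coef f ->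
  poly_coef (fun lam t => cint `[(0:R), t] (fun s => a s * f lam s)).
Proof.
move=> ha hf; have [m [p [ps pa ph]]] := hf.
have ia i : cintegrable I01 (fun s => a s * (p s)`_i).
  by have [c hc] := pa i; exact: cintegrableM_AC ha hc.
exists m, (fun t => \poly_(i < m) cint `[(0:R), t] (fun s => a s * (p s)`_i)); split.
- by move=> t; exact: size_poly.
- move=> i; have [im|im] := ltnP i m.
    eexists; apply: (AC_ext (AC_prim 0 (ia i))) => t _ //.
    by rewrite coef_poly im add0r.
  by exists (fun=> 0); apply: (AC_ext (AC_cst 0)) => t _ //; rewrite coef_poly ltnNge im.
- move=> lam t ht; have [f' hf'] := poly_coef_AC lam hf.
  have h1 := AC_prim 0 (cintegrableM_AC ha hf').
  have h2 := AC_sum (index_enum 'I_m) (fun i : 'I_m => AC_Z (lam ^+ i) (AC_prim 0 (ia i))).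
  have h3 : abscont (fun x => 0 + cint `[(0:R), x] (fun s => a s * f lam s))
    (fun s => \sum_(i <- index_enum 'I_m) lam ^+ i * (a s * (p s)`_i)).
    apply: (AC_ext h1) => s hs //; rewrite ph // (horner_coef_wide _ (ps s)) mulr_sumr.
    by apply: eq_bigr => i _; ring.
  rewrite horner_poly -[LHS]add0r h3.2 // cint00 addr0.
  have := h2.2 t ht; set S := cint _ _.
  rewrite [X in _ = X + _]big1 => [<-|i _]; last by rewrite cint00 addr0 mulr0.
  by apply: eq_bigr => i _; rewrite add0r mulrC.
Qed.

Lemma picard_poly_coef y0 m k : poly_coef (fun lam t => picard (B lam) y0 m t k 0).
Proof.
elim: m k => [|m IH] k; first exact: poly_coef_cst.
apply: (@poly_coef_ext (fun lam t => y0 k 0 +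
  (\sum_j cint `[(0:R), t] (fun s => F s k j * picard (B lam) y0 m s j 0) +
   lam * \sum_j cint `[(0:R), t] (fun s => E k j * picard (B lam) y0 m s j 0)))).
  move=> lam t ht; rewrite /= mxE; congr (_ + _).
  have hP j := poly_coef_AC lam (IH j).
  have iF j : cintegrable I01 (fun s => F s k j * picard (B lam) y0 m s j 0).
    by have [c hc] := hP j; exact: cintegrableM_AC (hF k j) hc.
  have iE j : cintegrable I01 (fun s => E k j * picard (B lam) y0 m s j 0).
    by have [c hc] := hP j; exact: cintegrableM_AC (cintegrable_cst _) hc.
  have h1 := AC_sum (index_enum 'I_n) (fun j : 'I_n => AC_prim 0 (iF j)).
  have h2 := AC_Z lam (AC_sum (index_enum 'I_n) (fun j : 'I_n => AC_prim 0 (iE j))).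
  have /choice[V hV] := hP.
  have h3 := AC_prim 0 (cintegrable_mulmx (pencil_integrable lam) hV k).
  have h4 : abscont (fun x => (\sum_(j <- index_enum 'I_n) (0 +
        cint `[(0:R), x] (fun s => F s k j * picard (B lam) y0 m s j 0))) +
      lam * (\sum_(j <- index_enum 'I_n) (0 +
        cint `[(0:R), x] (fun s => E k j * picard (B lam) y0 m s j 0))))
      (fun s => (B lam s *m picard (B lam) y0 m s) k 0).
    apply: (AC_ext (AC_D h1 h2)) => s _ //.
    rewrite mxE mulr_sumr -big_split; apply: eq_bigr => j _ /=.
    by rewrite /B !mxE; ring.
  have z0 (a : 'I_n -> R -> C) : \sum_(j <- index_enum 'I_n) (0 + cint `[(0:R), 0] (a j)) = 0.
    by rewrite big1 // => j _; rewrite cint00 addr0.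
  have := h4.2 t ht; rewrite [X in _ = X + _](_ : _ = 0); last by rewrite (z0 _) (z0 _) mulr0 addr0.
  rewrite add0r => <-.
  by congr (_ + lam * _); apply: eq_bigr => j _; rewrite add0r.
apply: poly_coefD; first exact: poly_coef_cst.
apply: poly_coefD; last apply: poly_coef_lam.
  by apply: poly_coef_sum => j; apply: poly_coef_int.
by apply: poly_coef_sum => j; apply: poly_coef_int => //; exact: cintegrable_cst.
Qed.

(** For |lambda| <= r a single primitive G serves all lambda at once, so the Picard iterates, which
    are polynomials in lambda, converge uniformly on that disc. *)
Lemma linsol_entire (Y : C -> R -> 'cV[C]_n) y0 : (forall lam, linsol (B lam) (Y lam)) ->
  (forall lam, Y lam 0 = y0) -> forall t, 0 <= t <= 1 -> forall k, entire (fun lam => Y lam t k 0).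
Proof.
move=> hY hY0 t ht k r.
have E0 := mx_sum_ge0 E; have r0 := normr_ge0 r.
have c0 : 0 <= `|r| * mx_sum E by rewrite mulr_ge0.
have hg : integr (fun t => mx_sum (F t) + `|r| * mx_sum E).
  by apply: integrD (integr_mx_sum hF) _; exact: integr_cst.
have hG := RAC_prim hg; set G := (X in RAC X _) in hG; set g := (X in RAC _ X) in hG.
have G0 : G 0 = 0 by rewrite /G set_itv1 Rintegral_set1.
have g0 s : 0 <= s <= 1 -> 0 <= g s by move=> _; rewrite addr_ge0 ?mx_sum_ge0.
have Bg lam : normc lam <= r -> forall s, 0 <= s <= 1 -> mx_sum (B lam s) <= g s.
  move=> lr s _; apply: le_trans (mx_sum_pencil lam s) _; rewrite lerD2l.
  by apply: ler_wpM2r => //; apply: le_trans lr (ler_norm r).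
have [N hN] := RAC_unif hG (ltac:(by rewrite divr_gt0) : (0 : R) < 1 / 4%:R).
have [M M0 hM] : exists2 M : R, 0 <= M & forall j, normc (y0 j 0) <= M.
  exists (\sum_j normc (y0 j 0)) => [|j]; first by apply: sumr_ge0 => j _; exact: nc_ge0.
  by rewrite (bigD1 j) //= lerDl; apply: sumr_ge0 => i _; exact: nc_ge0.
have bd lam : normc lam <= r -> forall s, 0 <= s <= 1 -> forall j,
    normc (Y lam s j 0) <= 2 ^+ N.+1 * M.
  move=> lr; apply: (@mesh_bound R 'I_n (fun j s => Y lam s j 0)
    (fun j s => (B lam s *m Y lam s) j 0) G g) => //.
  - by move=> j; exact: hY.
  - move=> s hs S hS j; exact: (mulmx_bound_g (Bg lam lr) hs).
  - move=> x y x0 xy y1 d; apply: le_trans (ler_norm _) _; apply: hN.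
    + by apply/andP; split; lra.
    + by apply/andP; split; lra.
    + by rewrite ger0_norm // subr_ge0.
  - by move=> j; rewrite hY0.
have /andP[t0 t1] := ht.
have Gt : 0 <= 2 * G t by rewrite mulr_ge0 // -G0; exact: RAC_mono hG g0 _ _ _.
set S := 2 ^+ N.+1 * M + M.
have S0 : 0 <= S by rewrite addr_ge0 // mulr_ge0 // exprn_ge0.
move=> e e0.
pose q := S * expR (2 * (2 * G t)) / e.
have [m [p [ps pa ph]]] := picard_poly_coef y0 (Num.truncn q).+1 k.
exists (p t) => lam lr; rewrite -ph //.
have := picard_approx (pencil_integrable lam) hG G0 (Bg lam lr) (hY lam) (hY0 lam) S0.
move=> /(_ _ (Num.truncn q).+1 k t ht) h; apply: le_trans (h _) _.
  move=> j s hs; apply: le_trans (le_normcD _ _) _; rewrite normcN.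
  by apply: lerD; [exact: bd|exact: hM].
apply: le_trans (ler_wpM2l S0 (pow_fact_le _ Gt)) _.
rewrite mulrA ler_pdivrMr ?exprn_gt0 //.
have := truncnS_gt q; rewrite {1}/q ltr_pdivrMr // => /ltW /le_trans; apply.
rewrite mulrC ler_wpM2l ?(ltW e0) //.
by rewrite -natrX ler_nat ltnW // ltn_expl.
Qed.

End SpectralParameter.

(** * Growth of order 1/4 of the solutions *)

Section Growth.
Variable R : realType.
Local Notation C := R[i].
Local Open Scope complex_scope.
Local Open Scope classical_set_scope.
Local Notation I01 := (`[(0 : R), 1]%classic).
Variable F : R -> 'M[C]_4.
Hypothesis hF : forall k j, cintegrable I01 (fun t => F t k j).
Hypothesis F_hess : forall t (k j : 'I_4), (k.+1 < j)%N -> F t k j = 0.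
Hypothesis F_super : forall t (k j : 'I_4), j = k.+1 :> nat -> F t k j = 1.

(** Weighting component k by q^(3 - k) turns the ones above the diagonal and the entry lambda into
    entries of size q and does not enlarge those of F. This is the origin of the order 1/4. *)
Lemma Amat_scaled (q : R) lam t (i j : 'I_4) : 1 <= q -> normc lam <= q ^+ 4 ->
  normc (Amat F lam t i j) * q ^+ (3 - i) <= q ^+ (3 - j) * (normc (F t i j) + q).
Proof.
move=> q1 lq; have q0 : 0 <= q by lra.
have Fij := nc_ge0 (F t i j).
have pq m : 0 <= q ^+ m by rewrite exprn_ge0.
have -> : Amat F lam t i j = F t i j + lam * ((i == 3 :> nat) && (j == 0 :> nat))%:R.
  by rewrite /Amat !mxE -!val_eqE /= !inordK.
have mono (a b : nat) : (a <= b)%N -> q ^+ a <= q ^+ b by exact: ler_weXn2l.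
have [/andP[/eqP i3 /eqP j0]|nij] := boolP ((i == 3 :> nat) && (j == 0 :> nat)).
  rewrite mulr1 i3 j0 expr0 mulr1 subn0; apply: le_trans (le_normcD _ _) _.
  rewrite mulrDr -exprSr lerD // ler_peMl //; have := mono 0%N 3%N isT; by rewrite expr0.
rewrite mulr0 addr0; have [ij|ij] := leqP j i.
  rewrite mulrC; apply: ler_pM => //; last lra.
  by apply: mono; rewrite leq_sub2l.
have [ji|ji] := eqVneq (j : nat) i.+1.
  rewrite F_super // nc1 mul1r ji -[X in X <= _]mul1r.
  have -> : (3 - i = (3 - i.+1).+1)%N by have := ltn_ord j; rewrite ji; lia.
  rewrite exprSr mul1r ler_wpM2l //; lra.
rewrite F_hess ?nc0 ?mul0r ?mulr_ge0 ?addr_ge0 //.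
by rewrite ltn_neqAle eq_sym ji.
Qed.

Lemma pow2_le_expR m : 2 ^+ m <= expR (m%:R : R).
Proof.
rewrite -[m%:R]mulr1 expRM_natl; apply: lerXn2r; rewrite ?nnegrE ?expR_ge0 //.
by apply: le_trans (expR_ge1Dx 1); lra.
Qed.

Lemma linsol_growth : exists2 A : R, 0 < A & forall (q : R) lam (Y : R -> 'cV[C]_4), 1 <= q ->
  normc lam <= q ^+ 4 -> linsol (Amat F lam) Y -> (forall k, normc (Y 0 k 0) <= 1) ->
  forall t k, 0 <= t <= 1 -> normc (Y t k 0) <= A * expR (A * q).
Proof.
have hG := RAC_prim (integr_mx_sum hF); set G := (X in RAC X _) in hG.
have [N0 hN0] := RAC_unif hG (ltac:(by rewrite divr_gt0) : (0 : R) < 1 / 8%:R).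
have P0 : 1 <= 2 ^+ N0.+2 :> R by rewrite exprn_ege1 // ler1n.
exists (2 ^+ N0.+2 * 39%:R); first by rewrite mulr_gt0 ?exprn_gt0 // ltr0n.
move=> q lam Y q1 lq hY h0 t k ht.
have q0 : 0 <= q by lra.
pose W (k : 'I_4) (t : R) := (q ^+ (3 - k))%:C * Y t k 0.
(* About 32 q additional cells make both parts G and 4 q t of the primitive vary by at most 1/8 per
   cell. The number of cells, and with it the exponent, is linear in q. *)
pose N := (N0 + Num.truncn (32%:R * q))%N.
have qn m : normc (q ^+ m)%:C = q ^+ m :> R by rewrite nc_real ger0_norm ?exprn_ge0.
have hGq := RAC_D hG (RAC_Z (4%:R * q) (RAC_id R)).
have hb : forall t, 0 <= t <= 1 -> forall i, normc (W i t) <= 2 ^+ N.+1 * q ^+ 3.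
  refine (@mesh_bound R 'I_4 W _ _ _ (fun i => AC_Z (q ^+ (3 - i))%:C (hY i)) hGq _ _ N (q ^+ 3) _ _).
  - by move=> s _; rewrite mulr1 addr_ge0 ?mx_sum_ge0 // mulr_ge0.
  - move=> s hs S hS i; rewrite normcM qn mxE mulrC.
    have S0 : 0 <= S by exact: le_trans (nc_ge0 _) (hS i).
    apply: le_trans (ler_wpM2r (exprn_ge0 _ q0) (nc_sum _ _ _)) _; rewrite mulr_suml.
    apply: le_trans (_ : \sum_(j < 4) S * (normc (F s i j) + q) <= _).
      apply: ler_sum => j _; rewrite normcM mulrAC.
      apply: le_trans (ler_wpM2r (nc_ge0 _) (Amat_scaled s i j q1 lq)) _.
      rewrite mulrAC; apply: ler_wpM2r; first by rewrite addr_ge0 ?nc_ge0.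
      by apply: le_trans (hS j); rewrite /W normcM qn.
    rewrite -mulr_sumr ler_wpM2l // big_split /= lerD //; last first.
      by rewrite sumr_const card_ord mulr1 mulr_natl.
    rewrite /mx_sum [leRHS](bigD1 i) //= lerDl.
    by apply: sumr_ge0 => a _; apply: sumr_ge0 => b _; exact: nc_ge0.
  - move=> x y x0 xy y1 d; rewrite /idfun.
    have h1 : G y - G x <= 1 / 8%:R.
      apply: le_trans (ler_norm _) _; apply: hN0; [by apply/andP; split; lra..|].
      rewrite ger0_norm ?subr_ge0 //; apply: le_trans d _.
      by rewrite lef_pV2 ?posrE ?ltr0Sn // ler_nat ltnS leq_addr.
    have h2 : 32%:R * q <= N.+1%:R.
      apply: ltW; apply: lt_le_trans (truncnS_gt _) _; rewrite ler_nat ltnS; exact: leq_addl.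
    have h3 : (y - x) * N.+1%:R <= 1 by rewrite -ler_pdivlMr ?ltr0Sn // mul1r.
    have h4 : 32%:R * q * (y - x) <= 1.
      by apply: le_trans h3; rewrite mulrC ler_wpM2l // subr_ge0.
    have -> : G y + 4%:R * q * y - (G x + 4%:R * q * x) = (G y - G x) + (32%:R * q * (y - x)) / 8%:R.
      by field.
    by move: h4; set u := 32%:R * q * (y - x) => h4; lra.
  - move=> i; rewrite /W normcM qn -[leRHS]mulr1; apply: ler_pM; rewrite ?nc_ge0 ?exprn_ge0 //.
    by apply: ler_weXn2l => //; exact: leq_subr.
have : normc (Y t k 0) <= normc (W k t).
  rewrite /W normcM qn -[leLHS]mul1r ler_wpM2r ?nc_ge0 //.
  by have := @ler_weXn2l _ q q1 0%N (3 - k)%N isT; rewrite expr0.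
move=> /le_trans; apply; apply: le_trans (hb t ht k) _.
apply: le_trans (_ : 2 ^+ N0.+2 * expR (32%:R * q) * expR q ^+ 3 <= _).
  apply: ler_pM; rewrite ?exprn_ge0 //; last first.
    by apply: lerXn2r; rewrite ?nnegrE ?expR_ge0 //; exact: expR_ge.
  rewrite /N -addSn exprD; apply: ler_pM; rewrite ?exprn_ge0 //.
    by apply: ler_weXn2l; rewrite ?ler1n.
  apply: le_trans (pow2_le_expR _) _.
  rewrite ler_expR truncn_le //; lra.
rewrite -expRM_natl -mulrA -expRD; apply: ler_pM; rewrite ?exprn_ge0 ?expR_ge0 //.
  by rewrite ler_peMr ?exprn_ge0 // ler1n.
rewrite ler_expR -mulrDl ler_wpM2r //.
by move: P0; set P := 2 ^+ _ => P0; lra.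
Qed.
End Growth.

(** * Modes on the ray lambda = -4 q^4 *)

Local Notation i0 := (@Ordinal 4 0 isT).
Local Notation i1 := (@Ordinal 4 1 isT).
Local Notation i2 := (@Ordinal 4 2 isT).
Local Notation i3 := (@Ordinal 4 3 isT).

Lemma sum_I4 (V : nmodType) (f : 'I_4 -> V) : \sum_k f k = f i0 + f i1 + f i2 + f i3.
Proof.
rewrite !big_ord_recl big_ord0 addr0 !addrA.
by congr (f _ + f _ + f _ + f _); exact: val_inj.
Qed.

Lemma I4_cases (P : 'I_4 -> Prop) : P i0 -> P i1 -> P i2 -> P i3 -> forall k, P k.
Proof.
move=> h0 h1 h2 h3 [[|[|[|[|k]]]] hk] //.
- by rewrite (_ : Ordinal hk = i0) //; exact: val_inj.
- by rewrite (_ : Ordinal hk = i1) //; exact: val_inj.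
- by rewrite (_ : Ordinal hk = i2) //; exact: val_inj.
- by rewrite (_ : Ordinal hk = i3) //; exact: val_inj.
Qed.

Lemma inord4 : [/\ inord 0 = i0, inord 1 = i1, inord 2 = i2 & inord 3 = i3].
Proof. by split; apply: val_inj; rewrite /= inordK. Qed.

Section Modes.
Variable R : realType.
Local Notation C := R[i].
Local Open Scope complex_scope.
Implicit Types (q S : R) (o b : bool) (v w : 'cV[C]_4).

Definition sg o : R := if o then 1 else -1.

(* Powers of the root mu = +-1 +- i of mu ^ 4 = -4. *)
Definition rt1 o b : C := sg o +i* sg b.
Definition rt2 o b : C := 0 +i* (2 * sg o * sg b).
Definition rt3 o b : C := (- 2 * sg o) +i* (2 * sg b).

(** The pairing with the left eigenvector ((mu q)^3, (mu q)^2, mu q, 1) of the leading part: if v_k'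
    = v_(k+1) and v_3' = (mu q)^4 v_0, this amplitude X satisfies X' = mu q X. The flag [o] tells
    growth from decay as t increases, [b] is the sign of the imaginary part of mu. *)
Definition mode q o b v : C :=
  rt3 o b * q%:C ^+ 3 * v i0 0 + rt2 o b * q%:C ^+ 2 * v i1 0 + rt1 o b * q%:C * v i2 0 + v i3 0.

(** The two roots with equal real part share one rate, so they need not be told apart. *)
Definition modes q o v : R := Num.max (normc (mode q o true v)) (normc (mode q o false v)).

Lemma rt11 o b : rt1 o b * rt1 o b = rt2 o b.
Proof.
by case: o b => [] []; apply/eqP; rewrite eq_complex /=; apply/andP; split; apply/eqP;
  rewrite /sg; ring.
Qed.

Lemma rt12 o b : rt1 o b * rt2 o b = rt3 o b.
Proof.
by case: o b => [] []; apply/eqP; rewrite eq_complex /=; apply/andP; split; apply/eqP;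
  rewrite /sg; ring.
Qed.

Lemma rt13 o b : rt1 o b * rt3 o b = - 4%:R%:C.
Proof.
by case: o b => [] []; apply/eqP; rewrite eq_complex /=; apply/andP; split; apply/eqP;
  rewrite /sg; ring.
Qed.

Lemma rt1E o b : rt1 o b = (sg o)%:C + (sg b)%:C * 'i.
Proof. by apply/eqP; rewrite eq_complex /=; apply/andP; split; apply/eqP; ring. Qed.

Lemma rt2E o b : rt2 o b = 2%:R * (sg o)%:C * (sg b)%:C * 'i.
Proof. by apply/eqP; rewrite eq_complex /=; apply/andP; split; apply/eqP; ring. Qed.

Lemma rt3E o b : rt3 o b = - 2%:R * (sg o)%:C + 2%:R * (sg b)%:C * 'i.
Proof. by apply/eqP; rewrite eq_complex /=; apply/andP; split; apply/eqP; ring. Qed.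

Lemma nc_rt o b : [/\ normc (rt1 o b) <= 2, normc (rt2 o b) <= 2 & normc (rt3 o b) <= 4%:R].
Proof.
by split; apply: le_trans (nc_le _) _; rewrite /= /sg; case: o b => [] [];
  rewrite ?normr0 ?normrN ?normrM ?normrN ?normr1 ?normr_nat; lra.
Qed.

Lemma mode_le q o b v : normc (mode q o b v) <= modes q o v.
Proof. by rewrite /modes le_max; case: b; rewrite lexx ?orbT. Qed.

Lemma modes_le q o v S : (forall b, normc (mode q o b v) <= S) -> modes q o v <= S.
Proof. by move=> h; rewrite ge_max !h. Qed.

Lemma modes_ge0 q o v : 0 <= modes q o v.
Proof. exact: le_trans (nc_ge0 _) (mode_le q o true v). Qed.

Lemma modes_mode q o v : exists b, modes q o v = normc (mode q o b v).
Proof.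
by rewrite /modes; case: (leP (normc (mode q o true v)) (normc (mode q o false v))) => _;
  [exists false|exists true].
Qed.

Lemma modeD q o b v w : mode q o b (v + w) = mode q o b v + mode q o b w.
Proof. by rewrite /mode !mxE; ring. Qed.

Lemma modesD q o v w : modes q o (v + w) <= modes q o v + modes q o w.
Proof.
apply: modes_le => b; rewrite modeD; apply: le_trans (le_normcD _ _) _.
by apply: lerD; exact: mode_le.
Qed.

Lemma modesN q o v : modes q o (- v) = modes q o v.
Proof.
have h b : normc (mode q o b (- v)) = normc (mode q o b v).
  by rewrite -normcN; congr normc; rewrite /mode !mxE; ring.
by rewrite /modes !h.
Qed.

Lemma modes_upper q o v : 0 <= q -> modes q o v <=
  4%:R * (q ^+ 3 * normc (v i0 0) + q ^+ 2 * normc (v i1 0) + q * normc (v i2 0) + normc (v i3 0)).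
Proof.
move=> q0; apply: modes_le => b; have [h1 h2 h3] := nc_rt o b.
have nq : normc (q%:C) = q by rewrite nc_real ger0_norm.
have st (r z : C) (c : R) m : normc r <= c -> c <= 4%:R ->
    normc (r * q%:C ^+ m * z) <= 4%:R * (q ^+ m * normc z).
  move=> rc c4; rewrite !normcM ncX nq -mulrA ler_wpM2r ?mulr_ge0 ?exprn_ge0 ?nc_ge0 //.
  exact: le_trans rc c4.
rewrite /mode !mulrDr.
apply: le_trans (le_normcD _ _) (lerD (le_trans (le_normcD _ _)
  (lerD (le_trans (le_normcD _ _) (lerD _ _)) _)) _).
- by apply: st h3 _.
- by apply: st h2 _; lra.
- by apply: (st _ _ 2 1%N); lra.
- by have := nc_ge0 (v i3 0); lra.
Qed.

(** Inversion of a discrete Fourier transform: the weighted coordinates are recovered from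
    combinations of the four modes with coefficients 1 and -1. *)
Lemma modes_lower q v : 0 <= q -> forall k : 'I_4,
  q ^+ (3 - k) * normc (v k 0) <= (modes q true v + modes q false v) / 2.
Proof.
move=> q0.
have nq m : normc (q%:C ^+ m) = q ^+ m by rewrite ncX nc_real ger0_norm.
set Z0 := q%:C ^+ 3 * v i0 0; set Z1 := q%:C ^+ 2 * v i1 0; set Z2 := q%:C ^+ 1 * v i2 0.
have XE o b : mode q o b v = (- 2%:R * (sg o)%:C + 2%:R * (sg b)%:C * 'i) * Z0 +
   (2%:R * (sg o)%:C * (sg b)%:C * 'i) * Z1 + ((sg o)%:C + (sg b)%:C * 'i) * Z2 + v i3 0.
  by rewrite /mode rt1E rt2E rt3E /Z0 /Z1 /Z2; ring.
have sgE : (sg true)%:C = 1 :> C /\ (sg false)%:C = - 1 :> C by rewrite /sg rmorphN rmorph1.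
case: sgE => s1 s2.
have st (a b c d : C) (z : C) : normc a = 1 -> normc b = 1 -> normc c = 1 -> normc d = 1 ->
    z = a * mode q true true v + b * mode q true false v + c * mode q false true v +
        d * mode q false false v ->
    normc z <= 2 * (modes q true v + modes q false v).
  move=> ha hb hc hd ->; apply: le_trans (le_normcD _ _) _.
  apply: le_trans (lerD (le_normcD _ _) (lexx _)) _.
  apply: le_trans (lerD (lerD (le_normcD _ _) (lexx _)) (lexx _)) _.
  rewrite !normcM ha hb hc hd !mul1r.
  have := mode_le q true true v; have := mode_le q true false v.
  have := mode_le q false true v; have := mode_le q false false v; lra.
have n1 := nc1 R; have nN : normc (-1 : C) = 1 by rewrite normcN nc1.
have hi := nc_i R.
have h3 := st 1 1 1 1 (4%:R * v i3 0) n1 n1 n1 n1 ltac:(by rewrite !XE s1 s2; ring).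
have h1 := st 1 (-1) (-1) 1 (8%:R * ('i * Z1)) n1 nN nN n1 ltac:(by rewrite !XE s1 s2; ring).
have ha := st 1 1 (-1) (-1) (- (8%:R * Z0) + 4%:R * Z2) n1 n1 nN nN ltac:(by rewrite !XE s1 s2; ring).
have hb := st 1 (-1) 1 (-1) ('i * (8%:R * Z0 + 4%:R * Z2)) n1 nN n1 nN ltac:(by rewrite !XE s1 s2; ring).
set M := modes q true v + _ in h1 h3 ha hb *.
rewrite normcM hi mul1r in hb; rewrite normcM nc_nat in h3.
rewrite normcM nc_nat normcM hi mul1r in h1.
have hz0 : 16%:R * normc Z0 <= 4%:R * M.
  have : normc (16%:R * Z0) <= 4%:R * M.
    have -> : 16%:R * Z0 = (8%:R * Z0 + 4%:R * Z2) - (- (8%:R * Z0) + 4%:R * Z2) by ring.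
    by apply: le_trans (le_normcD _ _) _; rewrite normcN; lra.
  by rewrite normcM nc_nat.
have hz2 : 8%:R * normc Z2 <= 4%:R * M.
  have : normc (8%:R * Z2) <= 4%:R * M.
    have -> : 8%:R * Z2 = (8%:R * Z0 + 4%:R * Z2) + (- (8%:R * Z0) + 4%:R * Z2) by ring.
    by apply: le_trans (le_normcD _ _) _; lra.
  by rewrite normcM nc_nat.
have M0 : 0 <= M by rewrite addr_ge0 ?modes_ge0.
apply: I4_cases; rewrite /= ?subnn ?expr0 ?mul1r -?(nq 3%N) -?(nq 2%N) -?(nq 1%N) -?normcM -/Z0 -/Z1 -/Z2; lra.
Qed.

Section Derivative.
Variable F : R -> 'M[C]_4.
Hypothesis F_hess : forall t (k j : 'I_4), (k.+1 < j)%N -> F t k j = 0.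
Hypothesis F_super : forall t (k j : 'I_4), j = k.+1 :> nat -> F t k j = 1.

Definition ray q : C := (- (4%:R * q ^+ 4))%:C.

(** The leading part acts on the mode as multiplication by mu q. What remains is the part [L] of F
    on and below the diagonal, which in the weights q^(3 - k) is bounded uniformly in q. *)
Lemma mode_Amat q o b t v S : 1 <= q -> (forall o, modes q o v <= S) ->
  normc (mode q o b (Amat F (ray q) t *m v) - rt1 o b * q%:C * mode q o b v)
    <= S * (4%:R * mx_sum (F t)).
Proof.
move=> q1 hS; have q0 : 0 <= q by lra.
have S0 : 0 <= S by exact: le_trans (modes_ge0 _ _ _) (hS true).
pose L : 'M[C]_4 := \matrix_(k, j) (if (j <= k)%N then F t k j else 0).
have hA (k : 'I_4) : (Amat F (ray q) t *m v) k 0 = (L *m v) k 0 +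
    (if k == i3 then ray q * v i0 0 else v (inord k.+1) 0).
  have H : forall k j : 'I_4, Amat F (ray q) t k j = L k j +
      (if (k == i3) then ray q * (j == i0)%:R else (j == k.+1 :> nat)%:R).
    move=> k' j; rewrite !mxE -!val_eqE /= !inordK //.
    have [jk|jk] := leqP j k'.
      have -> : (j == k'.+1 :> nat) = false by apply/eqP; lia.
      by case: eqP => //= _; rewrite mulr0.
    have -> : (k' == 3 :> nat) = false by apply/eqP => e; have := ltn_ord j; lia.
    rewrite mulr0 addr0 add0r; case: eqP => [e|ne]; first by rewrite F_super.
    by rewrite F_hess //; lia.
  rewrite !mxE !sum_I4 !H; move: k; apply: I4_cases => /=.
  - by rewrite (_ : inord 1 = i1); [ring|apply: val_inj; rewrite /= inordK].
  - by rewrite (_ : inord 2 = i2); [ring|apply: val_inj; rewrite /= inordK].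
  - by rewrite (_ : inord 3 = i3); [ring|apply: val_inj; rewrite /= inordK].
  - by ring.
have -> : mode q o b (Amat F (ray q) t *m v) - rt1 o b * q%:C * mode q o b v = mode q o b (L *m v).
  have [_ n1 n2 n3] := inord4; rewrite /mode !hA /= n1 n2 n3.
  rewrite !mulrDr.
  have -> : rt1 o b * q%:C * (rt3 o b * q%:C ^+ 3 * v i0 0) = (rt1 o b * rt3 o b) * q%:C ^+ 4 * v i0 0 by ring.
  have -> : rt1 o b * q%:C * (rt2 o b * q%:C ^+ 2 * v i1 0) = (rt1 o b * rt2 o b) * q%:C ^+ 3 * v i1 0 by ring.
  have -> : rt1 o b * q%:C * (rt1 o b * q%:C * v i2 0) = (rt1 o b * rt1 o b) * q%:C ^+ 2 * v i2 0 by ring.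
  rewrite rt11 rt12 rt13 /ray rmorphN rmorphM rmorphXn /=; ring.
apply: le_trans (mode_le q o b (L *m v)) _.
apply: le_trans (modes_upper _ _ q0) _.
rewrite mulrCA ler_wpM2l //.
have row (k : 'I_4) : q ^+ (3 - k) * normc ((L *m v) k 0) <= S * \sum_j normc (F t k j).
  rewrite mxE mulrC; apply: le_trans (ler_wpM2r (exprn_ge0 _ q0) (nc_sum _ _ _)) _.
  rewrite mulr_suml mulr_sumr; apply: ler_sum => j _; rewrite mxE normcM.
  case: ifP => jk; last by rewrite nc0 !mul0r mulr_ge0 ?nc_ge0.
  rewrite -mulrA mulrC; apply: ler_wpM2r; first exact: nc_ge0.
  apply: le_trans (_ : q ^+ (3 - j) * normc (v j 0) <= _).
    by rewrite mulrC ler_wpM2r ?nc_ge0 //; apply: ler_weXn2l => //; lia.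
  apply: le_trans (modes_lower _ q0 j) _; have := hS true; have := hS false; lra.
rewrite /mx_sum sum_I4 !mulrDr; apply: lerD; last by have := row i3; rewrite subnn expr0 mul1r.
by apply: lerD; [apply: lerD; [exact: row i0|exact: row i1]|exact: row i2].
Qed.

End Derivative.
End Modes.

Section ComplexExponential.
Variable R : realType.
Local Notation C := R[i].
Implicit Types (m : C) (s t : R).

Lemma cexpD m s t : cexp m (s + t) = cexp m s * cexp m t.
Proof.
rewrite /cexp !mulrDr expRD cosD sinD; apply/eqP; rewrite eq_complex /=.
by apply/andP; split; apply/eqP; ring.
Qed.

Lemma cexpN m t : cexp (- m) t = cexp m (- t).
Proof. by rewrite /cexp !raddfN /= !mulNr !mulrN. Qed.

End ComplexExponential.

(** * Following the modes over short blocks *)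

Section Blocks.
Variable R : realType.
Local Notation C := R[i].
Local Open Scope complex_scope.
Variables (G g : R -> R).
Hypothesis hG : RAC G g.
Hypothesis g0 : forall t, 0 <= t <= 1 -> 0 <= g t.
Local Notation sg := (@sg R).

Lemma sgsg o : sg o * sg o = 1.
Proof. by case: o; rewrite /sg; ring. Qed.

Lemma sgN o : sg (~~ o) = - sg o.
Proof. by case: o; rewrite /sg //= opprK. Qed.

Lemma sg_mono o p t y : 0 <= p <= 1 -> 0 <= y <= 1 -> 0 <= sg o * (t - p) ->
  0 <= sg o * (y - t) -> sg o * (G t - G p) <= sg o * (G y - G p).
Proof.
move=> /andP[p0 p1] /andP[y0 y1].
case: o; rewrite /sg !(mul1r, mulN1r) ?lerN2 ?lerD2r => h1 h2.
  by apply: (RAC_mono hG g0) => //; lra.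
by apply: (RAC_mono hG g0) => //; lra.
Qed.

(* The distance travelled from p in the direction o is [sg o * (t - p)]; [k] bounds the growth
   rate of all modes in that direction. *)
Lemma two_point o (u rho : R -> C) m (k T p t : R) :
  abscont u (fun s => m * u s + rho s) -> `|complex.Re m| <= k -> 0 <= T ->
  0 <= p <= 1 -> 0 <= t <= 1 -> 0 <= sg o * (t - p) ->
  (forall s, 0 <= s <= 1 -> 0 <= sg o * (s - p) -> 0 <= sg o * (t - s) ->
     normc (rho s) <= T * expR (k * (sg o * (s - p))) * g s) ->
  normc (u t - cexp m (t - p) * u p) <= 2 * T * expR (k * (sg o * (t - p))) * (sg o * (G t - G p)).
Proof.
move=> hu hm T0 hp ht tp hr; set r := complex.Re m.
have hr' : `|r| <= k := hm.
(* Variation of constants: the density of [f] involves only [rho]. *)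
pose f s := cexp (- m) s * u s.
have hf : abscont f (fun s => cexp (- m) s * rho s).
  by apply: (AC_ext (AC_M (AC_cexp (- m)) hu)) => s _ //; ring.
pose W := T * expR (- (r * t) + k * (sg o * (t - p))).
have W0 : 0 <= W by rewrite mulr_ge0 ?expR_ge0.
have hW s : 0 <= s <= 1 -> 0 <= sg o * (s - p) -> 0 <= sg o * (t - s) ->
    normc (cexp (- m) s * rho s) <= W * g s.
  move=> hs h1 h2; rewrite normcM nc_cexp; apply: le_trans (ler_wpM2l (expR_ge0 _) (hr s hs h1 h2)) _.
  rewrite [leLHS]mulrA ler_wpM2r ?g0 // mulrCA -expRD ler_wpM2l // ler_expR raddfN /= -/r mulNr.
  rewrite -subr_ge0; set A := (X in 0 <= X).
  have -> : A = (k - r * sg o) * (sg o * (t - s)) + r * (t - s) * (sg o * sg o - 1) by rewrite /A; ring.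
  rewrite sgsg subrr mulr0 addr0 mulr_ge0 // subr_ge0.
  by case: (o); rewrite /sg; move: hr'; rewrite ler_norml; lra.
have key : normc (f t - f p) <= 2 * W * (sg o * (G t - G p)).
  have hv := RAC_Z W hG.
  have /andP[p0 p1] := hp; have /andP[t0 t1] := ht.
  move: tp hW; rewrite /sg; case: (o) => tp hW.
    apply: le_trans (AC_le hf hv p0 _ t1 _) _; [lra| |lra].
    by move=> s ps st; apply: hW; [apply/andP; split|..]; lra.
  rewrite ncB; apply: le_trans (AC_le hf hv t0 _ p1 _) _; [lra| |lra].
  by move=> s ps st; apply: hW; [apply/andP; split|..]; lra.
have -> : u t - cexp m (t - p) * u p = cexp m t * (f t - f p).
  rewrite mulrBr /f !mulrA !cexpN -!cexpD subrr cexp0 mul1r.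
  by [].
rewrite normcM nc_cexp -/r; apply: le_trans (ler_wpM2l (expR_ge0 _) key) _.
rewrite /W; set D := sg o * (G t - G p); set E := k * _.
have -> : expR E = expR (r * t) * expR (- (r * t) + E) by rewrite -expRD; congr expR; ring.
set A := expR (r * t); set B := expR (_ + _).
by rewrite le_eqVlt; apply/orP; left; apply/eqP; ring.
Qed.

Section OnRay.
Variables (q : R) (X : bool -> bool -> R -> C) (rho : bool -> bool -> R -> C) (N : bool -> R -> R).
Hypothesis q1 : 1 <= q.

Lemma q_ge0 : 0 <= q. Proof. exact: le_trans ler01 q1. Qed.
Hypothesis hX : forall o b, abscont (X o b) (fun s => rt1 R o b * q%:C * X o b s + rho o b s).
Hypothesis X_N : forall o b t, normc (X o b t) <= N o t.
Hypothesis N_X : forall o t, exists b, N o t = normc (X o b t).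
Hypothesis hrho : forall t, 0 <= t <= 1 -> forall S, (forall o, N o t <= S) ->
  forall o b, normc (rho o b t) <= S * g t.

Lemma Re_rt o b : complex.Re (rt1 R o b * q%:C) = sg o * q.
Proof. by rewrite /rt1 /=; ring. Qed.

Lemma Re_rt_le o b : `|complex.Re (rt1 R o b * q%:C)| <= q.
Proof. rewrite Re_rt normrM; have -> : `|sg o| = 1 by case: o; rewrite /sg ?normrN normr1.
by rewrite mul1r ger0_norm ?q_ge0. Qed.

(** The bootstrap of [block_bound] with the exponential of the fastest rate q carried along as a
    weight. *)
Lemma block_apriori o p y m : 0 <= p <= 1 -> 0 <= y <= 1 -> 0 <= sg o * (y - p) ->
  sg o * (G y - G p) <= 1 / 4%:R -> (forall o', N o' p <= m) ->
  forall t, 0 <= t <= 1 -> 0 <= sg o * (t - p) -> 0 <= sg o * (y - t) ->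
  forall o', N o' t <= 2 * m * expR (q * (sg o * (t - p))).
Proof.
move=> hp hy py Gpy hm.
have [S S0 hS] : exists2 S, 0 <= S & forall o' t, 0 <= t <= 1 -> N o' t <= S.
  have [S S0 h] := @family_bounded R (bool * bool)%type (fun i => X i.1 i.2) _ (fun i => hX i.1 i.2).
  by exists S => // o' t ht; have [b ->] := N_X o' t; exact: (h (o', b)).
have N0 o' t : 0 <= N o' t by apply: le_trans (nc_ge0 _) (X_N o' true t).
have m0 : 0 <= m := le_trans (N0 true p) (hm true).
have key j : forall t, 0 <= t <= 1 -> 0 <= sg o * (t - p) -> 0 <= sg o * (y - t) ->
    forall o', N o' t <= (2 * m + S / 2 ^+ j) * expR (q * (sg o * (t - p))).
  elim: j => [|j IH] t ht pt ty o'.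
    rewrite expr0 divr1; apply: le_trans (hS o' t ht) _.
    apply: le_trans (_ : (2 * m + S) * 1 <= _); first lra.
    rewrite ler_wpM2l; [by []|lra|].
    by apply: le_trans (expR_ge1Dx _); rewrite lerDl mulr_ge0 ?q_ge0.
  have [b ->] := N_X o' t.
  pose T := 2 * m + S / 2 ^+ j.
  have T0 : 0 <= T by rewrite addr_ge0 ?mulr_ge0 // divr_ge0 ?exprn_ge0.
  have h := two_point (hX o' b) (Re_rt_le o' b) T0 hp ht pt _.
  have D s : 0 <= sg o * (s - p) -> expR (complex.Re (rt1 R o' b * q%:C) * (s - p)) <= expR (q * (sg o * (s - p))).
    move=> ps; rewrite ler_expR Re_rt; apply: le_trans (ler_norm _) _.
    have -> : sg o' * q * (s - p) = q * (sg o' * (s - p)) by ring.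
    rewrite normrM ger0_norm ?q_ge0 // ler_wpM2l ?q_ge0 //.
    by rewrite -[leRHS]ger0_norm // !normrM ler_wpM2r // /sg; case: (o); case: (o'); rewrite ?normrN.
  have {}h : normc (X o' b t - cexp (rt1 R o' b * q%:C) (t - p) * X o' b p) <=
      2 * T * expR (q * (sg o * (t - p))) * (1 / 4%:R).
    apply: le_trans (h _) _.
      move=> s hs ps st; apply: hrho => // o2; apply: IH => //.
      have -> : sg o * (y - s) = sg o * (y - t) + sg o * (t - s) by ring.
      by rewrite addr_ge0.
    rewrite ler_wpM2l ?mulr_ge0 ?expR_ge0 //.
    exact: le_trans (sg_mono hp hy pt ty) Gpy.
  apply: le_trans (nc_dist _ _) _.
  apply: le_trans (lerD (_ : _ <= m * expR (q * (sg o * (t - p)))) h) _.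
    rewrite normcM nc_cexp mulrC; apply: ler_pM; rewrite ?nc_ge0 ?expR_ge0 ?D //.
    exact: le_trans (X_N _ _ _) (hm _).
  have -> : 2 * m + S / 2 ^+ j.+1 = m + T / 2 by rewrite /T exprS; field; rewrite expf_neq0.
  by set E := expR _; rewrite le_eqVlt; apply/orP; left; apply/eqP; field.
move=> t ht pt ty o'; set E := expR _; rewrite -mulrA.
apply: (@halving_bound R _ (S * E)) => j; apply: le_trans (key j t ht pt ty o') _.
rewrite -/E; set P := 2 ^+ j; rewrite le_eqVlt; apply/orP; left; apply/eqP; field.
by rewrite expf_neq0.
Qed.

(** On a block each mode follows its own exponential up to the error 4 m d E: moving in direction o,
    the modes of kind o are multiplied by E and the others by its inverse. *)
Lemma block_step o p y m d : 0 <= p <= 1 -> 0 <= y <= 1 -> 0 <= sg o * (y - p) ->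
  sg o * (G y - G p) <= d -> d <= 1 / 4%:R -> (forall o', N o' p <= m) ->
  let E := expR (q * (sg o * (y - p))) in
  [/\ N o y <= (N o p + 4%:R * m * d) * E, (N o p - 4%:R * m * d) * E <= N o y &
      N (~~ o) y <= E^-1 * N (~~ o) p + 4%:R * m * d * E].
Proof.
move=> hp hy py Gpy d4 hm E; have E0 : 0 < E := expR_gt0 _.
have N0 o' t : 0 <= N o' t by apply: le_trans (nc_ge0 _) (X_N o' true t).
have m0 : 0 <= m := le_trans (N0 true p) (hm true).
have hap := block_apriori hp hy py (le_trans Gpy d4) hm.
have tp o' b : normc (X o' b y - cexp (rt1 R o' b * q%:C) (y - p) * X o' b p) <= 4%:R * m * d * E.
  have m20 : 0 <= 2 * m by rewrite mulr_ge0.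
  apply: le_trans (two_point (hX o' b) (Re_rt_le o' b) m20 hp hy py _) _.
    move=> s hs ps st; apply: hrho => // o2; exact: hap.
  rewrite -/E -[leRHS]mulrAC; have -> : 4%:R * m * E = 2 * (2 * m) * E by ring.
  by rewrite ler_wpM2l // mulr_ge0 ?(ltW E0) ?mulr_ge0.
have ex o' b : normc (cexp (rt1 R o' b * q%:C) (y - p) * X o' b p) =
    (if o' == o then E else E^-1) * normc (X o' b p).
  rewrite normcM nc_cexp Re_rt /E -expRN; case: eqP => [->|ne].
    by congr (expR _ * _); ring.
  have -> : o' = ~~ o by case: (o) (o') ne => [] [].
  by rewrite sgN; congr (expR _ * _); ring.
split.
- have [b ->] := N_X o y; apply: le_trans (nc_dist _ _) _.
  rewrite mulrDl; apply: lerD (tp o b).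
  by rewrite ex eqxx mulrC ler_wpM2r ?(ltW E0) ?X_N.
- have [b Np] := N_X o p; apply: le_trans (X_N o b y).
  have := nc_dist (cexp (rt1 R o b * q%:C) (y - p) * X o b p) (X o b y).
  rewrite ncB ex eqxx -Np; have := tp o b.
  set u := normc _; move=> h1 h2.
  rewrite mulrBl; move: h1 h2; rewrite [N o p * E]mulrC; lra.
- have [b ->] := N_X (~~ o) y; apply: le_trans (nc_dist _ _) _.
  apply: lerD (tp (~~ o) b).
  rewrite ex; have -> : (~~ o == o) = false by case: (o).
  by rewrite ler_wpM2l ?invr_ge0 ?(ltW E0) ?X_N.
Qed.

End OnRay.
(* [X o b] are the mode amplitudes of a solution and [N o] their maximum over [b]. *)
Definition ray_family (q : R) (N : bool -> R -> R) := exists (X rho : bool -> bool -> R -> C),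
  [/\ forall o b, abscont (X o b) (fun s => rt1 R o b * q%:C * X o b s + rho o b s),
      forall o b t, normc (X o b t) <= N o t,
      forall o t, exists b, N o t = normc (X o b t) &
      forall t, 0 <= t <= 1 -> forall S, (forall o, N o t <= S) ->
        forall o b, normc (rho o b t) <= S * g t].

Definition origin o : R := if o then 0 else 1.

Lemma family_ge0 q N o t : ray_family q N -> 0 <= N o t.
Proof. by move=> [X [_ [_ h _ _]]]; exact: le_trans (nc_ge0 _) (h o true t). Qed.

Lemma ray_step q N o p y s d : ray_family q N -> 1 <= q -> 0 <= p <= 1 -> 0 <= y <= 1 ->
  0 <= sg o * (y - p) -> sg o * (G y - G p) <= d -> d <= 1 / 4%:R -> 1 <= s ->
  N (~~ o) p <= s * N o p ->
  let E := expR (q * (sg o * (y - p))) in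
  [/\ N o y <= (1 + 4%:R * s * d) * (N o p * E), (1 - 4%:R * s * d) * (N o p * E) <= N o y &
      N (~~ o) y <= (s * E^-1 + 4%:R * s * d) * (N o p * E)].
Proof.
move=> hN q1 hp hy py Gpy d4 s1 cone E; have Np := family_ge0 o p hN.
have [X [rho [h1 h2 h3 h4]]] := hN.
have hm o' : N o' p <= s * N o p.
  have [->//|ne] := eqVneq o' (~~ o).
  have -> : o' = o by case: (o) (o') ne => [] [].
  by rewrite ler_peMl.
have [a1 a2 a3] := block_step q1 h1 h2 h3 h4 hp hy py Gpy d4 hm.
have E1 : 1 <= E.
  by apply: le_trans (expR_ge1Dx _); rewrite lerDl mulr_ge0 // (le_trans ler01).
have E0 : 0 < E := expR_gt0 _.
rewrite -/E in a1 a2 a3; split.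
- by apply: le_trans a1 _; rewrite le_eqVlt; apply/orP; left; apply/eqP; ring.
- by apply: le_trans a2; rewrite le_eqVlt; apply/orP; left; apply/eqP; ring.
- apply: le_trans a3 _; rewrite [leRHS]mulrDl; apply: lerD; last first.
    by rewrite le_eqVlt; apply/orP; left; apply/eqP; ring.
  have -> : s * E^-1 * (N o p * E) = s * N o p * (E^-1 * E) by ring.
  rewrite mulVf ?gt_eqF // mulr1; apply: le_trans cone; rewrite ler_piMl ?(family_ge0 _ _ hN) //.
  by rewrite invf_le1.
Qed.

(** The cone in which the opposite modes are at most 5 times those of kind o is preserved from one
    grid point to the next, since q >= M + 1 makes E at least 2 on a full cell. Each cell changes N
    o against its exponential by at most a factor 2, and the number of cells is fixed, so K does not
    depend on q. *)
Lemma ray_bounds : exists K q0 : R, [/\ 0 < K, 1 <= q0 & forall q N o, q0 <= q -> ray_family q N ->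
  N (~~ o) (origin o) <= 5%:R * N o (origin o) -> forall t, 0 <= t <= 1 ->
  let E := expR (q * (sg o * (t - origin o))) in
  [/\ N (~~ o) t <= 6%:R * N o t, N o t <= K * (N o (origin o) * E) &
      N o (origin o) * E <= K * N o t]].
Proof.
(* For the aperture 5 the error is 4 * 5 / 200 = 1/10: N o stays between 0.9 and 1.1 of the
   exponential, the opposite modes below 5 / E + 0.1 of it. Hence the ratio 6 in general, and 5 as
   soon as E >= 2. *)
have e200 : 0 < 1 / 200%:R :> R by rewrite divr_gt0 ?ltr0n.
have [M hM] := RAC_unif hG e200.
have M0 : 0 < M.+1%:R :> R by rewrite ltr0Sn.
(* At most M + 1 full cells, followed by one partial cell. *)
exists (2 ^+ M.+2), M.+1%:R; split; [by rewrite exprn_gt0|by rewrite ler1n|].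
move=> q N o Mq hN cone; set p0 := origin o.
have q1 : 1 <= q by apply: le_trans Mq; rewrite ler1n.
have q0 : 0 <= q by lra.
have N0 o' t := family_ge0 o' t hN.
pose P (k : nat) : R := p0 + sg o * (k%:R / M.+1%:R).
have DP k : sg o * (P k - p0) = k%:R / M.+1%:R.
  by rewrite /P addrC addKr mulrA sgsg mul1r.
have hP k : (k <= M.+1)%N -> 0 <= P k <= 1.
  move=> kM; have : 0 <= (k%:R / M.+1%:R : R) <= 1.
    by rewrite divr_ge0 //= ler_pdivrMr // mul1r ler_nat.
  rewrite /P /p0 /origin /sg; move: (_ / _) => c.
  by case: (o) => /andP[? ?]; apply/andP; split; lra.
have step p y : 0 <= p <= 1 -> 0 <= y <= 1 -> 0 <= sg o * (y - p) ->
    sg o * (y - p) <= M.+1%:R^-1 -> N (~~ o) p <= 5%:R * N o p ->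
    let E := expR (q * (sg o * (y - p))) in
    [/\ N o y <= 2 * (N o p * E), N o p * E <= 2 * N o y, N (~~ o) y <= 6%:R * N o y &
      2 <= E -> N (~~ o) y <= 5%:R * N o y].
  move=> hp hy py pyM c E.
  have Gpy : sg o * (G y - G p) <= 1 / 200%:R.
    apply: le_trans (ler_norm _) _; rewrite normrM.
    have -> : `|sg o| = 1 by case: (o); rewrite /sg ?normrN normr1.
    rewrite [leLHS]mul1r; apply: hM => //.
    have : `|sg o * (y - p)| <= M.+1%:R^-1 by rewrite ger0_norm.
    by rewrite normrM; have -> : `|sg o| = 1 by [case: (o); rewrite /sg ?normrN normr1]; rewrite mul1r.
  have [] := ray_step hN q1 hp hy py Gpy _ _ c; [lra|lra|].
  rewrite -/E; have : 0 <= N o p * E by rewrite mulr_ge0 ?expR_ge0.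
  have E1 : E^-1 <= 1.
    by rewrite invf_le1 ?expR_gt0 // -expR0 ler_expR mulr_ge0.
  set A := N o p * E => A0 h1 h2 h3.
  have h4 : E^-1 * A <= A by rewrite ler_piMl.
  move: h3; have -> : (5%:R * E^-1 + 4%:R * 5%:R * (1 / 200%:R)) * A =
    5%:R * (E^-1 * A) + A / 10%:R by field; rewrite gt_eqF ?expR_gt0.
  move: h4; set B := E^-1 * A => h4 h3.
  split; [lra|lra|lra|].
  move=> E2; have h5 : B <= A / 2.
    by rewrite /B mulrC ler_wpM2l // lef_pV2 ?posrE ?expR_gt0.
  lra.
have grid k : (k <= M.+1)%N -> let E := expR (q * (k%:R / M.+1%:R)) in
    [/\ N (~~ o) (P k) <= 5%:R * N o (P k), N o (P k) <= 2 ^+ k * (N o p0 * E) &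
       N o p0 * E <= 2 ^+ k * N o (P k)].
  elim: k => [_|k IH kM E].
    have -> : P 0%N = p0 by rewrite /P mul0r mulr0 addr0.
    by rewrite /= mul0r mulr0 expR0 expr0 !mul1r mulr1.
  have [c h1 h2] := IH (ltnW kM).
  have e1 : sg o * (P k.+1 - P k) = M.+1%:R^-1.
    have -> : P k.+1 - P k = (P k.+1 - p0) - (P k - p0) by ring.
    by rewrite mulrBr !DP -mulrBl -natr1 addrAC subrr add0r mul1r.
  have [] := step _ _ (hP k (ltnW kM)) (hP _ kM) _ _ c; rewrite ?e1 ?invr_ge0 ?(ltW M0) //.
  have -> : E = expR (q * (k%:R / M.+1%:R)) * expR (q * M.+1%:R^-1).
    by rewrite /E -expRD -mulrDr -natr1 mulrDl mul1r.
  have F1 : 1 + q * M.+1%:R^-1 <= expR (q * M.+1%:R^-1) := expR_ge1Dx _.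
  have F2 : 1 <= q * M.+1%:R^-1 by rewrite ler_pdivlMr // mul1r.
  move: h1 h2 F1 F2; set E1 := expR (q * (_ / _)); set E2 := expR _ => h1 h2 F1 F2.
  have E20 : 0 <= E2 := expR_ge0 _.
  have E22 : 2 <= E2 by move: F1 F2; move: (q / _) => c'; lra.
  move=> g1 g2 _ g4; split; first exact: g4.
  - apply: le_trans g1 _; rewrite exprS -mulrA ler_wpM2l // mulrA mulrA ler_wpM2r //.
    by rewrite -mulrA.
  - rewrite mulrA; apply: le_trans (ler_wpM2r E20 h2) _.
    have -> : 2 ^+ k * N o (P k) * E2 = 2 ^+ k * (N o (P k) * E2) by ring.
    have -> : 2 ^+ k.+1 * N o (P k.+1) = 2 ^+ k * (2 * N o (P k.+1)) by rewrite exprS; ring.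
    by rewrite ler_wpM2l ?exprn_ge0.
move=> t ht E.
have D0 : 0 <= sg o * (t - p0) <= 1.
  by rewrite /p0 /origin /sg; case: (o); have /andP[? ?] := ht; apply/andP; split; lra.
have /andP[D00 D01] := D0.
pose k := Num.truncn (sg o * (t - p0) * M.+1%:R).
have k1 : k%:R <= sg o * (t - p0) * M.+1%:R by rewrite truncn_le // mulr_ge0.
have k2 := truncnS_gt (sg o * (t - p0) * M.+1%:R).
have kM : (k <= M.+1)%N.
  by rewrite -(ler_nat R); apply: le_trans k1 _; rewrite ler_piMl // ltW.
have [c h1 h2] := grid k kM.
have e1 : sg o * (t - P k) = sg o * (t - p0) - k%:R / M.+1%:R.
  by rewrite -DP -mulrBr; congr (_ * _); ring.
have [||g1 g2 g3 _] := step _ t (hP k kM) ht _ _ c.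
- by rewrite e1 subr_ge0 ler_pdivrMr.
- rewrite e1 lerBlDr; apply: le_trans (_ : k.+1%:R / M.+1%:R <= _).
    by rewrite ler_pdivlMr //; exact: ltW.
  by rewrite -natr1 mulrDl mul1r addrC.
move: g1 g2; have -> : E = expR (q * (k%:R / M.+1%:R)) * expR (q * (sg o * (t - P k))).
  by rewrite /E -expRD -mulrDr e1; congr (expR (_ * _)); ring.
move: h1 h2; set E1 := expR (q * (_ / _)); set E2 := expR _ => h1 h2 g1 g2.
have E20 : 0 <= E2 := expR_ge0 _.
have E10 : 0 <= E1 := expR_ge0 _.
have pk : 2 ^+ k.+1 <= 2 ^+ M.+2 :> R by apply: ler_weXn2l; rewrite ?ler1n.
split=> //.
- apply: le_trans g1 _; apply: le_trans (_ : 2 ^+ k.+1 * (N o p0 * (E1 * E2)) <= _).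
    by rewrite exprS -mulrA ler_wpM2l // !mulrA ler_wpM2r // -mulrA.
  by rewrite ler_wpM2r // !mulr_ge0.
- apply: le_trans (_ : 2 ^+ k.+1 * N o t <= _); last by rewrite ler_wpM2r.
  rewrite mulrA; apply: le_trans (ler_wpM2r E20 h2) _.
  have -> : 2 ^+ k * N o (P k) * E2 = 2 ^+ k * (N o (P k) * E2) by ring.
  have -> : 2 ^+ k.+1 * N o t = 2 ^+ k * (2 * N o t) by rewrite exprS; ring.
  by rewrite ler_wpM2l ?exprn_ge0.
Qed.

(** One last block of fixed length l ending at t is enough: over it the opposite modes shrink by
    E^-1, which is small for large q, up to an error governed by the variation of G on the block. *)
Lemma ray_small o t e : 0 <= t <= 1 -> 0 < sg o * (t - origin o) -> 0 < e ->
  exists q0 : R, forall q N, q0 <= q -> ray_family q N ->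
    N (~~ o) (origin o) <= 5%:R * N o (origin o) -> N (~~ o) t <= e * N o t.
Proof.
move=> ht; set p0 := origin o => tp e0.
have [K [q0 [K0 q01 hq0]]] := ray_bounds.
pose e' : R := Num.min e 1.
have e'0 : 0 < e' by rewrite lt_min e0 ltr01.
have e'e : e' <= e by rewrite ge_min lexx.
have e'1 : e' <= 1 by rewrite ge_min lexx orbT.
(* The opposite modes come out below 6 / E + 24 e' / 96 <= 3 e' / 4 of the exponential, once E >= 12
   / e', and those of kind o above 1 - e' / 4 >= 3/4 of it. *)
have d0 : 0 < e' / 96%:R by rewrite divr_gt0 // ltr0n.
have [M hM] := RAC_unif hG d0.
pose l : R := Num.min (sg o * (t - p0)) M.+1%:R^-1.
have l0 : 0 < l by rewrite lt_min tp invr_gt0 ltr0Sn.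
have lt : l <= sg o * (t - p0) by rewrite ge_min lexx.
have lM : l <= M.+1%:R^-1 by rewrite ge_min lexx orbT.
exists (Num.max q0 (12%:R / (e' * l))) => q N; rewrite ge_max => /andP[qq0 ql] hN cone.
pose p := t - sg o * l.
have tpl : t - p = sg o * l by rewrite /p; ring.
have tpl' : sg o * (t - p) = l by rewrite tpl mulrA sgsg mul1r.
have hp : 0 <= p <= 1.
  have /andP[t0 t1] := ht; move: lt l0; rewrite /p /p0 /origin /sg.
  by case: (o) => ? ?; apply/andP; split; lra.
have q1 : 1 <= q by lra.
have [c _ _] := hq0 q N o qq0 hN cone p hp.
have Gpt : sg o * (G t - G p) <= e' / 96%:R.
  have n1 : `|sg o| = 1 by case: (o); rewrite /sg ?normrN normr1.
  apply: le_trans (ler_norm _) _; rewrite normrM n1 [leLHS]mul1r; apply: hM => //.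
  by rewrite tpl normrM n1 mul1r ger0_norm // ltW.
have := ray_step hN q1 hp ht _ Gpt _ _ c; rewrite tpl'.
set E := expR _; case; [exact: ltW|lra|lra|] => _ h2 h3.
have E0 : 0 < E := expR_gt0 _.
have E12 : E^-1 <= e' / 12%:R.
  rewrite -[e' / _]invrK lef_pV2 ?posrE ?invr_gt0 ?divr_gt0 //.
  rewrite invf_div; apply: le_trans (_ : q * l <= _); last by apply: le_trans (expR_ge1Dx _); lra.
  by move: ql; rewrite invfM mulrA ler_pdivrMr.
have A0 : 0 <= N o p * E by rewrite mulr_ge0 ?(ltW E0) // (family_ge0 _ _ hN).
set A := N o p * E in h2 h3 A0.
have e1 : (6%:R * E^-1 + 4%:R * 6%:R * (e' / 96%:R)) * A <= 3%:R / 4%:R * e' * A.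
  by apply: ler_wpM2r => //; lra.
have e2 : 3%:R / 4%:R * A <= N o t.
  by apply: le_trans h2; apply: ler_wpM2r => //; lra.
apply: le_trans h3 _; apply: le_trans e1 _; apply: le_trans (_ : e' * (3%:R / 4%:R * A) <= _).
  by rewrite le_eqVlt; apply/orP; left; apply/eqP; ring.
by apply: ler_pM => //; [exact: ltW|rewrite mulr_ge0 // divr_ge0].
Qed.

End Blocks.

(** * Cones of initial data *)

Section Cones.
Variable R : realType.
Local Notation C := R[i].
Local Open Scope complex_scope.
Implicit Types (q : R) (v : 'cV[C]_4).

Lemma cone_pair (a b : C) o (S : R) : (forall c, normc (rt1 R o c * a + b) <= S) ->
  forall c, normc (rt1 R (~~ o) c * a + b) <= 5%:R * S.
Proof.
move=> h c; have ha : normc a <= S.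
  have : normc (2%:R * ('i * a)) <= 2 * S.
    have -> : 2%:R * ('i * a) = (rt1 R o true * a + b) - (rt1 R o false * a + b).
      by rewrite !rt1E /sg rmorphN rmorph1; ring.
    apply: le_trans (le_normcD _ _) _; rewrite normcN; have := h true; have := h false; lra.
  by rewrite !normcM nc_nat nc_i mul1r; lra.
have ra o' c' : normc (rt1 R o' c' * a) <= 2 * normc a.
  by rewrite normcM; apply: ler_wpM2r; [exact: nc_ge0|case: (nc_rt R o' c')].
have hb : normc b <= S + 2 * S.
  have -> : b = (rt1 R o true * a + b) - rt1 R o true * a by ring.
  apply: le_trans (le_normcD _ _) _; rewrite normcN; have := h true; have := ra o true; lra.
apply: le_trans (le_normcD _ _) _; have := ra (~~ o) c; lra.
Qed.

(** With half of the data zero the modes reduce to mu a + b, up to the factor mu^2 if [o] holds, and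
    the two modes of one kind already determine a and b. This is where the aperture 5 comes from. *)
Lemma cone_origin q o v : (if o then v i2 0 = 0 /\ v i3 0 = 0 else v i0 0 = 0 /\ v i1 0 = 0) ->
  modes q (~~ o) v <= 5%:R * modes q o v.
Proof.
case: o => -[e1 e2].
  have E o b : mode q o b v = rt2 R o b * (rt1 R o b * (q%:C ^+ 3 * v i0 0) + q%:C ^+ 2 * v i1 0).
    by rewrite /mode e1 e2 -rt12; ring.
  have n2 o b : normc (rt2 R o b) = 2.
    rewrite rt2E !normcM nc_i nc_nat !nc_real /sg; case: o; case: b;
    by rewrite ?normrN !normr1 !mulr1.
  apply: modes_le => b; rewrite E normcM n2.
  have -> : 5%:R * modes q true v = 2 * (5%:R * (modes q true v / 2)) by field.
  rewrite ler_pM2l //; apply: (cone_pair (o := true)) => c.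
  by have := mode_le q true c v; rewrite E normcM n2; lra.
have E o b : mode q o b v = rt1 R o b * (q%:C * v i2 0) + v i3 0.
  by rewrite /mode e1 e2; ring.
apply: modes_le => b; rewrite E; apply: (cone_pair (o := false)) => c.
by rewrite -E mode_le.
Qed.

(** The two expressions are, up to units, the half-sum and half-difference of the growing modes;
    equating them to 0 gives the plane of decaying data, the source of the universal asymptotics of
    the minors. As e <= 1/12, the growing modes on the right are absorbed. *)
Lemma decaying_plane q e v : 0 <= q -> 0 < e -> e <= 1 / 12%:R ->
  modes q true v <= e * modes q false v ->
  let s := q * normc (v i2 0) + normc (v i3 0) in
  normc (2%:R * q%:C ^+ 3 * v i0 0 - q%:C * v i2 0 - v i3 0) <= 20%:R * e * s /\
  normc (2%:R * q%:C ^+ 3 * v i0 0 + 2%:R * q%:C ^+ 2 * v i1 0 + q%:C * v i2 0) <= 20%:R * e * s.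
Proof.
move=> q0 e0 e12 hv s.
have nq m : normc (q%:C ^+ m) = q ^+ m :> R by rewrite ncX nc_real ger0_norm.
set A := 2%:R * q%:C ^+ 3 * v i0 0 - q%:C * v i2 0 - v i3 0.
set B := 2%:R * q%:C ^+ 3 * v i0 0 + _ + _.
set M := modes q true v in hv *.
have [M0 Nf0] := (modes_ge0 q true v, modes_ge0 q false v).
have hA : normc A <= M.
  have : normc (2%:R * A) <= 2 * M.
    have -> : 2%:R * A = - (mode q true true v + mode q true false v).
      by rewrite /A /mode !rt1E !rt2E !rt3E /sg rmorphN rmorph1; ring.
    rewrite normcN; apply: le_trans (le_normcD _ _) _.
    by have := mode_le q true true v; have := mode_le q true false v; rewrite -/M; lra.
  by rewrite normcM nc_nat; lra.
have hB : normc B <= M.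
  have : normc (2%:R * ('i * B)) <= 2 * M.
    have -> : 2%:R * ('i * B) = mode q true true v - mode q true false v.
      by rewrite /B /mode !rt1E !rt2E !rt3E /sg rmorphN rmorph1; ring.
    apply: le_trans (le_normcD _ _) _; rewrite normcN.
    by have := mode_le q true true v; have := mode_le q true false v; rewrite -/M; lra.
  by rewrite !normcM nc_nat nc_i; lra.
suff hM : M <= 20%:R * e * s by split; [exact: le_trans hA hM|exact: le_trans hB hM].
have hup := modes_upper false v q0.
have h0 : 2 * (q ^+ 3 * normc (v i0 0)) <= M + s.
  have : normc (2%:R * (q%:C ^+ 3 * v i0 0)) <= M + s.
    have -> : 2%:R * (q%:C ^+ 3 * v i0 0) = A + (q%:C * v i2 0 + v i3 0) by rewrite /A; ring.
    apply: le_trans (le_normcD _ _) _; apply: lerD => //; apply: le_trans (le_normcD _ _) _.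
    by rewrite normcM (nq 1%N).
  by rewrite normcM nc_nat normcM nq.
have h1 : 2 * (q ^+ 2 * normc (v i1 0)) <= 2 * M + 2 * s.
  have : normc (2%:R * (q%:C ^+ 2 * v i1 0)) <= 2 * M + 2 * s.
    have -> : 2%:R * (q%:C ^+ 2 * v i1 0) = B - 2%:R * (q%:C ^+ 3 * v i0 0) - q%:C * v i2 0.
      by rewrite /B; ring.
    apply: le_trans (le_normcD _ _) _; rewrite normcN.
    apply: le_trans (lerD (le_normcD _ _) (lexx _)) _; rewrite normcN.
    have : normc (2%:R * (q%:C ^+ 3 * v i0 0)) <= M + s by rewrite normcM nc_nat normcM nq.
    have : normc (q%:C * v i2 0) <= s by rewrite normcM (nq 1%N) lerDl nc_ge0.
    lra.
  by rewrite normcM nc_nat normcM nq.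
have s0 : 0 <= s by rewrite addr_ge0 ?mulr_ge0 ?nc_ge0.
have hs : q * normc (v i2 0) + normc (v i3 0) = s by [].
set Nf := modes q false v in hv hup Nf0.
have {}hup : Nf <= 4%:R * (5%:R / 2 * s + 3%:R / 2 * M).
  by move: h0 h1 hup; set a := q ^+ 3 * _; set b := q ^+ 2 * _; lra.
have h3 : e * Nf <= e * (10%:R * s + 6%:R * M) by rewrite ler_wpM2l ?(ltW e0) //; lra.
have h4 : e * M <= 1 / 12%:R * M by apply: ler_wpM2r.
move: h3; rewrite mulrDr !(mulrCA e); lra.
Qed.

End Cones.

(** * Growing and decaying solutions on the ray *)

Section RaySolutions.
Variable R : realType.
Local Notation C := R[i].
Local Open Scope complex_scope.
Local Open Scope classical_set_scope.
Local Notation I01 := (`[(0 : R), 1]%classic).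
Implicit Types (q : R) (v : 'cV[C]_4) (Y : R -> 'cV[C]_4).

Definition hessenberg (F : R -> 'M[C]_4) := [/\ forall k j, cintegrable I01 (fun t => F t k j),
  forall t (k j : 'I_4), (k.+1 < j)%N -> F t k j = 0 &
  forall t (k j : 'I_4), j = k.+1 :> nat -> F t k j = 1].

Section One.
Variable F : R -> 'M[C]_4.
Hypothesis hF : hessenberg F.

Let g (t : R) : R := 4%:R * mx_sum (F t).

Lemma linsol_ray_family q Y : 1 <= q -> linsol (Amat F (ray q)) Y ->
  ray_family g q (fun o t => modes q o (Y t)).
Proof.
have [hi hh hs] := hF; move=> q1 hY.
exists (fun o b t => mode q o b (Y t)),
  (fun o b t => mode q o b (Amat F (ray q) t *m Y t) - rt1 R o b * q%:C * mode q o b (Y t)).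
split=> [p b|p b t|p t|t ht S hS p b].
- apply: (@AC_ext _ (fun t => mode q p b (Y t)) (fun t => mode q p b (Amat F (ray q) t *m Y t))) => //.
    by rewrite /mode; apply: AC_D; [apply: AC_D; [apply: AC_D|]|]; try apply: AC_Z; exact: hY.
  by move=> t _; rewrite addrC subrK.
- exact: mode_le.
- exact: modes_mode.
- exact: mode_Amat.
Qed.

Lemma primitive_g : exists G, RAC G g /\ forall t, 0 <= t <= 1 -> 0 <= g t.
Proof.
have [hi _ _] := hF; eexists; split; first exact: (RAC_Z 4%:R (RAC_prim (integr_mx_sum hi))).
by move=> t _; rewrite mulr_ge0 ?mx_sum_ge0.
Qed.

(* The boundary data that make a solution grow away from its origin 0 or 1. *)
Definition grows o Y := if o then Y 0 i2 0 = 0 /\ Y 0 i3 0 = 0 else Y 1 i0 0 = 0 /\ Y 1 i1 0 = 0.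

Lemma grows_cone q o Y : grows o Y ->
  modes q (~~ o) (Y (origin R o)) <= 5%:R * modes q o (Y (origin R o)).
Proof. by case: o => h; exact: cone_origin. Qed.

Lemma linsol_bounds : exists K q0 : R, [/\ 0 < K, 1 <= q0 & forall q o Y, q0 <= q ->
  linsol (Amat F (ray q)) Y -> grows o Y -> forall t, 0 <= t <= 1 ->
  let E := expR (q * (sg R o * (t - origin R o))) in
  [/\ modes q (~~ o) (Y t) <= 6%:R * modes q o (Y t),
      modes q o (Y t) <= K * (modes q o (Y (origin R o)) * E) &
      modes q o (Y (origin R o)) * E <= K * modes q o (Y t)]].
Proof.
have [G [hG g0]] := primitive_g; have [K [q0 [K0 q01 h]]] := ray_bounds hG g0.
exists K, q0; split=> // q o Y qq0 hY gY t ht.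
apply: (h q (fun o t => modes q o (Y t)) o qq0) => //; last exact: grows_cone.
by apply: linsol_ray_family hY; exact: le_trans qq0.
Qed.

Lemma linsol_small o t e : 0 <= t <= 1 -> 0 < sg R o * (t - origin R o) -> 0 < e ->
  exists2 q0 : R, 1 <= q0 & forall q Y, q0 <= q -> linsol (Amat F (ray q)) Y -> grows o Y ->
    modes q (~~ o) (Y t) <= e * modes q o (Y t).
Proof.
move=> ht tp e0; have [G [hG g0]] := primitive_g; have [q0 h] := ray_small hG g0 ht tp e0.
exists (Num.max 1 q0); first by rewrite le_max lexx.
move=> q Y; rewrite ge_max => /andP[q1 qq0] hY gY.
by apply: (h q (fun o t => modes q o (Y t))) => //; [exact: linsol_ray_family|exact: grows_cone].
Qed.

(** A solution that vanishes at 1 with its first quasi-derivative grows away from 1, so at 0 its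
    modes that increase with t are negligible. *)
Lemma decaying_initial (e : R) : 0 < e -> exists2 q0 : R, 1 <= q0 & forall q Y, q0 <= q ->
  linsol (Amat F (ray q)) Y -> Y 1 i0 0 = 0 -> Y 1 i1 0 = 0 ->
  let s := q * normc (Y 0 i2 0) + normc (Y 0 i3 0) in
  normc (2%:R * q%:C ^+ 3 * Y 0 i0 0 - q%:C * Y 0 i2 0 - Y 0 i3 0) <= e * s /\
  normc (2%:R * q%:C ^+ 3 * Y 0 i0 0 + 2%:R * q%:C ^+ 2 * Y 0 i1 0 + q%:C * Y 0 i2 0) <= e * s.
Proof.
move=> e0; pose e' : R := Num.min (e / 20%:R) (1 / 12%:R).
have e'0 : 0 < e' by rewrite lt_min !divr_gt0 // ltr0n.
have e'e : e' <= e / 20%:R by rewrite ge_min lexx.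
have e'1 : e' <= 1 / 12%:R by rewrite ge_min lexx orbT.
have h0 : 0 <= (0 : R) <= 1 by rewrite lexx ler01.
have tp : 0 < sg R false * (0 - origin R false) by rewrite /sg /origin; lra.
have [q0 q01 h] := linsol_small h0 tp e'0.
exists q0 => // q Y qq0 hY y0 y1 s.
have q_0 : 0 <= q by lra.
have [a b] := decaying_plane q_0 e'0 e'1 (h q Y qq0 hY (conj y0 y1)).
have s0 : 0 <= s by rewrite addr_ge0 ?mulr_ge0 ?nc_ge0.
have es : 20%:R * e' * s <= e * s by apply: ler_wpM2r => //; lra.
by split; [exact: le_trans a es|exact: le_trans b es].
Qed.

End One.

(** Each of V and W is comparable with its counterpart, because both follow the same exponential
    from the same data. At an interior point V' and W' lie in nearly complementary cones, so they
    cannot cancel in their sum. *)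
Lemma transfer_bound (F F' : R -> 'M[C]_4) t : hessenberg F -> hessenberg F' -> 0 < t < 1 ->
  exists K q0 : R, [/\ 0 < K, 1 <= q0 & forall q V W V' W', q0 <= q ->
  linsol (Amat F (ray q)) V -> linsol (Amat F (ray q)) W ->
  linsol (Amat F' (ray q)) V' -> linsol (Amat F' (ray q)) W' ->
  grows false V -> grows true W -> grows false V' -> grows true W' -> V 0 = V' 0 -> W 0 = W' 0 ->
  modes q true (V t + W t) + modes q false (V t + W t) <=
    K * (modes q true (V' t + W' t) + modes q false (V' t + W' t))].
Proof.
move=> hF hF' /andP[t0 t1].
have [K [q0 [K0 q01 h]]] := linsol_bounds hF.
have [K' [q0' [K0' q01' h']]] := linsol_bounds hF'.
have ht : 0 <= t <= 1 by rewrite !ltW.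
(* With opposite modes at most 1/4, the dominant modes of V' and W' add up to at most 4/3 of the
   modes of the sum. *)
have quarter : 0 < 1 / 4%:R :> R by rewrite divr_gt0 // ltr0n.
have [|p0 p01 hp] := linsol_small (o := false) hF' ht _ quarter.
  by rewrite /sg /origin; lra.
have [|p1 p11 hp1] := linsol_small (o := true) hF' ht _ quarter.
  by rewrite /sg /origin; lra.
(* V and V' are compared through t = 1, where their bounds start, while the common data sit at 0;
   this uses each constant twice. For W and W' the origin is 0 itself. *)
pose L := K ^+ 2 * K' ^+ 2 + K * K'.
have L0 : 0 < L by rewrite addr_gt0 ?mulr_gt0 ?exprn_gt0.
exists (7%:R * L * (4%:R / 3%:R)), (Num.max (Num.max q0 q0') (Num.max p0 p1)).
split; [by rewrite !mulr_gt0|by rewrite !le_max q01|].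
move=> q V W V' W'; rewrite !ge_max => /andP[/andP[qq0 qq0'] /andP[qp0 qp1]].
move=> hV hW hV' hW' gV gW gV' gW' e0 e1.
have zI : 0 <= (0 : R) <= 1 by rewrite lexx ler01.
have [a1 a2 _] := h q false V qq0 hV gV t ht.
have [_ _ a3] := h q false V qq0 hV gV 0 zI.
have [_ _ b1] := h' q false V' qq0' hV' gV' t ht.
have [_ b2 _] := h' q false V' qq0' hV' gV' 0 zI.
have [c1 c2 _] := h q true W qq0 hW gW t ht.
have [_ _ c3] := h' q true W' qq0' hW' gW' t ht.
have s1 := hp q V' qp0 hV' gV'; have s2 := hp1 q W' qp1 hW' gW'.
have N0 o v := modes_ge0 q o v.
have LV : modes q false (V t) <= L * modes q false (V' t).
  move: a2 a3 b1 b2; set e := expR _; set e' := expR _; rewrite -e0 => a2 a3 b1 b2.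
  have E0 : 0 < e := expR_gt0 _; have E0' : 0 < e' := expR_gt0 _.
  have A1 : modes q false (V 1) * e' <= K * K' * (modes q false (V' 1) * e').
    by apply: le_trans a3 _; rewrite -mulrA ler_wpM2l // ltW.
  have A2 : modes q false (V 1) <= K * K' * modes q false (V' 1).
    by rewrite -(ler_pM2r E0'); apply: le_trans A1 _; rewrite mulrA.
  apply: le_trans (_ : K ^+ 2 * K' ^+ 2 * modes q false (V' t) <= _); last first.
    by rewrite ler_wpM2r // lerDl mulr_ge0 // ltW.
  apply: le_trans a2 _; apply: le_trans (_ : K * (K * K' * (modes q false (V' 1) * e)) <= _).
    rewrite ler_wpM2l ?(ltW K0) // [leRHS]mulrA; apply: ler_wpM2r; [exact: ltW|exact: A2].
  have -> : K ^+ 2 * K' ^+ 2 * modes q false (V' t) = K * (K * K' * (K' * modes q false (V' t))) by ring.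
  by rewrite !ler_wpM2l ?mulr_ge0 ?(ltW K0) ?(ltW K0').
have LW : modes q true (W t) <= L * modes q true (W' t).
  move: c2 c3; rewrite /origin e1; set e := expR _ => c2 c3.
  apply: le_trans (_ : K * K' * modes q true (W' t) <= _); last first.
    by rewrite ler_wpM2r // lerDr mulr_ge0 ?exprn_ge0 // ltW.
  by apply: le_trans c2 _; rewrite -mulrA ler_wpM2l // ltW.
have T : modes q false (V' t) + modes q true (W' t) <=
    4%:R / 3%:R * (modes q true (V' t + W' t) + modes q false (V' t + W' t)).
  have hv : modes q false (V' t) <= modes q false (V' t + W' t) + modes q false (W' t).
    by have := modesD q false (V' t + W' t) (- W' t); rewrite addrK modesN.
  have hw : modes q true (W' t) <= modes q true (V' t + W' t) + modes q true (V' t).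
    by have := modesD q true (V' t + W' t) (- V' t); rewrite addrAC addrN add0r modesN.
  by move: hv hw s1 s2 => /=; lra.
have := modesD q true (V t) (W t); have := modesD q false (V t) (W t).
move: a1 c1 (ler_wpM2l (ltW L0) T) => /= {T b1 b2 c2 c3 s1 s2 a2 a3}.
set T := modes q true (V' t + W' t) + _; rewrite mulrDr => a1 c1 T1 h1 h2.
have -> : 7%:R * L * (4%:R / 3%:R) * T = 7%:R * (L * (4%:R / 3%:R * T)) by ring.
move: LV LW T1; set x := L * _; set y := L * modes q true _; set z := L * _ => LV LW T1; lra.
Qed.

End RaySolutions.

(** * Minors of the fundamental matrix *)

Lemma rev_ord4 : [/\ rev_ord i0 = i3, rev_ord i1 = i2, rev_ord i2 = i1 & rev_ord i3 = i0].
Proof. by split; exact: val_inj. Qed.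

Section SmallDeterminants.
Variable K : comNzRingType.
Implicit Type f : nat -> nat -> K.

Lemma det_expand_first n f : \det (\matrix_(i < n.+1, j < n.+1) f i j) =
  \sum_(j < n.+1) f 0 j * ((-1) ^+ j * \det (\matrix_(i < n, k < n) f i.+1 (bump j k))).
Proof.
rewrite (expand_det_row _ ord0); apply: eq_bigr => j _; rewrite mxE /cofactor add0n.
by congr (_ * (_ * \det _)); apply/matrixP => i k; rewrite !mxE.
Qed.

Lemma det2 f : \det (\matrix_(i < 2, j < 2) f i j) = f 0%N 0%N * f 1%N 1%N - f 0%N 1%N * f 1%N 0%N.
Proof.
by rewrite det_expand_first !big_ord_recl big_ord0 /= !det_mx11 !mxE /bump /=; ring.
Qed.

Lemma det3 f : \det (\matrix_(i < 3, j < 3) f i j) =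
  f 0%N 0%N * (f 1%N 1%N * f 2%N 2%N - f 1%N 2%N * f 2%N 1%N) - f 0%N 1%N * (f 1%N 0%N * f 2%N 2%N - f 1%N 2%N * f 2%N 0%N) +
  f 0%N 2%N * (f 1%N 0%N * f 2%N 1%N - f 1%N 1%N * f 2%N 0%N).
Proof.
rewrite det_expand_first !big_ord_recl big_ord0 /=.
by rewrite !(det2 (fun i k => f i.+1 (bump _ k))) /bump /=; ring.
Qed.

Lemma det4 f : let m a b c := f 1%N a * (f 2%N b * f 3%N c - f 2%N c * f 3%N b) -
    f 1%N b * (f 2%N a * f 3%N c - f 2%N c * f 3%N a) +
    f 1%N c * (f 2%N a * f 3%N b - f 2%N b * f 3%N a) in
  \det (\matrix_(i < 4, j < 4) f i j) = f 0%N 0%N * m 1%N 2%N 3%N - f 0%N 1%N * m 0%N 2%N 3%N +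
    f 0%N 2%N * m 0%N 1%N 3%N - f 0%N 3%N * m 0%N 1%N 2%N.
Proof.
rewrite det_expand_first !big_ord_recl big_ord0 /=.
by rewrite !(det3 (fun i k => f i.+1 (bump _ k))) /bump /=; ring.
Qed.

End SmallDeterminants.

(** * Symplectic algebra and the Pluecker relation *)

Section Symplectic.
Variable K : comNzRingType.
Implicit Type A B : 'M[K]_4.

(** The bilinear form of Lagrange's identity: the relation F^T Omega + Omega F = 0 of [Fmat]
    expresses the formal symmetry of the differential expression. *)
Definition Omega : 'M[K]_4 := \matrix_(i, j) ((i + j == 3)%N%:R * (-1) ^+ i).

Lemma mulmxOmega A k (l : 'I_4) : (A *m Omega) k l = - (-1) ^+ l * A k (rev_ord l).
Proof.
have [e0 e1 e2 e3] := rev_ord4; rewrite mxE sum_I4 !mxE.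
by move: l; apply: I4_cases; rewrite ?e0 ?e1 ?e2 ?e3 /=; ring.
Qed.

Lemma OmegaK : Omega *m Omega = -1%:M.
Proof.
apply/matrixP => i j; rewrite mulmxOmega !mxE.
by move: i j; apply: I4_cases; apply: I4_cases; rewrite /=; ring.
Qed.

Lemma bilin_Omega A B k l : (A *m Omega *m B) k l =
  A k i0 * B i3 l - A k i1 * B i2 l + A k i2 * B i1 l - A k i3 * B i0 l.
Proof.
have [e0 e1 e2 e3] := rev_ord4; rewrite mxE sum_I4 !mulmxOmega e0 e1 e2 e3 /=; ring.
Qed.

(** The inverse of a symplectic matrix. Being linear in the entries, it keeps the transfer matrix
    entire in lambda and of order 1/4. *)
Definition symplectic_inv A := - (Omega *m A^T *m Omega).

Lemma mulmx_symplectic_inv A B k l : (A *m symplectic_inv B) k l = (-1) ^+ l *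
  (A k i0 * B (rev_ord l) i3 - A k i1 * B (rev_ord l) i2 + A k i2 * B (rev_ord l) i1 -
   A k i3 * B (rev_ord l) i0).
Proof.
rewrite /symplectic_inv mulmxN mxE !mulmxA mulmxOmega bilin_Omega ![_^T _ _]mxE.
by rewrite mulNr opprK.
Qed.

Lemma symplectic_mulV A : A^T *m Omega *m A = Omega -> symplectic_inv A *m A = 1%:M.
Proof.
move=> h; rewrite /symplectic_inv mulNmx -!mulmxA [A^T *m _]mulmxA h OmegaK.
by rewrite opprK.
Qed.

Lemma symplectic_mulVr A : A^T *m Omega *m A = Omega -> A *m symplectic_inv A = 1%:M.
Proof. by move=> /symplectic_mulV /mulmx1C. Qed.

Lemma symplectic_tr A : A^T *m Omega *m A = Omega -> A *m Omega *m A^T = Omega.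
Proof.
move=> /symplectic_mulVr; rewrite /symplectic_inv mulmxN => h.
have : A *m (Omega *m A^T *m Omega) *m Omega = - Omega.
  by rewrite -[A *m _]opprK h mulNmx mul1mx.
by rewrite -!mulmxA OmegaK mulmxN mulmx1 !mulmxN => /oppr_inj; rewrite mulmxA.
Qed.

Definition minor01 A (i j : 'I_4) : K := A i0 i * A i1 j - A i0 j * A i1 i.

Lemma minor01_symplectic A : A *m Omega *m A^T = Omega -> minor01 A i1 i2 = minor01 A i0 i3.
Proof.
move=> h; have := congr1 (fun M : 'M[K]_4 => M i0 i1) h; rewrite bilin_Omega !mxE /= mul0r => e.
apply/eqP; rewrite eq_sym -subr_eq0 -e /minor01; apply/eqP; ring.
Qed.

Lemma plucker A : minor01 A i0 i1 * minor01 A i2 i3 - minor01 A i0 i2 * minor01 A i1 i3 +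
  minor01 A i0 i3 * minor01 A i1 i2 = 0.
Proof. by rewrite /minor01; ring. Qed.

End Symplectic.

(** * The fundamental matrix and the characteristic functions *)

Section Fundamental.
Variable R : realType.
Local Notation C := R[i].
Local Open Scope classical_set_scope.
Local Notation I01 := (`[(0 : R), 1]%classic).
Implicit Types (lam : C) (t : R).

Lemma AC_const_of0 (f : R -> C) : abscont f (fun=> 0) -> forall x, 0 <= x <= 1 -> f x = f 0.
Proof.
move=> /abscontE[h1 h2] x hx.
have := RAC_const_of0 h1 hx (introT andP (conj (lexx 0) ler01)).
have := RAC_const_of0 h2 hx (introT andP (conj (lexx 0) ler01)).
by rewrite /cRe /cIm; case: (f x) => a b; case: (f 0) => c d /= -> ->.
Qed.

Section OneProblem.
Variable F : R -> 'M[C]_4.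
Hypothesis hF : hessenberg F.
Hypothesis F_Omega : forall t, (F t)^T *m @Omega C + @Omega C *m F t = 0.

(** The linear forms count quasi-derivatives downwards; [rev_ord] undoes this, so that the matrix is
    the identity at 0. *)
Definition Ymat lam t : 'M[C]_4 := \matrix_(i, j) fund F lam (rev_ord j) t i 0.

Lemma Amat_integrable lam k j : cintegrable I01 (fun t => Amat F lam t k j).
Proof. by have [hi _ _] := hF; exact: pencil_integrable hi _ _ _. Qed.

(** [fund] is chosen by [epsilon]; existence of the solutions makes the choice genuine. *)
Lemma fund_spec lam : is_fund F lam (fund F lam).
Proof.
apply: epsilon_spec.
have /choice[Y hY] : forall k : 'I_4, exists Y, linsol (Amat F lam) Y /\
    Y 0 = \col_i ((rev_ord i == k)%:R : C).
  move=> k; have hg := RAC_prim (integr_mx_sum (Amat_integrable lam)).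
  apply: (linsol_exists (Amat_integrable lam) hg) => //.
  by rewrite set_itv1 Rintegral_set1.
exists Y => k; have [h e] := hY k; split; first exact: h.
by move=> s; rewrite /Uf e mxE rev_ordK.
Qed.

Lemma Ymat0 lam : Ymat lam 0 = 1%:M.
Proof.
apply/matrixP => i j; rewrite !mxE; have [_ /(_ (rev_ord i))] := fund_spec lam (rev_ord j).
by rewrite /Uf rev_ordK => ->; congr (_%:R); congr nat_of_bool; apply/eqP/eqP => [/rev_ord_inj|->].
Qed.

Lemma Ymat_AC lam k j : abscont (fun t => Ymat lam t k j) (fun t => (Amat F lam t *m Ymat lam t) k j).
Proof.
have [h _] := fund_spec lam (rev_ord j).
apply: (AC_ext (h k : abscont _ _)) => t _; first by rewrite mxE.
by rewrite mxE [RHS]mxE; apply: eq_bigr => i _; rewrite [Ymat _ _ _ _]mxE.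
Qed.

Lemma Ymat_linsol lam (a : 'cV[C]_4) : linsol (Amat F lam) (fun t => Ymat lam t *m a).
Proof.
move=> k; apply: (AC_ext (AC_sum (index_enum 'I_4) (fun j => AC_Z (a j 0) (Ymat_AC lam k j)))) => t _.
  by rewrite mxE; apply: eq_bigr => j _; exact: mulrC.
by rewrite mulmxA [RHS]mxE; apply: eq_bigr => j _; exact: mulrC.
Qed.

Lemma Amat_Omega lam t : (Amat F lam t)^T *m @Omega C + @Omega C *m Amat F lam t = 0.
Proof.
rewrite /Amat linearD /= mulmxDl mulmxDr addrACA F_Omega add0r.
have [-> _ _ ->] := inord4.
apply/matrixP => i j; rewrite mxE mulmxOmega [(_ *m (_ *: _)) _ _]mxE sum_I4 !mxE.
by move: i j; apply: I4_cases; apply: I4_cases; rewrite /=; ring.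
Qed.

Lemma Ymat_symplectic lam t : 0 <= t <= 1 ->
  (Ymat lam t)^T *m @Omega C *m Ymat lam t = @Omega C.
Proof.
move=> ht; apply/matrixP => j k; rewrite bilin_Omega.
have h a b := AC_M (Ymat_AC lam a j) (Ymat_AC lam b k).
have hc := AC_B (AC_D (AC_B (h i0 i3) (h i1 i2)) (h i2 i1)) (h i3 i0).
have {}hc : abscont (fun t => Ymat lam t i0 j * Ymat lam t i3 k - Ymat lam t i1 j * Ymat lam t i2 k +
   Ymat lam t i2 j * Ymat lam t i1 k - Ymat lam t i3 j * Ymat lam t i0 k) (fun=> 0).
  apply: (AC_ext hc) => s _ //.
  set Y := Ymat lam s; set Z := Amat F lam s *m Y.
  have e0 : Z^T *m @Omega C *m Y + Y^T *m @Omega C *m Z = 0.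
    rewrite /Z trmx_mul -!mulmxA -mulmxDr [X in _ *m (X + _)]mulmxA [X in _ *m (_ + X)]mulmxA.
    by rewrite -mulmxDl Amat_Omega mul0mx mulmx0.
  have : (Z^T *m @Omega C *m Y + Y^T *m @Omega C *m Z) j k = 0 by rewrite e0 mxE.
  by rewrite mxE !bilin_Omega => <-; rewrite ![_^T _ _]mxE; ring.
have := AC_const_of0 hc ht; rewrite ![_^T _ _]mxE => ->.
rewrite Ymat0; have -> : @Omega C j k = (1%:M^T *m @Omega C *m 1%:M) j k.
  by rewrite trmx1 mul1mx mulmx1.
by rewrite bilin_Omega ![_^T _ _]mxE.
Qed.

Lemma Ymat_inverse lam t : 0 <= t <= 1 ->
  Ymat lam t *m symplectic_inv (Ymat lam t) = 1%:M /\ symplectic_inv (Ymat lam t) *m Ymat lam t = 1%:M.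
Proof.
by move=> ht; split; [apply: symplectic_mulVr|apply: symplectic_mulV]; exact: Ymat_symplectic.
Qed.

Let M i j lam := minor01 (Ymat lam 1) i j.

Lemma zero_le1_le1 : 0 <= (1 : R) <= 1. Proof. by rewrite ler01 lexx. Qed.

Lemma minor12 lam : M i1 i2 lam = M i0 i3 lam.
Proof. exact: minor01_symplectic (symplectic_tr (Ymat_symplectic lam zero_le1_le1)). Qed.

(** The matrix of the boundary forms, with natural-number indices so that [det4] expands it. Its
    first two rows are unit vectors, because the solutions are normalised by U. *)
Let W (a b : nat) lam (k r : nat) : C := match k with
  | 0 => (a == r)%:R | 1 => (b == r)%:R
  | 2 => Ymat lam 1 i1 (rev_ord (inord r)) | _ => Ymat lam 1 i0 (rev_ord (inord r)) end.

Lemma charfunE (a b : nat) lam : (a < 4)%N -> (b < 4)%N ->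
  charfun F (inord a) (inord b) lam = \det (\matrix_(k < 4, r < 4) W a b lam k r).
Proof.
move=> a4 b4; congr (\det _); apply/matrixP => k r; rewrite !mxE /Wform /W.
have U (c : nat) : (c < 4)%N -> Uf (inord c) (fund F lam r) = (c == r)%:R.
  move=> c4; have [_ ->] := fund_spec lam r; congr (_%:R); congr nat_of_bool.
  by rewrite -val_eqE /= inordK.
have [_ _ e2 e3] := inord4; have [r0 r1 r2 r3] := rev_ord4.
case: (nat_of_ord k) => [|[|[|n]]]; rewrite ?U //.
  by rewrite mxE inord_val rev_ordK /Vf e2 r2.
by rewrite mxE inord_val rev_ordK /Vf e3 r3.
Qed.

Lemma charfun_minors lam : [/\ charfun F (inord 0) (inord 1) lam = M i0 i1 lam,
  charfun F (inord 0) (inord 2) lam = - M i0 i2 lam & charfun F (inord 1) (inord 2) lam = M i0 i3 lam].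
Proof.
have [e0 e1 e2 e3] := inord4; have [r0 r1 r2 r3] := rev_ord4.
rewrite !charfunE // !(det4 (W _ _ lam)) /= ?e0 ?e1 ?e2 ?e3 ?r0 ?r1 ?r2 ?r3.
by rewrite /M /minor01; split; ring.
Qed.

Lemma Delta_minors lam : Delta F 2 lam = M i0 i1 lam /\ Delta F 3 lam = Ymat lam 1 i0 i0.
Proof.
have [e0 e1 e2 e3] := inord4; have [r0 r1 r2 r3] := rev_ord4.
have V (k r : 'I_4) : Vf k (fund F lam r) = Ymat lam 1 (rev_ord k) (rev_ord r).
  by rewrite mxE rev_ordK.
split; last first.
  have -> : Delta F 3 lam = \det (\matrix_(s < 1, r < 1) Vf (inord (3 + s)) (fund F lam (inord (3 + r)))) by [].
  by rewrite det_mx11 mxE V /= e3 r3.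
pose f (s r : nat) := Vf (inord (2 + s)) (fund F lam (inord (2 + r))).
have -> : Delta F 2 lam = \det (\matrix_(s < 2, r < 2) f s r) by [].
rewrite det2 /f !V /= e2 e3 r2 r3.
by rewrite /M /minor01; ring.
Qed.

(** If both minors vanish, the Pluecker relation and M_12 = M_03 give M_03 = 0, so Y_00 times row 1
    equals Y_10 times row 0. The entries (1, 2) and (0, 2) of Y Omega Y^T are -1 and 0, which forces
    Y_00 = 0. But M_01 and Y_00 are Delta_22 and Delta_33. *)
Lemma minors_coprime lam : separation F -> ~ (M i0 i1 lam = 0 /\ M i0 i2 lam = 0).
Proof.
move=> sep [h1 h2]; apply: (sep 2 isT lam); have [-> ->] := Delta_minors lam; split=> //.
have h3 : M i0 i3 lam = 0.
  apply/eqP; rewrite -sqrf_eq0; have := plucker (Ymat lam 1).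
  by rewrite -/(M i0 i1 lam) -/(M i0 i2 lam) -/(M i1 i2 lam) -/(M i0 i3 lam) minor12 h1 h2 !mul0r subr0 add0r expr2 => ->.
have hs := symplectic_tr (Ymat_symplectic lam zero_le1_le1).
set Y := Ymat lam 1 in h1 h2 h3 hs *.
apply/eqP; apply/negPn/negP => y00.
have prop (j : 'I_4) : Y i0 i0 * Y i1 j = Y i1 i0 * Y i0 j.
  move: h1 h2 h3; rewrite /M /minor01 -/Y => /subr0_eq h1 /subr0_eq h2 /subr0_eq h3.
  move: j; apply: I4_cases; first exact: mulrC.
  - by rewrite h1 mulrC.
  - by rewrite h2 mulrC.
  - by rewrite h3 mulrC.
have E12 : (Y *m @Omega C *m Y^T) i1 i2 = -1 by rewrite hs !mxE /=; ring.
have E02 : (Y *m @Omega C *m Y^T) i0 i2 = 0 by rewrite hs !mxE /=; ring.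
have : Y i0 i0 * (Y *m @Omega C *m Y^T) i1 i2 = Y i1 i0 * (Y *m @Omega C *m Y^T) i0 i2.
  by rewrite !bilin_Omega !(mulrBr, mulrDr) !mulrA !prop.
by rewrite E12 E02 mulrN1 mulr0 => /eqP; rewrite oppr_eq0 (negPf y00).
Qed.

End OneProblem.
End Fundamental.

Section RayPoints.
Variable R : realType.
Local Notation C := R[i].
Local Open Scope complex_scope.
Implicit Types (q x : R).

Lemma ray_param x q0 : 1 <= q0 -> 4%:R * q0 ^+ 4 <= x -> exists2 q, q0 <= q & (- x)%:C = ray q.
Proof.
move=> q1 hx; have x0 : 0 <= x / 4%:R.
  by rewrite divr_ge0 // (le_trans _ hx) // mulr_ge0 // exprn_ge0 // (le_trans ler01).
exists (Num.sqrt (Num.sqrt (x / 4%:R))).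
  have q00 : 0 <= q0 by exact: le_trans ler01 q1.
  have -> : q0 = Num.sqrt (Num.sqrt (q0 ^+ 4)).
    by rewrite (exprM _ 2 2) sqrtr_sqr ger0_norm ?sqr_ge0 // sqrtr_sqr ger0_norm.
  by rewrite !ler_wsqrtr // ler_pdivlMr // mulrC.
by rewrite /ray (exprM _ 2 2) !sqr_sqrtr ?sqrtr_ge0 //; congr (- _)%:C; field.
Qed.

Lemma normc_ray q : normc (ray q : C) = 4%:R * q ^+ 4.
Proof. by rewrite nc_real normrN ger0_norm // mulr_ge0 // exprn_even_ge0. Qed.

(** The bound q^3 is below |lambda| = 4 q^4, so (f - f 0) / z tends to 0 on the ray and vanishes by
    Phragmen-Lindeloef. The power 3 is the largest that occurs among the entries of the transfer
    matrix. *)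
Lemma ray_cubic_const (f : C -> C) (B q0 : R) : entire f -> growth f -> 1 <= q0 ->
  (forall q, q0 <= q -> normc (f (ray q)) <= B * q ^+ 3) -> forall z, f z = f 0.
Proof.
move=> ef gf q01 hB.
have [h eh hf] := entire_div (entireB ef (entire_cst (f 0))) (subrr (f 0)).
have gh : growth h := growth_div (growthB gf (growth_cst (f 0))) eh hf.
pose D := `|B| + normc (f 0).
have D0 : 0 <= D by rewrite addr_ge0 ?nc_ge0.
have hq q : q0 <= q -> normc (h (ray q)) <= D / q.
  move=> qq; have q1 : 1 <= q by exact: le_trans qq.
  have q_0 : 0 < q by apply: lt_le_trans q1.
  have := congr1 (@normc R) (hf (ray q)); rewrite subr0 normcM normc_ray => e.
  have : 4%:R * q ^+ 4 * normc (h (ray q)) <= D * q ^+ 3.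
    rewrite -e; apply: le_trans (le_normcD _ _) _; rewrite normcN mulrDl; apply: lerD.
      apply: le_trans (hB q qq) _; apply: ler_wpM2r; first by rewrite exprn_ge0 // ltW.
      exact: ler_norm.
    by rewrite ler_peMr ?nc_ge0 // exprn_ege1.
  have -> : 4%:R * q ^+ 4 * normc (h (ray q)) = (4%:R * q * normc (h (ray q))) * q ^+ 3 by ring.
  rewrite ler_pM2r ?exprn_gt0 // => h4; rewrite ler_pdivlMr // mulrC.
  have : 0 <= q * normc (h (ray q)) by rewrite mulr_ge0 ?nc_ge0 // ltW.
  by move: h4; rewrite -mulrA; set u := q * _; lra.
have hc : forall z, h z = h 0.
  apply: (@phragmen_lindelof _ h D (4%:R * q0 ^+ 4) eh gh) => x hx.
  have [q qq ->] := ray_param q01 hx; apply: le_trans (hq q qq) _.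
  have q1 : 1 <= q by exact: le_trans qq.
  by rewrite ler_pdivrMr ?(lt_le_trans ltr01) // ler_peMr.
suff h0 : h 0 = 0 by move=> z; apply/eqP; rewrite -subr_eq0 hf hc h0 mulr0.
apply: nc_small0 => e e0; pose q := Num.max q0 (D / e).
have qq : q0 <= q by rewrite le_max lexx.
have q_0 : 0 < q by apply: lt_le_trans (le_trans q01 qq).
rewrite -(hc (ray q)); apply: le_trans (hq q qq) _.
by rewrite ler_pdivrMr // mulrC -ler_pdivrMr // le_max lexx orbT.
Qed.

End RayPoints.

(** * The plane in terms of its minors *)

Section Kernel.
Variable K : fieldType.
Implicit Types (A : 'M[K]_4) (a : 'cV[K]_4).

(** For A the fundamental matrix at 1, these are the data at 0 of the solutions with y(1) = y^[1](1)
    = 0. *)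
Definition in_plane A a := (A *m a) i0 0 = 0 /\ (A *m a) i1 0 = 0.

Definition col4 (x0 x1 x2 x3 : K) : 'cV[K]_4 := \col_k nth 0 [:: x0; x1; x2; x3] k.

Lemma mulmx_col4 A x0 x1 x2 x3 k : (A *m col4 x0 x1 x2 x3) k 0 =
  A k i0 * x0 + A k i1 * x1 + A k i2 * x2 + A k i3 * x3.
Proof. by rewrite mxE sum_I4 !mxE. Qed.

Lemma in_plane_minors A a : minor01 A i0 i1 != 0 -> in_plane A a <->
  minor01 A i0 i1 * a i1 0 + minor01 A i0 i2 * a i2 0 + minor01 A i0 i3 * a i3 0 = 0 /\
  minor01 A i0 i1 * a i0 0 - minor01 A i1 i2 * a i2 0 - minor01 A i1 i3 * a i3 0 = 0.
Proof.
move=> hM; rewrite /in_plane; set r := (A *m a) i0 0; set s := (A *m a) i1 0.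
have e1 : minor01 A i0 i1 * a i1 0 + minor01 A i0 i2 * a i2 0 + minor01 A i0 i3 * a i3 0 =
    A i0 i0 * s - A i1 i0 * r.
  by rewrite /r /s !mxE !sum_I4 /minor01; ring.
have e2 : minor01 A i0 i1 * a i0 0 - minor01 A i1 i2 * a i2 0 - minor01 A i1 i3 * a i3 0 =
    A i1 i1 * r - A i0 i1 * s.
  by rewrite /r /s !mxE !sum_I4 /minor01; ring.
rewrite e1 e2; split=> [[-> ->]|[h1 h2]]; first by rewrite !mulr0 subr0.
split; apply: (mulfI hM); rewrite mulr0.
  have -> : minor01 A i0 i1 * r = A i0 i0 * (A i1 i1 * r - A i0 i1 * s) + A i0 i1 * (A i0 i0 * s - A i1 i0 * r).
    by rewrite /minor01; ring.
  by rewrite h1 h2 !mulr0 addr0.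
have -> : minor01 A i0 i1 * s = A i1 i0 * (A i1 i1 * r - A i0 i1 * s) + A i1 i1 * (A i0 i0 * s - A i1 i0 * r).
  by rewrite /minor01; ring.
by rewrite h1 h2 !mulr0 addr0.
Qed.

Lemma in_plane_cramer A : in_plane A (col4 (minor01 A i1 i2) (- minor01 A i0 i2) (minor01 A i0 i1) 0) /\
  in_plane A (col4 (minor01 A i1 i3) (- minor01 A i0 i3) 0 (minor01 A i0 i1)).
Proof. by rewrite /in_plane !mulmx_col4 /minor01; split; split; ring. Qed.

End Kernel.

Section RayMinors.
Variable R : realType.
Local Notation C := R[i].
Local Open Scope complex_scope.
Implicit Types (q : R).
Variable F : R -> 'M[C]_4.
Hypothesis hF : hessenberg F.
Hypothesis F_Omega : forall t, (F t)^T *m @Omega C + @Omega C *m F t = 0.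
Let M i j lam := minor01 (Ymat F lam 1) i j.

Lemma Ymat_origin lam (a : 'cV[C]_4) : Ymat F lam 0 *m a = a.
Proof. by rewrite Ymat0 // mul1mx. Qed.

(** The two Cramer vectors of the plane are inserted into [decaying_initial]: the first gives the
    asymptotics of M_03 and M_02, the second the smallness of M_13. *)
Lemma ray_minors (e : R) : 0 < e -> e <= 1 -> exists2 q0, 1 <= q0 & forall q, q0 <= q ->
  [/\ M i0 i1 (ray q) != 0,
      normc (q%:C * M i0 i2 (ray q) - M i0 i1 (ray q)) <= e * normc (M i0 i1 (ray q)),
      normc (2%:R * q%:C ^+ 2 * M i0 i3 (ray q) - M i0 i1 (ray q)) <= e * normc (M i0 i1 (ray q)) &
      normc (M i1 i3 (ray q)) <= e * normc (M i0 i1 (ray q))].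
Proof.
move=> e0 e1; have [q0 q01 hq0] := decaying_initial hF e0.
exists (Num.max q0 e^-1); first by rewrite le_max q01.
move=> q; rewrite ge_max => /andP[qq eq]; have q1 := le_trans q01 qq.
have q_0 : 0 < q by exact: lt_le_trans q1.
set lam := ray q; set A := Ymat F lam 1.
have key a : in_plane A a -> let s := q * normc (a i2 0) + normc (a i3 0) in
    normc (2%:R * q%:C ^+ 3 * a i0 0 - q%:C * a i2 0 - a i3 0) <= e * s /\
    normc (2%:R * q%:C ^+ 3 * a i0 0 + 2%:R * q%:C ^+ 2 * a i1 0 + q%:C * a i2 0) <= e * s.
  by move=> [p0 p1]; have := hq0 q _ qq (Ymat_linsol hF lam a) p0 p1; rewrite !Ymat_origin.
have qC : q%:C != 0 :> C by rewrite -nc_eq0 nc_real gtr0_norm // gt_eqF.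
have two : (2%:R : C) != 0 by rewrite pnatr_eq0.
have zero a : in_plane A a -> a i2 0 = 0 -> a i3 0 = 0 -> a i0 0 = 0 /\ a i1 0 = 0.
  have nc_le0 (z : C) : normc z <= 0 -> z = 0.
    by move=> z0; apply/eqP; rewrite -nc_eq0 eq_le z0 nc_ge0.
  move=> /key[h0 h1] a2 a3; move: h0 h1; rewrite a2 a3 nc0 !mulr0 !addr0 !mulr0 !subr0.
  move=> /nc_le0/eqP; rewrite !mulf_eq0 (negPf two) !(negPf qC) /= => /eqP a0 /nc_le0.
  rewrite a0 mulr0 add0r => /eqP.
  by rewrite !mulf_eq0 (negPf two) !(negPf qC) /= => /eqP.
have M01 : M i0 i1 lam != 0.
  (* If M_01 = 0, the rows of A provide vectors of the plane whose last two entries are 0. By [zero]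
     they vanish, so the left 2x2 block of A is 0; then (1, 0, 0, 0) lies in the plane and
     contradicts [zero]. *)
  apply/eqP => m0.
  have [] := zero (col4 (A i0 i1) (- A i0 i0) 0 0); rewrite ?[col4 _ _ _ _ _ _]mxE //.
    move: m0; rewrite /M /minor01 -/A => m0.
    rewrite /in_plane !mulmx_col4; split; first ring.
    by rewrite -[RHS]oppr0 -[X in _ = - X]m0; ring.
  have [] := zero (col4 (A i1 i1) (- A i1 i0) 0 0); rewrite ?[col4 _ _ _ _ _ _]mxE //.
    move: m0; rewrite /M /minor01 -/A => m0.
    rewrite /in_plane !mulmx_col4; split; last ring.
    by rewrite -[RHS]m0; ring.
  move=> /= a11 /eqP; rewrite oppr_eq0 => /eqP a10 a01 /eqP; rewrite oppr_eq0 => /eqP a00.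
  have [] := zero (col4 1 0 0 0); rewrite ?[col4 _ _ _ _ _ _]mxE //.
    by rewrite /in_plane !mulmx_col4 a00 a10; split; ring.
  by move=> /= /eqP; rewrite oner_eq0.
have [/key/= + /key/=] := in_plane_cramer A; rewrite ![col4 _ _ _ _ _ _]mxE /=.
have m12 := minor12 hF F_Omega lam; rewrite -/A in m12 *; rewrite m12 -/(M i0 i3 lam) in M01 *.
rewrite /M -/A in M01 *; move: M01; set m01 := minor01 A i0 i1; set m02 := minor01 A i0 i2.
set m03 := minor01 A i0 i3; set m13 := minor01 A i1 i3 => M01.
rewrite expr0n /= addr0 sqrtr0 mulr0 addr0 mulr0 add0r !subr0 => -[h1 h2] [h3 _].
have nq : normc (q%:C : C) = q by rewrite nc_real gtr0_norm.
have h4 : normc (2%:R * q%:C ^+ 2 * m03 - m01) <= e * normc m01.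
  rewrite -(ler_pM2l q_0) [leRHS]mulrCA -{1}nq -normcM.
  by rewrite (_ : q%:C * _ = 2%:R * q%:C ^+ 3 * m03 - q%:C * m01) //; ring.
have h5 : normc (2%:R * (q%:C ^+ 2 * m02 - q%:C * m01)) <= 2%:R * (e * (q * normc m01)).
  have -> : 2%:R * (q%:C ^+ 2 * m02 - q%:C * m01) = (2%:R * q%:C ^+ 3 * m03 - q%:C * m01) -
    (2%:R * q%:C ^+ 3 * m03 + 2%:R * q%:C ^+ 2 * - m02 + q%:C * m01) by ring.
  by apply: le_trans (le_normcD _ _) _; rewrite normcN; lra.
split=> //.
- move: h5; rewrite normcM nc_nat ler_pM2l //.
  have -> : q%:C ^+ 2 * m02 - q%:C * m01 = q%:C * (q%:C * m02 - m01) by ring.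
  by rewrite normcM nq mulrCA ler_pM2l.
- have h6 : normc (2%:R * q%:C ^+ 3 * m13) <= 2%:R * normc m01.
    rewrite -[2%:R * q%:C ^+ 3 * m13](subrK m01); apply: le_trans (le_normcD _ _) _.
    have := nc_ge0 m01 => n0; have : e * normc m01 <= 1 * normc m01 by rewrite ler_wpM2r.
    lra.
  move: h6; rewrite -mulrA normcM nc_nat ler_pM2l // normcM ncX nq => h6.
  have n0 := nc_ge0 m13.
  rewrite -ler_pdivrMl //; apply: le_trans h6; rewrite mulrC mulrC ler_wpM2r //.
  apply: le_trans eq _; rewrite -[X in X <= _]expr1; exact: ler_weXn2l.
Qed.

End RayMinors.

(** * Comparing the two problems *)

Section EntireFundamental.
Variable R : realType.
Local Notation C := R[i].
Variable F : R -> 'M[C]_4.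
Hypothesis hF : hessenberg F.

Lemma Ymat_entire t k j : 0 <= t <= 1 -> entire (fun lam => Ymat F lam t k j).
Proof.
move=> ht; have [hi _ _] := hF.
pose e : 'cV[C]_4 := delta_mx j (0 : 'I_1).
have E lam : (Ymat F lam t *m e) k 0 = Ymat F lam t k j by rewrite /e -colE mxE.
have h := @linsol_entire R 4 F (delta_mx (inord 3) (inord 0)) hi
  (fun lam s => Ymat F lam s *m e) e (fun lam => Ymat_linsol hF lam e)
  (fun lam => Ymat_origin hF lam e) t ht k.
by move=> r; apply: (appr_ext _ (h r)) => z _; rewrite E.
Qed.

Lemma Ymat_growth t k j : 0 <= t <= 1 -> growth (fun lam => Ymat F lam t k j).
Proof.
move=> ht; have [hi hh hs] := hF; have [A A0 h] := linsol_growth hi hh hs.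
exists A => // q z q1 zq.
have E : (Ymat F z t *m delta_mx j (0 : 'I_1)) k 0 = Ymat F z t k j by rewrite -colE mxE.
rewrite -E; apply: (h q z _ q1 zq (Ymat_linsol hF z _)) => // i.
rewrite (Ymat_origin hF) mxE; case: (_ && _); by rewrite ?nc1 ?nc0.
Qed.

Lemma minor_entire i j : entire (fun lam => minor01 (Ymat F lam 1) i j).
Proof.
have h a b := Ymat_entire a b (zero_le1_le1 R).
by rewrite /minor01; exact: entireB (entireM (h _ _) (h _ _)) (entireM (h _ _) (h _ _)).
Qed.

Lemma minor_growth i j : growth (fun lam => minor01 (Ymat F lam 1) i j).
Proof.
have h a b := Ymat_growth a b (zero_le1_le1 R).
by rewrite /minor01; exact: growthB (growthM (h _ _) (h _ _)) (growthM (h _ _) (h _ _)).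
Qed.

End EntireFundamental.

(** * Proportionality of the minors *)

Section MinorFamilies.
Variable R : realType.
Local Notation C := R[i].
Local Open Scope complex_scope.
Implicit Types (q : R) (m : 'I_4 -> 'I_4 -> C -> C).

(* Stated for abstract functions [m i j]: on the actual minors of the fundamental matrix, conversion
   would unfold determinants and [epsilon]. *)
Record minor_family m : Prop := MinorFamily {
  family_entire : forall i j, entire (m i j);
  family_growth : forall i j, growth (m i j);
  family_symplectic : forall z, m i1 i2 z = m i0 i3 z;
  family_plucker : forall z,
    m i0 i1 z * m i2 i3 z - m i0 i2 z * m i1 i3 z + m i0 i3 z * m i1 i2 z = 0;
  family_ray : forall e : R, 0 < e -> e <= 1 -> exists2 q0, 1 <= q0 & forall q, q0 <= q ->
    [/\ m i0 i1 (ray q) != 0,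
        normc (q%:C * m i0 i2 (ray q) - m i0 i1 (ray q)) <= e * normc (m i0 i1 (ray q)),
        normc (2%:R * q%:C ^+ 2 * m i0 i3 (ray q) - m i0 i1 (ray q)) <= e * normc (m i0 i1 (ray q)) &
        normc (m i1 i3 (ray q)) <= e * normc (m i0 i1 (ray q))] }.

Lemma nonvanishing_minors m : minor_family m ->
  exists z, [/\ m i0 i1 z != 0, m i0 i2 z != 0 & m i0 i3 z != 0].
Proof.
move=> hm; have [q0 q01 h] := family_ray hm (ltac:(by rewrite divr_gt0) : (0 : R) < 1 / 2) ltac:(lra).
have [a b c _] := h q0 (lexx _); exists (ray q0); rewrite a.
have n0 : 0 < normc (m i0 i1 (ray q0)) by rewrite nc_gt0.
split=> //; apply/eqP => z.
  by move: b; rewrite z mulr0 sub0r normcN; lra.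
by move: c; rewrite z mulr0 sub0r normcN; lra.
Qed.

Variables m m' : 'I_4 -> 'I_4 -> C -> C.
Hypotheses (hm : minor_family m) (hm' : minor_family m').

(** On the ray h / h' and m_01 / m'_01 have the same limit. The dependence of h on q hides the
    factors q and 2 q^2 that normalise M_02 and M_03. *)
Lemma ray_limit_eq (h h' : R -> C -> C) (c c1 : C) : (forall z, m i0 i1 z = c1 * m' i0 i1 z) ->
  (forall z q, h q z = c * h' q z) ->
  (forall e : R, 0 < e -> e <= 1 -> exists2 q0, 1 <= q0 & forall q, q0 <= q ->
     [/\ m' i0 i1 (ray q) != 0, normc (h q (ray q) - m i0 i1 (ray q)) <= e * normc (m i0 i1 (ray q)) &
         normc (h' q (ray q) - m' i0 i1 (ray q)) <= e * normc (m' i0 i1 (ray q))]) -> c = c1.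
Proof.
move=> e1 hc lim; apply/eqP; rewrite -subr_eq0; apply/eqP; apply: nc_small0 => e e0.
pose S := normc c1 + normc c + 1.
have S0 : 0 < S by have := nc_ge0 c1; have := nc_ge0 c; rewrite /S; lra.
pose e' : R := Num.min 1 (e / S).
have e'0 : 0 < e' by rewrite lt_min ltr01 divr_gt0.
have e'1 : e' <= 1 by rewrite ge_min lexx.
have e'e : e' * S <= e by rewrite -ler_pdivlMr // ge_min lexx orbT.
have [q0 _ /(_ q0 (lexx _))[m0 a b]] := lim e' e'0 e'1.
have n0 : 0 < normc (m' i0 i1 (ray q0)) by rewrite nc_gt0.
rewrite -(ler_pM2r n0) -normcM.
have -> : (c - c1) * m' i0 i1 (ray q0) = (h q0 (ray q0) - m i0 i1 (ray q0)) - c * (h' q0 (ray q0) - m' i0 i1 (ray q0)).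
  by rewrite hc e1; ring.
apply: le_trans (le_normcD _ _) _; rewrite normcN normcM.
apply: le_trans (lerD a (ler_wpM2l (nc_ge0 c) b)) _; rewrite e1 normcM.
apply: le_trans (_ : e' * S * normc (m' i0 i1 (ray q0)) <= _); last by rewrite ler_wpM2r // ltW.
have -> : e' * (normc c1 * normc (m' i0 i1 (ray q0))) + normc c * (e' * normc (m' i0 i1 (ray q0))) =
  e' * (normc c1 + normc c) * normc (m' i0 i1 (ray q0)) by ring.
by rewrite ler_wpM2r ?(ltW n0) // ler_wpM2l ?(ltW e'0) // /S lerDl.
Qed.

Lemma proportional_minors : same_spectrum (m i0 i1) (m' i0 i1) ->
  same_spectrum (fun z => - m i0 i2 z) (fun z => - m' i0 i2 z) ->
  same_spectrum (m i0 i3) (m' i0 i3) -> exists2 c : C, c != 0 & forall z,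
  [/\ m i0 i1 z = c * m' i0 i1 z, m i0 i2 z = c * m' i0 i2 z & m i0 i3 z = c * m' i0 i3 z].
Proof.
move=> s1 s2 s3; have [z [z1 z2 z3]] := nonvanishing_minors hm.
have [w [w1 w2 w3]] := nonvanishing_minors hm'.
have [en en'] := (family_entire hm, family_entire hm').
have [gr gr'] := (family_growth hm, family_growth hm').
have [c1 c10 e1] := same_spectrum_proportional (en _ _) (en' _ _) (gr _ _) (gr' _ _)
  (ex_intro _ z z1) (ex_intro _ w w1) s1.
have [c3 _ e3] := same_spectrum_proportional (en _ _) (en' _ _) (gr _ _) (gr' _ _)
  (ex_intro _ z z3) (ex_intro _ w w3) s3.
have [c2 e2] : exists c2, forall z, m i0 i2 z = c2 * m' i0 i2 z.
  have neg (f : C -> C) : (fun z => - f z) = (fun z => 0 - f z).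
    by apply/funext => x; rewrite sub0r.
  rewrite !neg in s2.
  have [||c _ e] := same_spectrum_proportional (entireB (entire_cst 0) (en i0 i2))
    (entireB (entire_cst 0) (en' i0 i2)) (growthB (growth_cst 0) (gr i0 i2))
    (growthB (growth_cst 0) (gr' i0 i2)) _ _ s2.
  - by exists z; rewrite sub0r oppr_eq0.
  - by exists w; rewrite sub0r oppr_eq0.
  by exists c => x; have := e x; rewrite !sub0r mulrN => /oppr_inj.
have E2 : c2 = c1.
  apply: (@ray_limit_eq (fun q x => q%:C * m i0 i2 x) (fun q x => q%:C * m' i0 i2 x)) e1 _ _.
    by move=> x q; rewrite e2; ring.
  move=> e e0 e1'; have [q0 q01 h] := family_ray hm e0 e1'.
  have [p0 p01 h'] := family_ray hm' e0 e1'.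
  exists (Num.max q0 p0) => [|q]; first by rewrite le_max q01.
  by rewrite ge_max => /andP[/h[_ a _ _] /h'[x a' _ _]]; split.
have E3 : c3 = c1.
  apply: (@ray_limit_eq (fun q x => 2%:R * q%:C ^+ 2 * m i0 i3 x)
    (fun q x => 2%:R * q%:C ^+ 2 * m' i0 i3 x)) e1 _ _.
    by move=> x q; rewrite e3; ring.
  move=> e e0 e1'; have [q0 q01 h] := family_ray hm e0 e1'.
  have [p0 p01 h'] := family_ray hm' e0 e1'.
  exists (Num.max q0 p0) => [|q]; first by rewrite le_max q01.
  by rewrite ge_max => /andP[/h[_ _ b _] /h'[x _ b' _]]; split.
by exists c1 => // x; rewrite e1 e2 e3 E2 E3.
Qed.

Lemma proportional_minor13 (c : C) : (forall z, ~ (m i0 i1 z = 0 /\ m i0 i2 z = 0)) -> (forall z,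
  [/\ m i0 i1 z = c * m' i0 i1 z, m i0 i2 z = c * m' i0 i2 z & m i0 i3 z = c * m' i0 i3 z]) ->
  forall z, m i1 i3 z = c * m' i1 i3 z.
Proof.
move=> cop hc z; apply/eqP; rewrite -subr_eq0; apply/eqP; move: z.
have [en en'] := (family_entire hm, family_entire hm').
have [gr gr'] := (family_growth hm, family_growth hm').
apply: (@cofactor_vanish R (fun z => m i1 i3 z - c * m' i1 i3 z) (m i0 i1) (m i0 i2)
  (fun z => m i2 i3 z - c * m' i2 i3 z)).
- exact: entireB (en _ _) (entireM (entire_cst c) (en' _ _)).
- exact: en.
- exact: en.
- exact: entireB (en _ _) (entireM (entire_cst c) (en' _ _)).
- exact: growthB (gr _ _) (growthM (growth_cst c) (gr' _ _)).
- exact: gr.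
(* Subtracting one Pluecker relation from c^2 times the other removes the squares of M_03 and leaves
   the cofactor identity. *)
- move=> z; have := family_plucker hm z; have := family_plucker hm' z.
  rewrite (family_symplectic hm) (family_symplectic hm').
  have [-> -> ->] := hc z => p' p; apply/eqP; rewrite -subr_eq0.
  have -> : (m i1 i3 z - c * m' i1 i3 z) * (c * m' i0 i2 z) - (m i2 i3 z - c * m' i2 i3 z) * (c * m' i0 i1 z) =
    c ^+ 2 * (m' i0 i1 z * m' i2 i3 z - m' i0 i2 z * m' i1 i3 z + m' i0 i3 z * m' i0 i3 z) -
    (c * m' i0 i1 z * m i2 i3 z - c * m' i0 i2 z * m i1 i3 z + c * m' i0 i3 z * (c * m' i0 i3 z)) by ring.
  by rewrite p p' mulr0 subrr.
- by move=> z [h2 h1]; apply: (cop z).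
- move=> e e0; pose e' : R := Num.min 1 (e / 2).
  have e'0 : 0 < e' by rewrite lt_min ltr01 divr_gt0.
  have e'1 : e' <= 1 by rewrite ge_min lexx.
  have e'e : e' <= e / 2 by rewrite ge_min lexx orbT.
  have [q0 q01 h] := family_ray hm e'0 e'1.
  have [p0 p01 h'] := family_ray hm' e'0 e'1.
  have m1 : 1 <= Num.max q0 p0 by rewrite le_max q01.
  exists (4%:R * (Num.max q0 p0) ^+ 4) => x /(ray_param m1)[q + ->].
  rewrite ge_max => /andP[/h[a _ _ b] /h'[_ _ _ b']]; split=> //.
  apply: le_trans (le_normcD _ _) _; rewrite normcN normcM.
  have {}b' : normc c * normc (m' i1 i3 (ray q)) <= e' * normc (m i0 i1 (ray q)).
    have [-> _ _] := hc (ray q); rewrite [normc (c * _)]normcM mulrCA.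
    by rewrite ler_wpM2l ?nc_ge0.
  have n0 := nc_ge0 (m i0 i1 (ray q)).
  apply: le_trans (lerD b b') _; rewrite -mulrDl ler_wpM2r //; lra.
Qed.

End MinorFamilies.

Lemma in_plane_proportional (K : fieldType) (A B : 'M[K]_4) (c : K) (a : 'cV[K]_4) : c != 0 ->
  minor01 A i0 i1 != 0 -> minor01 A i0 i1 = c * minor01 B i0 i1 ->
  minor01 A i0 i2 = c * minor01 B i0 i2 -> minor01 A i0 i3 = c * minor01 B i0 i3 ->
  minor01 A i1 i2 = c * minor01 B i1 i2 -> minor01 A i1 i3 = c * minor01 B i1 i3 ->
  in_plane A a -> in_plane B a.
Proof.
move=> c0 m e1 e2 e3 e4 e5 /(in_plane_minors _ m); rewrite e1 e2 e3 e4 e5 => -[h1 h2].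
have m' : minor01 B i0 i1 != 0 by move: m; rewrite e1 mulf_eq0 negb_or => /andP[].
apply/(in_plane_minors _ m'); split; apply: (mulfI c0); rewrite mulr0.
  by rewrite -h1; ring.
by rewrite -h2; ring.
Qed.

Lemma in_plane_exists (K : fieldType) (A : 'M[K]_4) (x2 x3 : K) : minor01 A i0 i1 != 0 ->
  exists x0 x1, in_plane A (col4 x0 x1 x2 x3).
Proof.
move=> m; exists ((minor01 A i1 i2 * x2 + minor01 A i1 i3 * x3) / minor01 A i0 i1).
exists (- (minor01 A i0 i2 * x2 + minor01 A i0 i3 * x3) / minor01 A i0 i1).
by apply/(in_plane_minors _ m); rewrite !mxE /=; split; field.
Qed.

(** * The transfer matrix on the ray *)

Section TwoProblems.
Variable R : realType.
Local Notation C := R[i].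
Local Open Scope complex_scope.
Implicit Types (q : R).
Variables F F' : R -> 'M[C]_4.
Hypotheses (hF : hessenberg F) (hF' : hessenberg F').
Hypothesis F_Omega : forall t, (F t)^T *m @Omega C + @Omega C *m F t = 0.
Hypothesis F'_Omega : forall t, (F' t)^T *m @Omega C + @Omega C *m F' t = 0.
Hypothesis sepF : separation F.
Hypothesis spec12 : same_spectrum (charfun F (inord 0) (inord 1)) (charfun F' (inord 0) (inord 1)).
Hypothesis spec13 : same_spectrum (charfun F (inord 0) (inord 2)) (charfun F' (inord 0) (inord 2)).
Hypothesis spec23 : same_spectrum (charfun F (inord 1) (inord 2)) (charfun F' (inord 1) (inord 2)).

Definition end_minor (G : R -> 'M[C]_4) i j z := minor01 (Ymat G z 1) i j.

Lemma end_minor_family G : hessenberg G ->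
  (forall t, (G t)^T *m @Omega C + @Omega C *m G t = 0) -> minor_family (end_minor G).
Proof.
move=> hG oG; split.
- exact: minor_entire.
- exact: minor_growth.
- exact: minor12.
- by move=> z; exact: plucker.
- exact: ray_minors.
Qed.

Lemma planes_agree : exists2 c : C, c != 0 & forall z,
  [/\ end_minor F i0 i1 z = c * end_minor F' i0 i1 z, end_minor F i0 i2 z = c * end_minor F' i0 i2 z,
      end_minor F i0 i3 z = c * end_minor F' i0 i3 z, end_minor F i1 i2 z = c * end_minor F' i1 i2 z &
      end_minor F i1 i3 z = c * end_minor F' i1 i3 z].
Proof.
have hm := end_minor_family hF F_Omega; have hm' := end_minor_family hF' F'_Omega.
have E01 G : hessenberg G -> charfun G (inord 0) (inord 1) = end_minor G i0 i1.
  by move=> hG; apply/funext => z; case: (charfun_minors hG z) => [-> _ _].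
have E02 G : hessenberg G -> charfun G (inord 0) (inord 2) = fun z => - end_minor G i0 i2 z.
  by move=> hG; apply/funext => z; case: (charfun_minors hG z) => [_ -> _].
have E12 G : hessenberg G -> charfun G (inord 1) (inord 2) = end_minor G i0 i3.
  by move=> hG; apply/funext => z; case: (charfun_minors hG z) => [_ _ ->].
have [c c0 hc] : exists2 c : C, c != 0 & forall z, [/\ end_minor F i0 i1 z = c * end_minor F' i0 i1 z,
    end_minor F i0 i2 z = c * end_minor F' i0 i2 z & end_minor F i0 i3 z = c * end_minor F' i0 i3 z].
  apply: (proportional_minors hm hm').
  - by have := spec12; rewrite !E01.
  - by have := spec13; rewrite !E02.
  - by have := spec23; rewrite !E12.
have h13 := proportional_minor13 hm hm' (fun z => minors_coprime hF F_Omega sepF) hc.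
exists c => // z; have [e1 e2 e3] := hc z; split.
- exact: e1.
- exact: e2.
- exact: e3.
- by rewrite (family_symplectic hm) (family_symplectic hm') e3.
- exact: h13.
Qed.

(* Carries the solutions of the second problem to those of the first with the same data at 0. *)
Definition transfer lam t : 'M[C]_4 := Ymat F lam t *m symplectic_inv (Ymat F' lam t).

Lemma transferE lam t k l : transfer lam t k l = (-1) ^+ l *
    (Ymat F lam t k i0 * Ymat F' lam t (rev_ord l) i3 - Ymat F lam t k i1 * Ymat F' lam t (rev_ord l) i2 +
     Ymat F lam t k i2 * Ymat F' lam t (rev_ord l) i1 - Ymat F lam t k i3 * Ymat F' lam t (rev_ord l) i0).
Proof. exact: mulmx_symplectic_inv. Qed.

Lemma transfer_entire t k l : 0 <= t <= 1 -> entire (fun lam => transfer lam t k l).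
Proof.
move=> ht; have h a b := Ymat_entire hF a b ht; have h' a b := Ymat_entire hF' a b ht.
under [X in entire X]eq_fun do rewrite transferE.
exact: entireM (entire_cst _) (entireB (entireD (entireB (entireM (h _ _) (h' _ _))
  (entireM (h _ _) (h' _ _))) (entireM (h _ _) (h' _ _))) (entireM (h _ _) (h' _ _))).
Qed.

Lemma transfer_growth t k l : 0 <= t <= 1 -> growth (fun lam => transfer lam t k l).
Proof.
move=> ht; have h a b := Ymat_growth hF a b ht; have h' a b := Ymat_growth hF' a b ht.
under [X in growth X]eq_fun do rewrite transferE.
exact: growthM (growth_cst _) (growthB (growthD (growthB (growthM (h _ _) (h' _ _))
  (growthM (h _ _) (h' _ _))) (growthM (h _ _) (h' _ _))) (growthM (h _ _) (h' _ _))).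
Qed.

(** The solution of the second problem with value w at t has data c at 0, split into a in the common
    plane and b with b_2 = b_3 = 0. For both problems a gives a decaying and b a growing solution,
    which is the situation of [transfer_bound]. *)
Lemma transfer_ray_bound t : 0 < t < 1 -> exists K q0 : R, 1 <= q0 /\ forall q, q0 <= q ->
  forall k l : 'I_4, q ^+ (3 - k) * normc (transfer (ray q) t k l) <= K * q ^+ (3 - l).
Proof.
move=> ht; have [K [q0 [K0 q01 hK]]] := transfer_bound hF hF' ht.
have [p0 p01 hp] := ray_minors hF F_Omega (@ltr01 R) (lexx 1).
exists (K * 4%:R), (Num.max q0 p0); split; first by rewrite le_max q01.
move=> q; rewrite ge_max => /andP[qq pq] k l; have [m01 _ _ _] := hp q pq.
have q_0 : 0 <= q by rewrite (le_trans _ qq) // (le_trans ler01).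
have ht' : 0 <= t <= 1 by move: ht => /andP[/ltW -> /ltW ->].
(* The basis vector w picks out column l of the transfer matrix. *)
set lam := ray q; pose w : 'cV[C]_4 := delta_mx l 0; set c := symplectic_inv (Ymat F' lam t) *m w.
have [x0 [x1 pa]] := in_plane_exists (c i2 0) (c i3 0) m01.
set a := col4 _ _ _ _ in pa.
have pa' : in_plane (Ymat F' lam 1) a.
  have [d d0 /(_ lam)[e1 e2 e3 e4 e5]] := planes_agree.
  exact: (in_plane_proportional d0 m01 e1 e2 e3 e4 e5 pa).
pose b := c - a.
have bE (d : 'cV[C]_4) y0 y1 : (d - col4 y0 y1 (d i2 0) (d i3 0)) i2 0 = 0 /\
    (d - col4 y0 y1 (d i2 0) (d i3 0)) i3 0 = 0 by rewrite !mxE /= !subrr.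
have gW (G : R -> 'M[C]_4) : hessenberg G -> grows true (fun s => Ymat G lam s *m b).
  by move=> hG; rewrite /grows !(Ymat_origin hG); exact: bE.
have o0 (v : 'cV[C]_4) : Ymat F lam 0 *m v = Ymat F' lam 0 *m v.
  exact: etrans (Ymat_origin hF lam v) (esym (Ymat_origin hF' lam v)).
have h := hK q _ _ _ _ qq (Ymat_linsol hF lam a) (Ymat_linsol hF lam b)
  (Ymat_linsol hF' lam a) (Ymat_linsol hF' lam b) pa (gW _ hF) pa' (gW _ hF') (o0 a) (o0 b).
have ab : a + b = c by rewrite /b addrC subrK.
have [i1' _] := Ymat_inverse hF' F'_Omega lam ht'.
have cw : Ymat F' lam t *m a + Ymat F' lam t *m b = w.
  by rewrite -mulmxDr ab /c mulmxA i1' mul1mx.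
have cP : Ymat F lam t *m a + Ymat F lam t *m b = transfer lam t *m w.
  by rewrite -mulmxDr ab /c mulmxA.
have {cw cP}h : modes q true (transfer lam t *m w) + modes q false (transfer lam t *m w) <=
    K * (modes q true w + modes q false w).
  have sub (u u' v v' : 'cV[C]_4) : u = v -> u' = v' ->
    modes q true u + modes q false u <= K * (modes q true u' + modes q false u') ->
    modes q true v + modes q false v <= K * (modes q true v' + modes q false v') by move=> -> ->.
  exact: (sub _ _ _ _ cP cw h).
have E : transfer lam t k l = (transfer lam t *m w) k 0 by rewrite /w -colE [RHS]mxE.
rewrite E; apply: le_trans (modes_lower _ q_0 k) _.
have up o : modes q o w <= 4%:R * q ^+ (3 - l).
  apply: le_trans (modes_upper o w q_0) _; rewrite ler_wpM2l //.
  have nd (d : bool) : normc (d%:R : C) = d%:R by case: d; rewrite ?nc1 ?nc0.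
  rewrite /w !mxE !nd; move: (l); apply: I4_cases; rewrite /= ?subn0 ?subSS ?subn0;
  by rewrite ?(mulr1, mulr0, addr0, add0r) ?expr0 ?expr1.
have := up true; have := up false; move: h; set x := modes _ _ _ + _; set y := modes _ _ _ + _.
move=> h u1 u2; have : K * y <= K * (8%:R * q ^+ (3 - l)) by rewrite ler_wpM2l ?(ltW K0) // /y; lra.
have -> : K * 4%:R * q ^+ (3 - l) = K * (8%:R * q ^+ (3 - l)) / 2 by field.
by lra.
Qed.

(** The bound q^(k - l) never exceeds q^3, so every entry is constant in lambda; for k < l it also
    tends to 0. *)
Lemma transfer_triangular t : 0 < t < 1 -> (forall lam, transfer lam t = transfer 0 t) /\
  forall k l : 'I_4, (k < l)%N -> transfer 0 t k l = 0.
Proof.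
move=> ht; have [K [q0 [q01 hK]]] := transfer_ray_bound ht.
have ht' : 0 <= t <= 1 by move: ht => /andP[/ltW -> /ltW ->].
have c lam k l : transfer lam t k l = transfer 0 t k l.
  apply: (@ray_cubic_const R (fun lam => transfer lam t k l) `|K| q0 (transfer_entire k l ht')
    (transfer_growth k l ht') q01) => q qq.
  have q1 : 1 <= q := le_trans q01 qq.
  apply: le_trans (_ : q ^+ (3 - k) * normc (transfer (ray q) t k l) <= _).
    by rewrite ler_peMl ?nc_ge0 // exprn_ege1.
  apply: le_trans (hK q qq k l) _; apply: le_trans (_ : `|K| * q ^+ (3 - l) <= _).
    by rewrite ler_wpM2r ?ler_norm // exprn_ge0 // (le_trans ler01).
  by rewrite ler_wpM2l // ler_weXn2l // leq_subr.
split=> [lam|k l kl]; first by apply/matrixP => k l; exact: c.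
apply: nc_small0 => e e0; pose q := Num.max q0 (`|K| / e).
have qq : q0 <= q by rewrite le_max lexx.
have q1 : 1 <= q := le_trans q01 qq.
have q_0 : 0 < q by exact: lt_le_trans q1.
have Q : 0 < q ^+ (3 - l) by rewrite exprn_gt0.
rewrite -(c (ray q)); set x := normc _; have x0 : 0 <= x := nc_ge0 _.
have h : q * x * q ^+ (3 - l) <= `|K| * q ^+ (3 - l).
  apply: le_trans (_ : q ^+ (3 - k) * x <= _); last first.
    apply: le_trans (hK q qq k l) _; rewrite ler_wpM2r ?(ltW Q) //; exact: ler_norm.
  have -> : q * x * q ^+ (3 - l) = q ^+ (3 - l).+1 * x by rewrite exprS; ring.
  have kl' : ((3 - l).+1 <= 3 - k)%N by move: kl (ltn_ord l); clear; lia.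
  by rewrite ler_wpM2r // ler_weXn2l.
rewrite (ler_pM2r Q) in h; rewrite -(ler_pM2l q_0); apply: le_trans h _.
by rewrite -ler_pdivrMr // le_max lexx orbT.
Qed.

End TwoProblems.

(** * Reading off the coefficients *)

Section AlmostEverywhere.
Variable R : realType.
Local Notation C := R[i].
Local Open Scope complex_scope.
Local Open Scope classical_set_scope.
Local Notation mu := (@lebesgue_measure R).
Local Notation I01 := (`[(0 : R), 1]%classic).
Implicit Types (f g : R -> C).

Lemma cint_ae_eq (D : set R) f g : measurable D -> cintegrable D f -> cintegrable D g ->
  {ae mu, forall x, D x -> f x = g x} -> cint D f = cint D g.
Proof.
move=> mD [f1 f2] [g1 g2] ae; rewrite /cint /Rintegral; congr (_ +i* _); congr fine.
  apply: ae_eq_integral => //; [exact: measurable_int f1|exact: measurable_int g1|].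
  by move: ae; apply: filterS; [exact: (ae_filter_ringOfSetsType mu)|];
    move=> x h /h; rewrite /= /cRe => ->.
apply: ae_eq_integral => //; [exact: measurable_int f2|exact: measurable_int g2|].
by move: ae; apply: filterS; [exact: (ae_filter_ringOfSetsType mu)|];
  move=> x h /h; rewrite /= /cIm => ->.
Qed.

Lemma AC_ae_const f f' : abscont f f' -> {ae mu, forall x, I01 x -> f' x = 0} ->
  forall x, 0 <= x <= 1 -> f x = f 0.
Proof.
move=> [hi hf] ae x hx; rewrite hf //.
have sub : `[0, x] `<=` I01.
  move=> t /=; rewrite !in_itv /= => /andP[-> tx] /=.
  by apply: le_trans tx _; case/andP: hx.
have hi' : cintegrable `[(0 : R), x]%classic f'.
  by case: hi => h1 h2; split; [apply: integrableS h1|apply: integrableS h2].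
rewrite (@cint_ae_eq _ _ (fun=> 0)) //.
- by rewrite /cint /cRe /cIm /= !Rintegral_cst // !mul0r addr0.
- by split; exact: integrable0.
- move: ae; apply: filterS; first exact: (ae_filter_ringOfSetsType mu).
  by move=> t h /sub /h.
Qed.

(** The ray bound is available for 0 < t < 1 only, since at an end point one of the two cones has
    not yet narrowed; continuity supplies the ends. *)
Lemma AC_zero_interior f f' : abscont f f' -> (forall x, 0 < x < 1 -> f x = 0) ->
  forall x, 0 <= x <= 1 -> f x = 0.
Proof.
move=> hf f0 x hx; apply: nc_small0 => e e0.
have /abscontE[h1 h2] := hf.
have e2 : 0 < e / 2 by rewrite divr_gt0.
have [N hN] := RAC_unif h1 e2; have [N' hN'] := RAC_unif h2 e2.
pose d : R := Num.min (1 / 2) (Num.min N.+1%:R^-1 N'.+1%:R^-1).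
have d0 : 0 < d by rewrite !lt_min divr_gt0 // !invr_gt0 !ltr0Sn.
have d2 : d <= 1 / 2 by rewrite ge_min lexx.
have dN : d <= N.+1%:R^-1 by rewrite !ge_min lexx orbT.
have dN' : d <= N'.+1%:R^-1 by rewrite !ge_min lexx !orbT.
have [y [y0 xy]] : exists y : R, 0 < y < 1 /\ `|x - y| <= d.
  have /andP[x0 x1] := hx; have [xh|xh] := leP x (1 / 2).
    exists (x + d / 2); split; first by apply/andP; split; lra.
    by rewrite ler_norml; apply/andP; split; lra.
  exists (x - d / 2); split; first by apply/andP; split; lra.
  by rewrite ler_norml; apply/andP; split; lra.
have hy : 0 <= y <= 1 by move: y0 => /andP[/ltW -> /ltW ->].
rewrite -[f x]subr0 -(f0 y y0); apply: le_trans (nc_le _) _; rewrite !raddfB /=.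
have := hN x y hx hy (le_trans xy dN); have := hN' x y hx hy (le_trans xy dN').
by rewrite /cRe /cIm; lra.
Qed.

Lemma cintegrableN f : cintegrable I01 f -> cintegrable I01 (fun t => - f t).
Proof.
move=> h; rewrite (_ : (fun t => - f t) = fun t => f t * -1).
  exact: cintegrableM_AC h (AC_cst (-1)).
by apply/funext => t; rewrite mulrN1.
Qed.

Lemma L2_cst (c : C) : L2 (fun=> c).
Proof. by split; [exact: measurable_cst|split; [exact: measurable_cst|exact: (integr_cst (complex.Re c ^+ 2 + complex.Im c ^+ 2))]]. Qed.

Lemma L2_mul_integrable f g : L2 f -> L2 g -> cintegrable I01 (fun t => f t * g t).
Proof.
move=> [mf1 [mf2 hf]] [mg1 [mg2 hg]].
have hb := integrD hf hg; set b := (X in integr X) in hb.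
have bound (a c a' c' : R) : `|a * a' - c * c'| <= (a ^+ 2 + c ^+ 2) + (a' ^+ 2 + c' ^+ 2).
  have := sqr_ge0 (a - a'); have := sqr_ge0 (a + a').
  have := sqr_ge0 (c - c'); have := sqr_ge0 (c + c').
  by rewrite !sqrrB !sqrrD ler_norml => ????; apply/andP; split; lra.
split; apply: (integr_le (b := b)) => //.
- rewrite (_ : cRe _ = fun t => cRe f t * cRe g t - cIm f t * cIm g t).
    by apply: measurable_funB; apply: measurable_funM.
  by apply/funext => t; rewrite /cRe /cIm; case: (f t); case: (g t).
- move=> t _; apply: le_trans (bound (cRe f t) (cIm f t) (cRe g t) (cIm g t)).
  by rewrite /cRe /cIm; case: (f t); case: (g t).
- rewrite (_ : cIm _ = fun t => cRe f t * cIm g t + cIm f t * cRe g t).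
    by apply: measurable_funD; apply: measurable_funM.
  by apply/funext => t; rewrite /cRe /cIm; case: (f t); case: (g t).
- move=> t _; apply: le_trans (le_trans (bound (cRe f t) (- cIm f t) (cIm g t) (cRe g t)) _).
    by rewrite /cRe /cIm; case: (f t) => a c; case: (g t) => a' c' /=; rewrite mulNr opprK.
  by rewrite /b; lra.
Qed.

Lemma L2_integrable f : L2 f -> cintegrable I01 f.
Proof.
move=> hf; rewrite (_ : f = fun t => f t * 1); first exact: L2_mul_integrable hf (L2_cst 1).
by apply/funext => t; rewrite mulr1.
Qed.

Lemma hessenberg_Fmat (t1 t2 : R -> C) : L2 t1 -> L2 t2 -> hessenberg (Fmat t1 t2).
Proof.
move=> h1 h2; have [j1 j2] := (L2_integrable h1, L2_integrable h2); split.
- have c0 := cintegrable_cst (0 : C); have c1 := cintegrable_cst (1 : C).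
  apply: I4_cases; apply: I4_cases; rewrite /Fmat; under [X in cintegrable _ X]eq_fun do rewrite mxE /=.
  all: try by [].
  - exact: cintegrableN.
  - exact: L2_mul_integrable.
  - apply: cintegrableD; first by apply: cintegrableN; exact: L2_mul_integrable.
    exact: L2_mul_integrable (L2_cst _) h2.
  - exact: cintegrableN.
  - exact: L2_mul_integrable.
  - by apply: cintegrableN; exact: L2_mul_integrable.
  - exact: cintegrableN.
- by move=> t; apply: I4_cases; apply: I4_cases => //; rewrite mxE.
- by move=> t; apply: I4_cases; apply: I4_cases => //; rewrite mxE.
Qed.

Lemma Fmat_Omega (t1 t2 : R -> C) x : (Fmat t1 t2 x)^T *m @Omega C + @Omega C *m Fmat t1 t2 x = 0.
Proof.
apply/matrixP => k l; rewrite mxE mulmxOmega [(Omega _ *m _) _ _]mxE sum_I4 !mxE.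
by move: k l; apply: I4_cases; apply: I4_cases; rewrite /=; ring.
Qed.

(** The derivative of order k of a test function is continuously differentiable, hence absolutely
    continuous, which makes both pairings integrable. *)
Lemma distr_deriv_eq_ae k f g : L2 f -> L2 g -> {ae mu, forall x, I01 x -> f x = g x} ->
  distr_deriv_eq k f g.
Proof.
move=> hf hg fg phi [dphi _].
set u := iter k _ phi; set u' := iter k.+1 (@derive1 R R) phi.
have cu' : continuous u'.
  by move=> x; apply: differentiable_continuous; apply/derivable1_diffP; exact: (dphi k.+1 x).
have hu : RAC u u'.
  apply: (RAC_C1 cu') => x; rewrite /u' /= derive1E; apply: derivableP; exact: (dphi k x).
apply: cint_ae_eq => //.
- exact: cintegrableM_AC (L2_integrable hf) (AC_real hu).
- exact: cintegrableM_AC (L2_integrable hg) (AC_real hu).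
- move: fg; apply: filterS; first exact: (ae_filter_ringOfSetsType mu).
  by move=> x h /h ->.
Qed.

End AlmostEverywhere.

Lemma symplectic_invM (K : comNzRingType) (A B : 'M[K]_4) : A^T *m Omega K + Omega K *m A = 0 ->
  symplectic_inv (A *m B) = - (symplectic_inv B *m A).
Proof.
move=> /eqP; rewrite addr_eq0 => /eqP e.
rewrite /symplectic_inv trmx_mul -!mulmxA e !mulmxN opprK mulNmx opprK.
by rewrite !mulmxA.
Qed.

(** The left side is the product rule for Y times the inverse of Y'; [symplectic_invM] supplies the
    derivative of the inverse, so that P' = A P - P A'. *)
Lemma transfer_derivative (K : comNzRingType) (A A' Y Y' : 'M[K]_4) (k l : 'I_4) :
  A'^T *m Omega K + Omega K *m A' = 0 ->
  (-1) ^+ l *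
    ((A *m Y) k i0 * Y' (rev_ord l) i3 + Y k i0 * (A' *m Y') (rev_ord l) i3 -
     ((A *m Y) k i1 * Y' (rev_ord l) i2 + Y k i1 * (A' *m Y') (rev_ord l) i2) +
     ((A *m Y) k i2 * Y' (rev_ord l) i1 + Y k i2 * (A' *m Y') (rev_ord l) i1) -
     ((A *m Y) k i3 * Y' (rev_ord l) i0 + Y k i3 * (A' *m Y') (rev_ord l) i0)) =
  (A *m (Y *m symplectic_inv Y') - Y *m symplectic_inv Y' *m A') k l.
Proof.
move=> h; have e : Y *m symplectic_inv (A' *m Y') = - (Y *m symplectic_inv Y' *m A').
  by rewrite symplectic_invM // mulmxN mulmxA.
rewrite mulmxA -e [RHS]mxE !mulmx_symplectic_inv; ring.
Qed.

Section TransferEquation.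
Variable R : realType.
Local Notation C := R[i].
Variables F F' : R -> 'M[C]_4.
Hypotheses (hF : hessenberg F) (hF' : hessenberg F').
Hypothesis F'_Omega : forall t, (F' t)^T *m @Omega C + @Omega C *m F' t = 0.

Lemma Amat0 (G : R -> 'M[C]_4) t : Amat G 0 t = G t.
Proof. by rewrite /Amat scale0r addr0. Qed.

Lemma transfer0 lam : transfer F F' lam 0 = 1%:M.
Proof.
rewrite /transfer !Ymat0 // mul1mx /symplectic_inv trmx1 mulmx1 OmegaK.
by rewrite opprK.
Qed.

Lemma transfer_AC k l : abscont (fun t => transfer F F' 0 t k l)
  (fun t => (F t *m transfer F F' 0 t - transfer F F' 0 t *m F' t) k l).
Proof.
have h a b c := AC_M (Ymat_AC hF 0 k a) (Ymat_AC hF' 0 b c).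
have hd := AC_Z ((-1) ^+ l) (AC_B (AC_D (AC_B (h i0 (rev_ord l) i3) (h i1 (rev_ord l) i2))
  (h i2 (rev_ord l) i1)) (h i3 (rev_ord l) i0)).
apply: (AC_ext hd) => t _; first by rewrite transferE.
by rewrite !Amat0; exact: transfer_derivative.
Qed.

End TransferEquation.

(** * Solving the triangular equation *)

Section TriangularTransfer.
Variable R : realType.
Local Notation C := R[i].
Local Open Scope complex_scope.
Local Open Scope classical_set_scope.
Local Notation mu := (@lebesgue_measure R).
Local Notation I01 := (`[(0 : R), 1]%classic).
Variables t1 t2 s1 s2 : R -> C.
Variable Q : R -> 'M[C]_4.
Hypothesis hQ : forall k l, abscont (fun t => Q t k l)
  (fun t => (Fmat t1 t2 t *m Q t - Q t *m Fmat s1 s2 t) k l).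
Hypothesis Q0 : Q 0 = 1%:M.
Hypothesis tri : forall t, 0 <= t <= 1 -> forall k l : 'I_4, (k < l)%N -> Q t k l = 0.

Let D t := Fmat t1 t2 t *m Q t - Q t *m Fmat s1 s2 t.

Lemma triQ t : 0 <= t <= 1 -> (Q t i0 i1 = 0) * (Q t i0 i2 = 0) * (Q t i0 i3 = 0) *
  (Q t i1 i2 = 0) * (Q t i1 i3 = 0) * (Q t i2 i3 = 0).
Proof. by move=> ht; rewrite !tri. Qed.

Lemma DE t k l : D t k l = \sum_j Fmat t1 t2 t k j * Q t j l - \sum_j Q t k j * Fmat s1 s2 t j l.
Proof.
have sub (A B : 'M[C]_4) : (A - B) k l = A k l - B k l by rewrite !mxE.
by rewrite /D sub ![(_ *m _) _ _]mxE.
Qed.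

(** An entry just above the diagonal is 0, and its density is the difference of the neighbouring
    diagonal entries. This difference is continuous, so it vanishes everywhere. *)
Lemma Q_diag0 t : 0 <= t <= 1 ->
  (Q t i1 i1 = Q t i0 i0) * (Q t i2 i2 = Q t i0 i0) * (Q t i3 i3 = Q t i0 i0).
Proof.
have sup (k l : 'I_4) : (k < l)%N -> (forall t, 0 <= t <= 1 -> D t k l = Q t l l - Q t k k) ->
    forall t, 0 <= t <= 1 -> Q t l l = Q t k k.
  move=> kl e t' ht; apply/eqP; rewrite -subr_eq0; apply/eqP.
  apply: (AC_cont0 (AC_B (hQ l l) (hQ k k))) ht.
  by apply: (AC_ext (hQ k l)) => s hs; [rewrite tri|exact: e].
have e01 : forall t, 0 <= t <= 1 -> Q t i1 i1 = Q t i0 i0.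
  apply: (sup i0 i1 isT) => s hs; rewrite DE !sum_I4 !mxE /= !(triQ hs); ring.
have e12 : forall t, 0 <= t <= 1 -> Q t i2 i2 = Q t i1 i1.
  apply: (sup i1 i2 isT) => s hs; rewrite DE !sum_I4 !mxE /= !(triQ hs); ring.
have e23 : forall t, 0 <= t <= 1 -> Q t i3 i3 = Q t i2 i2.
  apply: (sup i2 i3 isT) => s hs; rewrite DE !sum_I4 !mxE /= !(triQ hs); ring.
by move=> ht; rewrite e23 // e12 // e01.
Qed.

(** The trace of Q has density 0: with equal diagonal entries the coefficient matrices enter through
    their traces, which are 0, and the entries of Q below the diagonal cancel in pairs. *)
Lemma Q_diag t : 0 <= t <= 1 -> forall k, Q t k k = 1.
Proof.
move=> ht; have h := AC_D (AC_D (AC_D (hQ i0 i0) (hQ i1 i1)) (hQ i2 i2)) (hQ i3 i3).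
have {}h : abscont (fun t => Q t i0 i0 + Q t i1 i1 + Q t i2 i2 + Q t i3 i3) (fun=> 0).
  apply: (AC_ext h) => s hs //; rewrite -!/(D s) !DE !sum_I4 !mxE /=.
  rewrite !(triQ hs) !(Q_diag0 hs); ring.
have := AC_const_of0 h ht; rewrite Q0 !mxE /= !(Q_diag0 ht) => e.
have q0 : Q t i0 i0 = 1.
  have four : (4%:R : C) != 0 by rewrite pnatr_eq0.
  apply: (mulfI four); rewrite mulr1; transitivity (Q t i0 i0 + Q t i0 i0 + Q t i0 i0 + Q t i0 i0).
    by ring.
  by rewrite e; ring.
by apply: I4_cases; rewrite ?(Q_diag0 ht).
Qed.

(** Both coefficient matrices have corner entry 0, so the first diagonal equation retains Q_10
    alone; the last one yields Q_32 in the same way. *)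
Lemma Q10 t : 0 <= t <= 1 -> Q t i1 i0 = 0.
Proof.
apply: (AC_cont0 (hQ i1 i0)); apply: (AC_ext (AC_B (hQ i0 i0) (AC_cst 1))) => s hs.
  by rewrite Q_diag // subrr.
rewrite -/(D s) DE !sum_I4 !mxE /= !Q_diag //; rewrite ?(triQ hs); ring.
Qed.

Lemma Q32 t : 0 <= t <= 1 -> Q t i3 i2 = 0.
Proof.
apply: (AC_cont0 (hQ i3 i2)); apply: (AC_ext (AC_Z (-1) (AC_B (hQ i3 i3) (AC_cst 1)))) => s hs.
  by rewrite Q_diag // subrr mulr0.
rewrite subr0 -/(D s) DE !sum_I4 !mxE /= !Q_diag //; rewrite ?(triQ hs); ring.
Qed.

Let aeF := ae_filter_ringOfSetsType mu.

Lemma I01P (t : R) : I01 t -> 0 <= t <= 1.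
Proof. by rewrite /= in_itv. Qed.

(** Here and in the next two lemmas, an entry already known to be constant has density 0, which
    expresses an entry two steps further down by the coefficients, hence almost everywhere only. *)
Lemma Q21_ae : {ae mu, forall t, I01 t -> Q t i2 i1 = s1 t - t1 t}.
Proof.
have h : abscont (fun=> 0) (fun t => t1 t - s1 t + Q t i2 i1).
  apply: (AC_ext (AC_B (hQ i1 i1) (AC_cst 1))) => s hs; first by rewrite Q_diag // subrr.
  rewrite -/(D s) DE !sum_I4 !mxE /= !Q_diag // Q10 //.
  by rewrite ?(triQ hs); ring.
move: (AC_ae0 h); apply: filterS; first exact: aeF.
by move=> t ht /ht e; apply/eqP; rewrite -subr_eq0 -e; apply/eqP; ring.
Qed.

Lemma Q20_ae : {ae mu, forall t, I01 t -> Q t i2 i0 = t2 t - s2 t}.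
Proof.
have h : abscont (fun=> 0) (fun t => Q t i2 i0 - t2 t + s2 t).
  apply: (AC_ext (hQ i1 i0)) => s hs; first by rewrite Q10.
  rewrite -/(D s) DE !sum_I4 !mxE /= !Q_diag // Q10 //.
  by rewrite ?(triQ hs); ring.
move: (AC_ae0 h); apply: filterS; first exact: aeF.
by move=> t ht /ht e; apply/eqP; rewrite -subr_eq0 -e; apply/eqP; ring.
Qed.

Lemma Q31_ae : {ae mu, forall t, I01 t -> Q t i3 i1 = s2 t - t2 t}.
Proof.
have h : abscont (fun=> 0) (fun t => - Q t i3 i1 - t2 t + s2 t).
  apply: (AC_ext (hQ i3 i2)) => s hs; first by rewrite Q32.
  rewrite -/(D s) DE !sum_I4 !mxE /= !Q_diag // Q32 //.
  by rewrite ?(triQ hs); ring.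
move: (AC_ae0 h); apply: filterS; first exact: aeF.
by move=> t ht /ht e; apply/eqP; rewrite eq_sym -subr_eq0 -e; apply/eqP; ring.
Qed.

(** After substitution of the three relations the density reduces to 2 (t2 - s2) + (s2 - t2) - (t2 -
    s2) = 0, the squares of t1 and s1 having cancelled. As Q_21 = s1 - t1 almost everywhere, this
    settles the first coefficient. *)
Lemma Q21 t : 0 <= t <= 1 -> Q t i2 i1 = 0.
Proof.
move=> ht; rewrite (AC_ae_const (hQ i2 i1) _ ht) ?Q0 ?mxE //.
move: Q21_ae Q20_ae Q31_ae; apply: filterS3; first exact: aeF.
move=> s + + + Is; move=> /(_ Is) e21 /(_ Is) e20 /(_ Is) e31; have hs := I01P Is.
rewrite -/(D s) DE !sum_I4 !mxE /= !Q_diag // e21 e20 e31.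
by rewrite ?(triQ hs); ring.
Qed.

Lemma Q30 t : 0 <= t <= 1 -> Q t i3 i0 = 0.
Proof.
move=> ht; rewrite (AC_ae_const (hQ i3 i0) _ ht) ?Q0 ?mxE //.
move: Q20_ae Q31_ae; apply: filterS2; first exact: aeF.
move=> s + + Is; move=> /(_ Is) e20 /(_ Is) e31; have hs := I01P Is.
rewrite -/(D s) DE !sum_I4 !mxE /= !Q_diag // e20 e31 Q10 // Q32 //; ring.
Qed.

Lemma coefficients_ae : {ae mu, forall t, I01 t -> t1 t = s1 t} /\
  {ae mu, forall t, I01 t -> t2 t = s2 t}.
Proof.
have e1 : {ae mu, forall t, I01 t -> t1 t = s1 t}.
  move: Q21_ae; apply: filterS; first exact: aeF.
  move=> t h It; have := h It; rewrite Q21 ?I01P // => /esym/eqP; rewrite subr_eq0 => /eqP <-.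
  by [].
split=> //.
(* The density of Q_20 cancels once t1 = s1 and Q_21 = Q_30 = 0 are known. *)
have Q20 t : 0 <= t <= 1 -> Q t i2 i0 = 0.
  move=> ht; rewrite (AC_ae_const (hQ i2 i0) _ ht) ?Q0 ?mxE //.
  move: e1 Q20_ae; apply: filterS2; first exact: aeF.
  move=> s + + Is; move=> /(_ Is) e1s /(_ Is) e20; have hs := I01P Is.
  rewrite -/(D s) DE !sum_I4 !mxE /= !Q_diag // e20 Q10 // Q21 // Q30 // e1s ?(triQ hs); ring.
move: Q20_ae; apply: filterS; first exact: aeF.
move=> t h It; have := h It; rewrite Q20 ?I01P // => /esym/eqP; rewrite subr_eq0 => /eqP <-.
by [].
Qed.

End TriangularTransfer.

Theorem theorem2p2 (R : realType) (tau1 tau2 tau1' tau2' : R -> R[i]) :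
  L2 tau1 -> L2 tau2 -> L2 tau1' -> L2 tau2' ->
  separation (Fmat tau1 tau2) -> separation (Fmat tau1' tau2') ->
  same_spectrum (charfun (Fmat tau1 tau2) (inord 0) (inord 1))
                (charfun (Fmat tau1' tau2') (inord 0) (inord 1)) ->
  same_spectrum (charfun (Fmat tau1 tau2) (inord 0) (inord 2))
                (charfun (Fmat tau1' tau2') (inord 0) (inord 2)) ->
  same_spectrum (charfun (Fmat tau1 tau2) (inord 1) (inord 2))
                (charfun (Fmat tau1' tau2') (inord 1) (inord 2)) ->
  distr_deriv_eq 1 tau1 tau1' /\ distr_deriv_eq 2 tau2 tau2'.
Proof.
move=> h1 h2 h1' h2' sep _ sp12 sp13 sp23.
have hF := hessenberg_Fmat h1 h2; have hF' := hessenberg_Fmat h1' h2'.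
have oF := Fmat_Omega tau1 tau2; have oF' := Fmat_Omega tau1' tau2'.
pose Q := transfer (Fmat tau1 tau2) (Fmat tau1' tau2') 0.
have hQ k l : abscont (fun t => Q t k l)
  (fun t => (Fmat tau1 tau2 t *m Q t - Q t *m Fmat tau1' tau2' t) k l).
  exact: transfer_AC.
have Q0 : Q 0 = 1%:M by exact: transfer0.
have tri t : 0 <= t <= 1 -> forall k l : 'I_4, (k < l)%N -> Q t k l = 0.
  move=> ht k l kl; apply: (AC_zero_interior (hQ k l)) ht => s hs.
  by have [_ /(_ k l kl)] := transfer_triangular hF hF' oF oF' sep sp12 sp13 sp23 hs.
have [e1 e2] := coefficients_ae hQ Q0 tri.
by split; apply: distr_deriv_eq_ae.
Qed.
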